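(* Let $\mathbb{X}$ be a set of $6$ distinct points in $\mathbb{P}^2_k$. Then the Jacobian ideal of $I(\mathbb{X})$ is not $\mathcal{VV}$-torsion free if and only if $\mathbb{X}$ is in one of the following configurations: (2) $\mathbb{X}$ is a $6$-fold collinear configuration; (3) $\mathbb{X}$ is a $5$-fold collinear configuration; (7) $\mathbb{X}$ is a $3$-fold collinear configuration such that the remaining three points are collinear and the straight line through them meets the line containing the first three points in a point not in $\mathbb{X}$; (11) $\mathbb{X}$ is contained in an irreducible conic.
   Context: $k$ is an algebraically closed field of characteristic zero and $R=k[x,y,z]$ is the homogeneous coordinate ring of $\mathbb{P}^2_k$. Given integers $s\geq 4$ and $0\leq r\leq s-3$, an $(s-r)$-fold collinear configuration is a set of $s$ distinct points of $\mathbb{P}^2_k$ such that exactly $s-r$ of them lie on a straight line (i.e. there is a line containing exactly $s-r$ of the points). Here $s=6$. For a finite set $\mathbb{X}$ of distinct points, $J=I(\mathbb{X})\subset R$ is its (radical) homogeneous defining ideal. Let $\Theta$ be the Jacobian matrix of a set of homogeneous generators of $J$, and $I_2(\Theta)\subset R$ the ideal generated by its $2\times 2$ minors. Put $I=(J,I_2(\Theta))\subset R$; the Jacobian ideal of $I(\mathbb{X})$ is $I$ (equivalently its image $I/J$ in $R/J$); it does not depend on the choice of generators. The Jacobian ideal is called $\mathcal{VV}$-torsion free if the Valabrega--Valla module $\bigoplus_{t\ge 2}\frac{J\cap I^t}{J I^{t-1}}$ is zero, i.e. if $J\cap I^t=JI^{t-1}$ for all $t\geq 2$. *)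

(* Defs.v *)
From HB Require Import structures.
From mathcomp Require Import all_boot all_order all_algebra.
From mathcomp Require Import finmap mpoly.

Set Implicit Arguments.
Unset Strict Implicit.
Unset Printing Implicit Defensive.

Import GRing.Theory.
Local Open Scope ring_scope.

(* Ideals are Prop-valued predicates on the ring, not ssralg's idealr
   structures, since the latter require a boolean membership test. *)
Section Ideals.
Variable R : comNzRingType.
Implicit Types (S I J : R -> Prop) (f : R).

Definition ideal_gen S f : Prop :=
  exists2 s : seq (R * R),
    (forall cg, cg \in s -> S cg.2) & f = \sum_(cg <- s) cg.1 * cg.2.

Definition ideal_prod I J : R -> Prop :=
  ideal_gen (fun f => exists a b, [/\ I a, J b & f = a * b]).

Definition ideal_pow I (t : nat) : R -> Prop :=
  iter t (ideal_prod I) (fun=> True).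

Definition VV_torsion_free J I : Prop :=
  forall t : nat, (2 <= t)%N -> forall f,
    J f /\ ideal_pow I t f <-> ideal_prod J (ideal_pow I t.-1) f.

End Ideals.

Definition irreducible_elt (R : unitRingType) (q : R) : Prop :=
  q \isn't a GRing.unit /\
  forall a b : R, q = a * b -> a \is a GRing.unit \/ b \is a GRing.unit.

Section Plane.
Variable k : fieldType.

(* A point of the projective plane is a 1-dimensional subspace of k^3, a
   straight line is a 2-dimensional one, and incidence is inclusion. *)
Record subsp (d : nat) := Subsp {
  subsp_val :> {vspace 'rV[k]_3};
  _ : \dim subsp_val == d
}.

HB.instance Definition _ d := [isSub for @subsp_val d].
HB.instance Definition _ d := [Choice of subsp d by <:].

Definition point := subsp 1.
Definition line := subsp 2.

Definition on_line (P : point) (L : line) : bool :=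
  (subsp_val P <= subsp_val L)%VS.

(* Only used for homogeneous f, for which one nonzero v in P is enough. *)
Definition vanishes_at (f : {mpoly k[3]}) (P : point) : Prop :=
  forall v : 'rV[k]_3, v \in subsp_val P -> v != 0 -> f.@[v 0] = 0.

Implicit Types X : {fset point}.

Definition points_ideal X : {mpoly k[3]} -> Prop :=
  ideal_gen (fun f => (exists d, f \is d.-homog) /\
                      forall P, P \in X -> vanishes_at f P).

Definition points_on X (L : line) : {fset point} :=
  [fset P in X | on_line P L]%fset.

Definition fold_collinear (n : nat) X : Prop :=
  exists L : line, #|` points_on X L| = n.

Definition two_collinear_triples X : Prop :=
  exists L M : line,
    [/\ #|` points_on X L| = 3,
        (forall P, P \in X -> ~~ on_line P L -> on_line P M)
      & exists2 Q : point,
          (subsp_val L :&: subsp_val M)%VS = subsp_val Q & Q \notin X].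

Definition on_irreducible_conic X : Prop :=
  exists q : {mpoly k[3]},
    [/\ q \is 2.-homog, irreducible_elt q
      & forall P, P \in X -> vanishes_at q P].

End Plane.

Section JacobianIdeal.
Variables (k : fieldType) (m : nat).
Implicit Types (J : {mpoly k[3]} -> Prop) (F : m.-tuple {mpoly k[3]}).

Definition homog_generators J F : Prop :=
  (forall i : 'I_m, exists d, tnth F i \is d.-homog) /\
  (forall f, J f <-> ideal_gen (fun g => g \in F) f).

Definition jacobian_mx F : 'M[{mpoly k[3]}]_(m, 3) :=
  \matrix_(i < m, j < 3) mderiv j (tnth F i).

Definition minor2 F (g : {mpoly k[3]}) : Prop :=
  exists (r : 'I_2 -> 'I_m) (c : 'I_2 -> 'I_3),
    [/\ {homo r : i j / (i < j)%N}, {homo c : i j / (i < j)%N}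
      & g = \det (mxsub r c (jacobian_mx F))].

Definition jacobian_ideal J F : {mpoly k[3]} -> Prop :=
  ideal_gen (fun g => J g \/ minor2 F g).

End JacobianIdeal.

(* Main.v *)
(* Write J for the ideal of the points and I for the Jacobian ideal. By Euler's
   identity all computations can be made in a frame of k^3, with directional
   derivatives and the dual linear forms.

   When torsion-freeness fails there is an explicit witness in J and I^2 outside JI.
   - If five or six of the points are on the line l = 0, let g be the product of
     the lines joining them to a point q outside (the sixth one if there is one).
     The witness is g h, where h is the Hessian of g in the directions of l = 0.
   - If the points are the complete intersection of a conic q and a cubic c, put
     M = grad q x grad c and N = (grad c)^T adj(H) grad c, with H the Hessian
     matrix of q. Then q(M), which is in I^2, is q N modulo c^2 up to a unit, so
     the witness is q N. Six points on an irreducible conic and two collinear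
     triples are of this type: c is the product of the lines through three pairs
     of points, chosen so that none of these lines lies on the conic.

   If no conic contains the points, the conics through five of them give I = J + m^4,
   and J is generated in degree at most 3, whence J cap m^(4t) = J m^(4(t-1)).
   If exactly four points are on a line l = 0, then I = J + K with
   K = l m^2 + G m + m^5 for a cubic form G; reducing modulo a product of four lines,
   each joining one of these points to one of the two others, leaves multiples of l, which
   are controlled by their restrictions to the two residual points. In the
   remaining cases a conic contains the points, and counting points on its
   components gives one of the four listed configurations. *)

Require Import Defs.
From HB Require Import structures.
From mathcomp Require Import all_boot all_order all_algebra.
From mathcomp Require Import finmap mpoly.
From mathcomp Require Import ring zify.
From Stdlib Require Import Classical_Prop.

Set Implicit Arguments.
Unset Strict Implicit.
Unset Printing Implicit Defensive.

Import GRing.Theory.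
Local Open Scope ring_scope.

(** * Ideals and their powers *)

(** That a witness is outside JI is reduced to first derivatives: in g h = g i + l C with i in I,
    the prime l must divide h - i, and in q N = q i + c j coprimality gives N - i in (c). So h would
    be in the ideal generated by l and two derivatives of g, or N would be in I, which values at the
    points refute. As soon as I = J + K, I^t = J I^(t-1) + K^t, and torsion-freeness only concerns J
    cap K^t. When K is a power of m this is a matter of degrees. With four points on l = 0 it is
    not: K has generators of degrees 3, 4 and 5, and J contains the conic l s, where s = 0 joins the
    two other points. There G is the derivative of the quartic product of lines along the common
    direction of l = 0 and s = 0; s G is, up to sign, a minor of l s and this quartic. As G may
    vanish at one of the four points, a form G^e Q vanishing at all of them is divided only with one
    factor G kept next to Q. *)

Section IdealTheory.
Variable R : comNzRingType.
Implicit Types (S I J K T : R -> Prop) (f g r : R) (t : nat).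

Definition is_ideal T : Prop :=
  [/\ T 0, forall f g, T f -> T g -> T (f + g) & forall r f, T f -> T (r * f)].

Section Closure.
Variables (T : R -> Prop) (idT : is_ideal T).

Lemma idl0 : T 0. Proof. by case: idT. Qed.
Lemma idlD f g : T f -> T g -> T (f + g). Proof. by case: idT => _ + _; apply. Qed.
Lemma idlMl r f : T f -> T (r * f). Proof. by case: idT => _ _; apply. Qed.
Lemma idlMr r f : T f -> T (f * r). Proof. by rewrite mulrC; apply: idlMl. Qed.
Lemma idlN f : T f -> T (- f). Proof. by rewrite -mulN1r; apply: idlMl. Qed.
Lemma idlB f g : T f -> T g -> T (f - g).
Proof. by move=> Tf Tg; apply: idlD => //; apply: idlN. Qed.

Lemma idl_sum (A : Type) (s : seq A) (P : pred A) (F : A -> R) :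
  (forall i, P i -> T (F i)) -> T (\sum_(i <- s | P i) F i).
Proof. by move=> TF; apply: (big_ind T); [apply: idl0 | apply: idlD | ]. Qed.

Lemma idl_sum_seq (A : eqType) (s : seq A) (F : A -> R) :
  (forall i, i \in s -> T (F i)) -> T (\sum_(i <- s) F i).
Proof. by move=> TF; rewrite big_seq_cond; apply: idl_sum => i /andP[/TF]. Qed.

(** With this colon ideal as target, [ideal_gen_sub] proves that products belong to an ideal by
    checking one factor on generators. *)
Lemma idl_colon g : is_ideal (fun f => T (f * g)).
Proof.
split=> [|x y|r x]; rewrite ?mul0r ?mulrDl -?mulrA.
- exact: idl0.
- exact: idlD.
exact: idlMl.
Qed.

End Closure.

Lemma ideal_gen_ideal S : is_ideal (ideal_gen S).
Proof.
split=> [|f g [s1 S1 ->] [s2 S2 ->]|r f [s Ss ->]].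
- by exists [::] => //; rewrite big_nil.
- exists (s1 ++ s2); last by rewrite big_cat.
  by move=> cg; rewrite mem_cat => /orP[/S1|/S2].
exists [seq (r * cg.1, cg.2) | cg <- s].
  by move=> _ /mapP[cg /Ss ? ->].
by rewrite big_map mulr_sumr; apply: eq_bigr => cg _; rewrite mulrA.
Qed.

Lemma mem_ideal_gen S f : S f -> ideal_gen S f.
Proof.
move=> Sf; exists [:: (1, f)]; last by rewrite big_seq1 mul1r.
by move=> cg; rewrite inE => /eqP->.
Qed.

Lemma ideal_gen_sub S T : is_ideal T -> (forall f, S f -> T f) ->
  forall f, ideal_gen S f -> T f.
Proof.
move=> idT ST _ [s Ss ->]; apply: idl_sum_seq => // cg /Ss/ST.
exact: idlMl.
Qed.

Lemma ideal_prod_ideal I J : is_ideal (ideal_prod I J).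
Proof. exact: ideal_gen_ideal. Qed.

Lemma mem_ideal_prod I J f g : I f -> J g -> ideal_prod I J (f * g).
Proof. by move=> If Jg; apply: mem_ideal_gen; exists f, g. Qed.

Lemma ideal_prod_sub I J T : is_ideal T ->
  (forall f g, I f -> J g -> T (f * g)) -> forall f, ideal_prod I J f -> T f.
Proof.
by move=> idT IJT; apply: ideal_gen_sub => // _ [a [b [Ia Jb ->]]]; apply: IJT.
Qed.

Lemma ideal_prodS I J I' J' : (forall f, I f -> I' f) -> (forall f, J f -> J' f) ->
  forall f, ideal_prod I J f -> ideal_prod I' J' f.
Proof.
move=> sI sJ; apply: ideal_prod_sub; first exact: ideal_prod_ideal.
by move=> f g /sI ? /sJ ?; apply: mem_ideal_prod.
Qed.

Lemma ideal_pow_ideal I t : is_ideal (ideal_pow I t).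
Proof. by case: t => [|t]; [split | apply: ideal_prod_ideal]. Qed.

Lemma ideal_powS I I' t : (forall f, I f -> I' f) ->
  forall f, ideal_pow I t f -> ideal_pow I' t f.
Proof. by move=> sI; elim: t => // t IHt; apply: ideal_prodS. Qed.

Lemma ideal_pow1 I f : is_ideal I -> ideal_pow I 1 f <-> I f.
Proof.
move=> idI; split; first by apply: ideal_prod_sub => // a b Ia _; apply: idlMr.
by move=> If; rewrite -[f]mulr1; apply: mem_ideal_prod.
Qed.

Lemma mem_ideal_pow2 I f g : I f -> I g -> ideal_pow I 2 (f * g).
Proof.
move=> If Ig; apply: mem_ideal_prod => //.
by rewrite -[g]mulr1; apply: mem_ideal_prod.
Qed.

Lemma ideal_pow_mul I m n f g : ideal_pow I m f -> ideal_pow I n g ->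
  ideal_pow I (m + n) (f * g).
Proof.
move=> + Ig; elim: m f => [f _|m IHm]; first by apply: idlMl => //; apply: ideal_pow_ideal.
apply: (ideal_prod_sub (T := fun f => ideal_pow I (m.+1 + n) (f * g))) => [|a b Ia Ib].
  exact/idl_colon/ideal_pow_ideal.
by rewrite -mulrA; apply: mem_ideal_prod => //; apply: IHm.
Qed.

Lemma ideal_pow_exp I n f : I f -> ideal_pow I n (f ^+ n).
Proof.
move=> If; elim: n => [//|n IHn].
by rewrite exprS; apply: mem_ideal_prod.
Qed.

Lemma ideal_prod_mul J I m n f g : ideal_prod J (ideal_pow I m) f ->
  ideal_pow I n g -> ideal_prod J (ideal_pow I (m + n)) (f * g).
Proof.
move=> + Ig.
apply: (ideal_prod_sub (T := fun f => ideal_prod J (ideal_pow I (m + n)) (f * g)))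
  => [|a b Ja Ib]; first exact/idl_colon/ideal_prod_ideal.
by rewrite -mulrA; apply: mem_ideal_prod => //; apply: ideal_pow_mul.
Qed.

(** In the expansion of a product of t + 1 elements of J + K, every term with a factor in J falls
    into J I^t, because K is contained in I. *)
Lemma ideal_pow_decomp J K I : is_ideal J -> is_ideal I ->
  (forall f, J f -> I f) -> (forall f, K f -> I f) ->
  (forall f, I f -> exists a b, [/\ J a, K b & f = a + b]) ->
  forall t f, ideal_pow I t.+1 f ->
  exists a b, [/\ ideal_prod J (ideal_pow I t) a, ideal_pow K t.+1 b & f = a + b].
Proof.
move=> idJ idI JI KI IJK; elim=> [|t IHt] f.
  move/(ideal_pow1 _ idI) => /IJK[a [b [Ja Kb ->]]]; exists a, b; split=> //.
    by rewrite -[a]mulr1; apply: mem_ideal_prod.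
  by rewrite -[b]mulr1; apply: mem_ideal_prod.
apply: (@ideal_prod_sub I _ (fun f => exists a b, [/\ ideal_prod J (ideal_pow I t.+1) a,
   ideal_pow K t.+2 b & f = a + b])).
  have idJI := ideal_prod_ideal J (ideal_pow I t.+1).
  have idK := ideal_pow_ideal K t.+2.
  split=> [|x y [a [b [? ? ->]]] [a' [b' [? ? ->]]]|r x [a [b [? ? ->]]]].
  - by exists 0, 0; rewrite addr0; split=> //; apply: idl0.
  - by exists (a + a'), (b + b'); rewrite addrACA; split=> //; apply: idlD.
  by exists (r * a), (r * b); rewrite mulrDr; split=> //; apply: idlMl.
move=> x y /IJK[a [b [Ja Kb ->]]] It; have [c [d [JIc Kd Ey]]] := IHt y It.
exists (a * y + b * c), (b * d); split.
- apply: idlD; [exact: ideal_prod_ideal | exact: mem_ideal_prod |].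
  have := @ideal_prod_mul J I t 1 c b JIc; rewrite addn1 mulrC; apply.
  by apply/ideal_pow1 => //; apply: KI.
- exact: mem_ideal_prod.
by rewrite Ey; ring.
Qed.

(** Modular law: the part of f in J I^t lies in J, so subtracting it leaves an element of J cap
    K^(t+1), the only intersection to be controlled. *)
Lemma VV_torsion_freeI J K I : is_ideal J -> is_ideal I ->
  (forall f, J f -> I f) -> (forall f, K f -> I f) ->
  (forall f, I f -> exists a b, [/\ J a, K b & f = a + b]) ->
  (forall t f, (0 < t)%N -> J f -> ideal_pow K t.+1 f ->
     ideal_prod J (ideal_pow I t) f) ->
  VV_torsion_free J I.
Proof.
move=> idJ idI JI KI IJK JK [|[|t]] // _ f; rewrite [t.+2.-1]/=; split.
  case=> Jf If; have [a [b [JIa Kb Ef]]] := ideal_pow_decomp idJ idI JI KI IJK (t := t.+1) If.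
  rewrite Ef; apply: idlD => //; first exact: ideal_prod_ideal.
  apply: JK => //; have -> : b = f - a by rewrite Ef addrC addKr.
  apply: idlB => //; move: JIa; apply: ideal_prod_sub => // x y Jx _.
  exact: idlMr.
move=> JIf; split; first by move: JIf; apply: ideal_prod_sub => // x y Jx _; apply: idlMr.
by move: JIf; apply: ideal_prodS.
Qed.

Lemma VV_torsion_freePn J I f : is_ideal I ->
  J f -> ideal_pow I 2 f -> ~ ideal_prod J I f -> ~ VV_torsion_free J I.
Proof.
move=> idI Jf I2f JIf VV; apply: JIf.
have [+ _] := VV 2 isT f.
by move=> /(_ (conj Jf I2f)); apply: ideal_prodS => // g; apply: (ideal_pow1 _ idI).1.
Qed.

End IdealTheory.

(** * Forms in three variables and ideals of points *)

Section Vectors.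
Variable A : comNzRingType.
Implicit Types a b c v w : 'rV[A]_3.

Definition i0 : 'I_3 := Ordinal (isT : (0 < 3)%N).
Definition i1 : 'I_3 := Ordinal (isT : (1 < 3)%N).
Definition i2 : 'I_3 := Ordinal (isT : (2 < 3)%N).

Lemma sum3 (V : nmodType) (F : 'I_3 -> V) : \sum_i F i = F i0 + F i1 + F i2.
Proof.
rewrite !big_ord_recl big_ord0 addr0 addrA.
by congr (F _ + F _ + F _); apply: val_inj.
Qed.

Lemma ord3P (P : 'I_3 -> Prop) : P i0 -> P i1 -> P i2 -> forall i, P i.
Proof.
move=> P0 P1 P2 [[|[|[|//]]] lti].
- by have -> : Ordinal lti = i0 by exact: val_inj.
- by have -> : Ordinal lti = i1 by exact: val_inj.
by have -> : Ordinal lti = i2 by exact: val_inj.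
Qed.

Definition dot a v : A := a 0 i0 * v 0 i0 + a 0 i1 * v 0 i1 + a 0 i2 * v 0 i2.

Definition cross a b : 'rV[A]_3 := \row_i
  (if i == i0 then a 0 i1 * b 0 i2 - a 0 i2 * b 0 i1
   else if i == i1 then a 0 i2 * b 0 i0 - a 0 i0 * b 0 i2
   else a 0 i0 * b 0 i1 - a 0 i1 * b 0 i0).

Definition det3 a b c : A := dot (cross a b) c.

Lemma cross0E a b : cross a b 0 i0 = a 0 i1 * b 0 i2 - a 0 i2 * b 0 i1.
Proof. by rewrite mxE. Qed.
Lemma cross1E a b : cross a b 0 i1 = a 0 i2 * b 0 i0 - a 0 i0 * b 0 i2.
Proof. by rewrite mxE. Qed.
Lemma cross2E a b : cross a b 0 i2 = a 0 i0 * b 0 i1 - a 0 i1 * b 0 i0.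
Proof. by rewrite mxE. Qed.
Lemma addvE a b i : (a + b) 0 i = a 0 i + b 0 i. Proof. by rewrite mxE. Qed.
Lemma oppvE a i : (- a) 0 i = - a 0 i. Proof. by rewrite mxE. Qed.
Lemma scalevE x a i : (x *: a) 0 i = x * a 0 i. Proof. by rewrite mxE. Qed.
Lemma zerovE i : (0 : 'rV[A]_3) 0 i = 0. Proof. by rewrite mxE. Qed.
Definition crossE := (cross0E, cross1E, cross2E, addvE, oppvE, scalevE, zerovE).

Lemma rV3P a b : a 0 i0 = b 0 i0 -> a 0 i1 = b 0 i1 -> a 0 i2 = b 0 i2 -> a = b.
Proof. by move=> e0 e1 e2; apply/rowP; apply: ord3P. Qed.

End Vectors.

Ltac vring := rewrite /det3 /dot ?crossE; ring.
Ltac rvring := apply: rV3P; rewrite /det3 /dot ?crossE; ring.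

Section VectorField.
Variable k : fieldType.
Implicit Types a b c u v w : 'rV[k]_3.

Lemma dotC a b : dot a b = dot b a. Proof. vring. Qed.
Lemma dotZr x a b : dot a (x *: b) = x * dot a b. Proof. vring. Qed.
Lemma det3_rot a b c : det3 a b c = det3 b c a. Proof. vring. Qed.
Lemma dot_surj a : a != 0 -> exists v, dot a v = 1.
Proof.
move=> a0; have [i ai0] : exists i, a 0 i != 0.
  apply/existsP; apply: contraR a0 => /existsPn/= H; apply/eqP/rowP => i.
  by rewrite mxE; apply/eqP; have := H i; rewrite negbK.
exists (\row_j (if j == i then (a 0 i)^-1 else 0)).
move: i ai0; apply: ord3P => ai; rewrite /dot !mxE /= ?mulr0 ?add0r ?addr0;
  exact: mulfV.
Qed.

(** Cramer's rule: the cross products of pairs of vectors form the dual frame. *)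
Lemma det3_expand a b c v : det3 a b c *: v =
  dot (cross b c) v *: a + dot (cross c a) v *: b + dot (cross a b) v *: c.
Proof. rvring. Qed.

Lemma crossP a b : a != 0 -> cross a b = 0 -> exists x, b = x *: a.
Proof.
move=> /dot_surj[v av] ab0; exists (dot b v).
have : cross (cross a b) v = dot a v *: b - dot b v *: a by rvring.
rewrite av scale1r ab0 => E; apply/eqP; rewrite -subr_eq0 -E; apply/eqP.
rvring.
Qed.

(* A vector frame of determinant one together with its dual linear forms
   plays the role of a linear change of coordinates. *)
Lemma frame_complete a b : cross a b != 0 -> exists c, det3 a b c = 1.
Proof. exact: dot_surj. Qed.

Lemma cross_surj a : a != 0 -> exists b, cross a b != 0.
Proof.
move=> a0; pose e i := (\row_j (j == i)%:R : 'rV[k]_3).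
case: (eqVneq (cross a (e i0)) 0) => [E0|]; last by exists (e i0).
case: (eqVneq (cross a (e i1)) 0) => [E1|]; last by exists (e i1).
case/eqP: a0; have C i j (E : cross a (e i) = 0) := congr1 (fun w : 'rV[k]_3 => w 0 j) E.
have := (C i0 i1 E0, C i0 i2 E0, C i1 i2 E1); rewrite !crossE !mxE /= !mulr0 !mulr1 !subr0 sub0r.
by move=> [[H1 /eqP]]; rewrite oppr_eq0 => /eqP H2 H3; apply: rV3P; rewrite mxE.
Qed.

Lemma frame_with a : a != 0 -> exists b c, det3 a b c = 1.
Proof. by move=> /cross_surj[b /frame_complete[c abc]]; exists b, c. Qed.

End VectorField.

Notation ev v f := (meval (@fun_of_matrix _ 1 3 v 0) f).

(** * Linear forms, directional derivatives and Euler's identity *)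

Section Forms.
Variable k : fieldType.
Local Notation R := {mpoly k[3]}.
Implicit Types (a b c v w : 'rV[k]_3) (f g h : R) (d n : nat).

Definition lf a : R := \sum_i a 0 i *: 'X_i.

Lemma lfE a : lf a = (a 0 i0)%:MP * 'X_i0 + (a 0 i1)%:MP * 'X_i1 + (a 0 i2)%:MP * 'X_i2.
Proof. by rewrite /lf sum3 !mul_mpolyC. Qed.

Lemma lf_eval a v : ev v (lf a) = dot a v.
Proof. by rewrite lfE !rmorphD !rmorphM /= !mevalC !mevalXU. Qed.

Lemma lf_homog a : lf a \is 1.-homog.
Proof. by apply: rpred_sum => i _; apply: rpredZ; rewrite dhomogX; apply/eqP; exact: mdeg1. Qed.

Lemma lfD a b : lf (a + b) = lf a + lf b.
Proof. by rewrite -big_split; apply: eq_bigr => i _; rewrite mxE scalerDl. Qed.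
Lemma lfZ x a : lf (x *: a) = x%:MP * lf a.
Proof. by rewrite mulr_sumr; apply: eq_bigr => i _; rewrite mxE -scalerA mul_mpolyC. Qed.

Lemma homog1P f : f \is 1.-homog -> exists a, f = lf a.
Proof.
move=> f1; exists (\row_i f@_U_(i)); apply/mpolyP => m.
rewrite /lf raddf_sum /=; case: (eqVneq (mdeg m) 1%N) => [m1|m1]; last first.
  rewrite (dhomog_nemf_coeff f1 m1) big1 // => i _; rewrite mcoeffZ mcoeffX.
  by case: eqP => [E|]; [move: m1; rewrite -E mdeg1 | rewrite mulr0].
have [i ->] : exists i, m = U_(i)%MM by move/eqP: m1 => /mdeg1P[i /eqP ->]; exists i.
rewrite (bigD1 i) //= mcoeffZ mcoeffX eqxx mulr1 mxE big1 ?addr0 // => j ji.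
rewrite mcoeffZ mcoeffX; case: eqP => [/mnmP/(_ i)|_]; last by rewrite mulr0.
by rewrite !mnm1E eqxx (negPf ji).
Qed.

Definition dd v f : R := \sum_i v 0 i *: f^`M(i).

Lemma ddE v f : dd v f = (v 0 i0)%:MP * f^`M(i0) + (v 0 i1)%:MP * f^`M(i1)
  + (v 0 i2)%:MP * f^`M(i2).
Proof. by rewrite /dd sum3 !mul_mpolyC. Qed.

Lemma ddD v f g : dd v (f + g) = dd v f + dd v g.
Proof. by rewrite !ddE !mderivD; ring. Qed.
Lemma ddM v f g : dd v (f * g) = dd v f * g + f * dd v g.
Proof. by rewrite !ddE !mderivM; ring. Qed.
Lemma ddC v (x : k) : dd v x%:MP = 0.
Proof. by rewrite ddE !mderivC !mulr0 !addr0. Qed.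
Lemma dd0 v : dd v 0 = 0.
Proof. by rewrite -(mpolyC0 3 k) ddC. Qed.
Lemma dd_comm v w f : dd v (dd w f) = dd w (dd v f).
Proof.
rewrite !ddE !mderivD !mderiv_mulC [f^`M(i1)^`M(i0)]mderiv_comm.
by rewrite [f^`M(i2)^`M(i0)]mderiv_comm [f^`M(i2)^`M(i1)]mderiv_comm; ring.
Qed.
Lemma ddDv v w f : dd (v + w) f = dd v f + dd w f.
Proof. by rewrite !ddE !mxE; ring. Qed.
Lemma ddZv x v f : dd (x *: v) f = x%:MP * dd v f.
Proof. by rewrite !ddE !mxE; ring. Qed.

Lemma mderivXU i j : ('X_i : R)^`M(j) = (i == j)%:R.
Proof.
rewrite mderivX mnm1E; case: eqP => [->|_]; last by rewrite scale0r.
have -> : (U_(j) - U_(j) = 0 :> 'X_{1..3})%MM by apply/mnmP => l; rewrite mnmBE subnn mnm0E.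
by rewrite scale1r mpolyX0.
Qed.

Lemma dd_lf v a : dd v (lf a) = (dot a v)%:MP.
Proof.
rewrite lfE !ddD !ddM !ddC !ddE !mderivXU /= /dot.
ring.
Qed.

Lemma dd_homog v d f : f \is d.-homog -> dd v f \is d.-1.-homog.
Proof.
move=> fd; apply: rpred_sum => i _; apply: rpredZ; apply/dhomogP => m.
rewrite mcoeff_msupp mcoeff_mderiv => nz.
have : f@_(m + U_(i)) != 0 by apply: contraNneq nz => ->; rewrite mul0rn.
rewrite -mcoeff_msupp => /(dhomog_mf fd) /= <-.
by rewrite mdegD mdeg1 addn1.
Qed.

Lemma euler d f : f \is d.-homog ->
  'X_i0 * f^`M(i0) + 'X_i1 * f^`M(i1) + 'X_i2 * f^`M(i2) = d%:R * f.
Proof.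
move=> fd; rewrite -(sum3 (fun i => 'X_i * f^`M(i))).
have E i : 'X_i * f^`M(i) = \sum_(m <- msupp f) f@_m *: ('X_i * 'X_[m]^`M(i)).
  rewrite {1}[f]mpolyE raddf_sum /= mulr_sumr; apply: eq_bigr => m _.
  by rewrite mderivZ scalerAr.
rewrite (eq_bigr _ (fun i _ => E i)) exchange_big /= [in RHS](mpolyE f) mulr_sumr.
rewrite big_seq [RHS]big_seq; apply: eq_bigr => m /(dhomog_mf fd) /= <-.
under eq_bigr => i _ do rewrite mderivX.
rewrite -scaler_sumr -scalerAr; congr (_ *: _).
rewrite mdegE natr_sum mulr_suml.
 apply: eq_bigr => i _.
case: (posnP (m i)) => [->|mi]; first by rewrite scale0r mulr0 mul0r.
rewrite -scalerAr -mpolyXD addmC submK ?scaler_nat ?mulr_natl //.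
by rewrite lep1mP -lt0n.
Qed.

Definition framed (e0 e1 e2 : 'rV[k]_3) : Prop := det3 e0 e1 e2 = 1.

Section Frame.
Variables (e0 e1 e2 : 'rV[k]_3) (fr : framed e0 e1 e2).
Local Notation x0 := (lf (cross e1 e2)).
Local Notation x1 := (lf (cross e2 e0)).
Local Notation x2 := (lf (cross e0 e1)).

Lemma frame_rot : framed e1 e2 e0.
Proof. by rewrite /framed -det3_rot. Qed.

Lemma frame_expand v :
  v = dot (cross e1 e2) v *: e0 + dot (cross e2 e0) v *: e1 + dot (cross e0 e1) v *: e2.
Proof. by rewrite -det3_expand fr scale1r. Qed.

Lemma frame_lf a : lf a = (dot a e0)%:MP * x0 + (dot a e1)%:MP * x1 + (dot a e2)%:MP * x2.
Proof.
rewrite -!lfZ -!lfD; congr lf; rewrite -[a]scale1r -[in LHS]fr; rvring.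
Qed.

Lemma frame_euler d f : f \is d.-homog ->
  x0 * dd e0 f + x1 * dd e1 f + x2 * dd e2 f = d%:R * f.
Proof.
move=> /euler <-; rewrite -[RHS]mul1r -(mpolyC1 3 k) -[X in X%:MP * _]fr.
by rewrite !lfE !ddE /det3 /dot !crossE; ring.
Qed.

Lemma frame_euler_ev d f v : f \is d.-homog ->
  ev v x0 * ev v (dd e0 f) + ev v x1 * ev v (dd e1 f) + ev v x2 * ev v (dd e2 f)
  = d%:R * ev v f.
Proof.
by move=> fd; rewrite -!rmorphM -!rmorphD /= (frame_euler fd) rmorphM rmorph_nat.
Qed.

Lemma frame_mderiv i f : f^`M(i) =
  (cross e1 e2 0 i)%:MP * dd e0 f + (cross e2 e0 0 i)%:MP * dd e1 f
  + (cross e0 e1 0 i)%:MP * dd e2 f.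
Proof.
rewrite -[LHS]mul1r -[X in X * _ = _](mpolyC1 3 k) -[X in X%:MP * _ = _]fr !ddE.
by move: i; apply: ord3P; rewrite /det3 /dot !crossE; ring.
Qed.

End Frame.

Lemma homog_eval d f x v : f \is d.-homog -> ev (x *: v) f = x ^+ d * ev v f.
Proof.
move=> fd; rewrite !mevalE mulr_sumr !big_seq; apply: eq_bigr => m /(dhomog_mf fd) <-.
rewrite mulrCA; congr (_ * _); under eq_bigr => i _ do rewrite mxE exprMn.
by rewrite big_split /= -expr_sum mdegE.
Qed.

(** Used to truncate the cofactors of homogeneous generators to the degrees that homogeneity
    prescribes; a cofactor of negative degree becomes zero. *)
Lemma pihomogM d n f g : g \is n.-homog ->
  pihomog mdeg d (f * g) = (if (n <= d)%N then pihomog mdeg (d - n) f else 0) * g.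
Proof.
(* [K] also exceeds [d], so that the index d - n occurs in the sum even when [f] has no component
   there. *)
move=> gn; pose K := maxn (mmeasure mdeg f) d.+1.
rewrite {1}(pihomog_partitionE (mf := mdeg) (k := K) (p := f)) ?leq_maxl //.
rewrite mulr_suml raddf_sum /=.
have E (i : 'I_K) : pihomog mdeg d (pihomog mdeg i f * g) =
    if (i + n)%N == d then pihomog mdeg i f * g else 0.
  have H : pihomog mdeg i f * g \is (i + n).-homog.
    by apply: dhomogM => //; apply: pihomogP.
  case: eqP => [<-|/eqP ne]; first by rewrite pihomog_dE.
  by rewrite (pihomog_ne0 _ H) // eq_sym.
rewrite (eq_bigr _ (fun i _ => E i)) -big_mkcond /=.
case: leqP => [nd|dn]; last first.
  by rewrite mul0r big1 // => i /eqP E'; move: dn; rewrite -E' ltnNge leq_addl.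
have dK : (d - n < K)%N by rewrite leq_max ltnS leq_subr orbT.
rewrite (bigD1 (Ordinal dK)) /= ?subnK // big1 ?addr0 // => i /andP[/eqP iE].
by case/eqP; apply: val_inj; rewrite /= -iE addnK.
Qed.

End Forms.

(** * Decompositions of forms vanishing at given points *)

Section FormIdeals.
Variables (k : fieldType) (k_char0 : [pchar k]%R =i pred0).
Local Notation R := {mpoly k[3]}.
Implicit Types (a b c m p v w : 'rV[k]_3) (f g h q : R) (d n : nat).

Lemma natS_neq0 n : (n.+1)%:R != 0 :> k.
Proof. by rewrite (pcharf0P k).1. Qed.

Lemma eq_divC (x : k) f g : x != 0 -> x%:MP * f = g -> f = x^-1%:MP * g.
Proof. by move=> x0 <-; rewrite mulrA -mpolyCM mulVf // mpolyC1 mul1r. Qed.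

Lemma homog0P f : f \is 0.-homog -> exists x, f = x%:MP.
Proof.
move=> f0; exists f@_0; apply/mpolyP => m; rewrite mcoeffC.
case: eqVneq => [->|m0]; first by rewrite mulr1.
by rewrite (dhomog_nemf_coeff f0) ?mulr0 //= mdeg_eq0.
Qed.

Lemma homogC (x : k) : x%:MP \is [in k[3], 0.-homog].
Proof. by rewrite -[x%:MP]mulr1 mul_mpolyC rpredZ // dhomog1. Qed.

Section Frame.
Variables (e0 e1 e2 : 'rV[k]_3) (fr : framed e0 e1 e2).
Local Notation x0 := (lf (cross e1 e2)).
Local Notation x1 := (lf (cross e2 e0)).
Local Notation x2 := (lf (cross e0 e1)).

(** The cofactors are the derivatives divided by the degree d + 1: Euler's identity in
    characteristic zero. *)
Lemma homog_split d f : f \is d.+1.-homog ->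
  exists f0 f1 f2, [/\ f = x0 * f0 + x1 * f1 + x2 * f2,
    f0 \is d.-homog, f1 \is d.-homog & f2 \is d.-homog].
Proof.
move=> fd; pose y := (d.+1%:R : k)^-1%:MP_[3].
have hy e : y * dd e f \is d.-homog.
  by rewrite mul_mpolyC rpredZ // (dd_homog e fd).
exists (y * dd e0 f), (y * dd e1 f), (y * dd e2 f); split=> //.
rewrite [LHS](@eq_divC d.+1%:R _ (x0 * dd e0 f + x1 * dd e1 f + x2 * dd e2 f)) -/y.
- by ring.
- exact: natS_neq0.
by rewrite (frame_euler fr fd) mpolyC_nat.
Qed.

(** At [e0] Euler's identity reduces to its first term, so [dd e0 f] vanishes there as well and the
    induction on the degree applies to it. *)
Lemma point_ideal d f : f \is d.-homog -> ev e0 f = 0 ->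
  exists A B, f = x1 * A + x2 * B.
Proof.
elim: d f => [|d IHd] f fd f0.
  have [x fx] := homog0P fd; exists 0, 0; rewrite !mulr0 addr0.
  by move: f0; rewrite fx mevalC => ->; rewrite mpolyC0.
have E := frame_euler fr fd.
have [||A [B EAB]] := IHd (dd e0 f); first exact: (dd_homog e0 fd).
  have := congr1 (fun g => ev e0 g) E; rewrite !rmorphD !rmorphM /= !lf_eval f0 mulr0.
  have -> : dot (cross e1 e2) e0 = 1 by rewrite -fr; vring.
  have -> : dot (cross e2 e0) e0 = 0 by vring.
  have -> : dot (cross e0 e1) e0 = 0 by vring.
  by rewrite mul1r !mul0r !addr0.
pose y := (d.+1%:R : k)^-1%:MP_[3].
exists (y * (x0 * A + dd e1 f)), (y * (x0 * B + dd e2 f)).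
rewrite [LHS](@eq_divC d.+1%:R _ (x0 * dd e0 f + x1 * dd e1 f + x2 * dd e2 f)) -/y.
- by rewrite EAB; ring.
- exact: natS_neq0.
by rewrite E mpolyC_nat.
Qed.

End Frame.

Lemma orth2P a m p : cross a m != 0 -> dot a p = 0 -> dot m p = 0 ->
  exists x, p = x *: cross a m.
Proof.
move=> am ap mp; apply: crossP => //.
have -> : cross (cross a m) p = dot a p *: m - dot m p *: a by rvring.
by rewrite ap mp !scale0r subr0.
Qed.

Lemma two_forms_ideal a m p d f : cross a m != 0 -> dot a p = 0 -> dot m p = 0 ->
  p != 0 -> f \is d.-homog -> ev p f = 0 -> exists A B, f = lf a * A + lf m * B.
Proof.
move=> am ap mp p0 fd fp; have [c amc] := frame_complete am.
(* The reciprocal frame: its determinant is the square of that of (a, m, c), and [lf a] and [lf m]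
   are two of its dual forms. *)
have fr : framed (cross a m) (cross m c) (cross c a).
  transitivity (det3 a m c ^+ 2); last by rewrite amc expr1n.
  vring.
have fe : ev (cross a m) f = 0.
  have [x Ex] := orth2P am ap mp; move: fp; rewrite Ex (homog_eval _ _ fd).
  move/eqP; rewrite mulf_eq0 expf_eq0 => /orP[/andP[_ /eqP x0]|/eqP //].
  by move: p0; rewrite Ex x0 scale0r eqxx.
have [A [B ->]] := point_ideal fr fd fe; exists A, B; congr (lf _ * _ + lf _ * _).
  by rewrite -[RHS]scale1r -amc; rvring.
by rewrite -[RHS]scale1r -amc; rvring.
Qed.

Lemma homog_quot n g d f A B : g \is n.-homog -> f \is d.-homog ->
  forall q e, q \is e.-homog -> f = q * A + g * B ->
  f = q * (if (e <= d)%N then pihomog mdeg (d - e) A else 0)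
    + g * (if (n <= d)%N then pihomog mdeg (d - n) B else 0).
Proof.
move=> gn fd q e qe E; rewrite -[LHS](pihomog_dE fd) {1}E raddfD /=.
by rewrite ![_ * A]mulrC ![_ * B]mulrC (pihomogM _ _ qe) (pihomogM _ _ gn) ![_ * q]mulrC ![_ * g]mulrC.
Qed.

(** At the points of the later chunks [q] vanishes and the line of the first chunk does not, so the
    cofactor of that line vanishes there and can be decomposed in turn. It is applied with [q] a
    line or a conic. *)
Lemma chunk_decomp q n (s : seq ('rV[k]_3 * seq 'rV[k]_3)) : q \is n.-homog ->
  (forall mc p, mc \in s -> p \in mc.2 -> ev p q = 0) ->
  (forall mc d f, mc \in s -> f \is d.-homog -> (forall p, p \in mc.2 -> ev p f = 0) ->
     exists A B, f = q * A + lf mc.1 * B) ->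
  pairwise (fun mc mc' : 'rV[k]_3 * seq 'rV[k]_3 => all (fun p => dot mc.1 p != 0) mc'.2) s ->
  forall d f, f \is d.-homog -> (forall mc p, mc \in s -> p \in mc.2 -> ev p f = 0) ->
  exists A B, f = q * A + (\prod_(mc <- s) lf mc.1) * B.
Proof.
move=> qn; elim: s => [|[m c] s IHs] q0 step /= pw d f fd f0.
  by exists 0, f; rewrite big_nil mulr0 add0r mul1r.
have [||A [B E]] := step (m, c) d f _ fd; first exact: mem_head.
  by move=> p pc; apply: (f0 (m, c)); rewrite ?mem_head.
have := homog_quot (lf_homog m) fd qn E; set A' := (X in q * X); set B' := (X in _ + _ * X).
move=> /= E'; have B'h : B' \is d.-1.-homog.
  by rewrite /B'; case: d {fd E A' B' E'} => [|d] /=; rewrite ?rpred0 // subn1 pihomogP.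
case/andP: pw => /allP mp pw.
have [|||A1 [B1 EB]] := IHs _ _ pw d.-1 B' B'h.
- by move=> mc p mcs; apply: q0; rewrite inE mcs orbT.
- by move=> mc d' f' mcs; apply: step; rewrite inE mcs orbT.
- move=> mc p mcs pmc.
  have := f0 mc p; rewrite inE mcs orbT => /(_ isT pmc).
  rewrite E' rmorphD !rmorphM /= (q0 mc) ?inE ?mcs ?orbT // mul0r add0r lf_eval => /eqP.
  rewrite mulf_eq0 => /orP[/eqP z|/eqP //].
  by have /allP/(_ _ pmc) := mp _ mcs; rewrite z eqxx.
exists (A' + lf m * A1), B1; rewrite big_cons /= E' EB; ring.
Qed.

Lemma comp_mpoly_mod (T : R -> Prop) (y : 3.-tuple R) f : is_ideal T ->
  (forall i, T ('X_i - tnth y i)) -> T (f - (f \mPo y)).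
Proof.
move=> idT Ty.
have TM g h : T (g - (g \mPo y)) -> T (h - (h \mPo y)) -> T (g * h - (g * h \mPo y)).
  move=> Tg Th; rewrite rmorphM /=.
  have -> : g * h - (g \mPo y) * (h \mPo y) = (g - (g \mPo y)) * h + (g \mPo y) * (h - (h \mPo y)).
    by ring.
  by apply: (idlD idT); [apply: (idlMr idT) | apply: (idlMl idT)].
have TC x : T (x%:MP - (x%:MP \mPo y)) by rewrite comp_mpolyC subrr; apply: (idl0 idT).
have TD g h : T (g - (g \mPo y)) -> T (h - (h \mPo y)) -> T (g + h - (g + h \mPo y)).
  by move=> Tg Th; rewrite rmorphD /= opprD addrACA; apply: (idlD idT).
rewrite [f]mpolyE; apply: (big_ind (fun f => T (f - (f \mPo y)))) => [|? ? ? ?|m _].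
- by rewrite -(mpolyC0 3 k); apply: TC.
- exact: TD.
rewrite -mul_mpolyC; apply: (TM) => //.
rewrite mpolyXE_id; apply: (big_ind (fun f => T (f - (f \mPo y)))) => [|? ? ? ?|i _].
- by rewrite -(mpolyC1 3 k); apply: TC.
- exact: TM.
elim: (m i) => [|j IHj]; first by rewrite expr0 -(mpolyC1 3 k); apply: TC.
by rewrite exprS; apply: (TM) => //; rewrite comp_mpolyXU -tnth_nth.
Qed.

Lemma principal_ideal (q : R) : is_ideal (fun f => exists u, f = q * u).
Proof.
split=> [|x z [x' ->] [z' ->]|r x [x' ->]].
- by exists 0; rewrite mulr0.
- by exists (x' + z'); rewrite mulrDr.
by exists (r * x'); ring.
Qed.

(** The substitution [y] is the projection onto the plane a = 0 along [e]. It kills [lf a] and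
    changes nothing modulo [lf a], so the claim follows from the absence of zero divisors. *)
Lemma lf_prime a f g h : a != 0 -> f * g = lf a * h ->
  (exists u, f = lf a * u) \/ (exists u, g = lf a * u).
Proof.
move=> a0; have [e ae] := dot_surj a0.
pose y : 3.-tuple R := [tuple 'X_i - (e 0 i)%:MP * lf a | i < 3].
have dv u : exists u', u - (u \mPo y) = lf a * u'.
  have idT := principal_ideal (lf a); apply: (comp_mpoly_mod u idT) => i.
  by exists (e 0 i)%:MP; rewrite tnth_mktuple; ring.
have la : lf a \mPo y = 0.
  rewrite {1}lfE !rmorphD !rmorphM /= !comp_mpolyC !comp_mpolyXU -!tnth_nth !tnth_mktuple.
  transitivity (lf a - (dot a e)%:MP * lf a); last by rewrite ae mpolyC1 mul1r subrr.
  by rewrite /dot lfE; ring.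
move=> E; have := congr1 (fun z => z \mPo y) E; rewrite !rmorphM /= la mul0r => /eqP.
rewrite mulf_eq0 => /orP[]/eqP z; [left; have := dv f | right; have := dv g];
  by rewrite z subr0.
Qed.

End FormIdeals.

(** * The ideal of the points and the Jacobian ideal, free of coordinates *)

Section PointIdeals.
Variable k : fieldType.
Local Notation R := {mpoly k[3]}.
Implicit Types (a b c m p v w : 'rV[k]_3) (f g h q : R) (d n : nat).

(** All that is used of the ideal of the points, once a vector is chosen for each point: it is
    homogeneous, and its forms are those vanishing at these vectors. *)
Definition ideal_of_points (s : seq 'rV[k]_3) (J : R -> Prop) : Prop :=
  [/\ is_ideal J, forall f d, J f -> J (pihomog mdeg d f),
      forall f v, J f -> v \in s -> ev v f = 0
    & forall f d, f \is d.-homog -> (forall v, v \in s -> ev v f = 0) -> J f].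

Definition dd_minor v w f g : R := dd v f * dd w g - dd w f * dd v g.

(** Frees the Jacobian ideal from a choice of generators and coordinates: from below it contains all
    directional minors of elements of J, from above it is bounded through the minors of any
    generating set in any frame. *)
Definition jacobian_of (J I : R -> Prop) : Prop :=
  [/\ is_ideal I, forall f, J f -> I f,
      forall f g v w, J f -> J g -> I (dd_minor v w f g)
    & forall (G T : R -> Prop) (e0 e1 e2 : 'rV[k]_3), framed e0 e1 e2 -> is_ideal T ->
      (forall f, G f -> J f) -> (forall f, J f -> ideal_gen G f) -> (forall f, J f -> T f) ->
      (forall f g, G f -> G g ->
        [/\ T (dd_minor e0 e1 f g), T (dd_minor e0 e2 f g) & T (dd_minor e1 e2 f g)]) ->
      forall f, I f -> T f].

Lemma homog_ind (J T : R -> Prop) : is_ideal T ->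
  (forall f d, J f -> J (pihomog mdeg d f)) ->
  (forall f d, J f -> f \is d.-homog -> T f) -> forall f, J f -> T f.
Proof.
move=> idT homJ JT f Jf; rewrite (pihomog_partitionE (leqnn (mmeasure mdeg f))).
apply: (idl_sum idT) => i _; apply: (JT _ i); [exact: homJ | exact: pihomogP].
Qed.

Lemma homog_prod (A : Type) (s : seq A) (F : A -> 'rV[k]_3) :
  \prod_(i <- s) lf (F i) \is (size s).-homog.
Proof.
elim: s => [|x s IHs]; first by rewrite big_nil dhomog1.
by rewrite big_cons /= -[(size s).+1]add1n dhomogM // lf_homog.
Qed.

Lemma dd_prod0 (A : Type) (s : seq A) (F : A -> 'rV[k]_3) v :
  (forall i, dot (F i) v = 0) -> dd v (\prod_(i <- s) lf (F i)) = 0.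
Proof.
move=> Fv; elim: s => [|x s IHs]; first by rewrite big_nil -(mpolyC1 3 k) ddC.
by rewrite big_cons ddM IHs dd_lf Fv mpolyC0 mul0r mulr0 addr0.
Qed.

Lemma lf_ndvd_prod (A : eqType) (s : seq A) (F : A -> 'rV[k]_3) a u : a != 0 ->
  (forall i, i \in s -> exists2 w, dot a w = 0 & dot (F i) w != 0) ->
  \prod_(i <- s) lf (F i) = lf a * u -> False.
Proof.
move=> a0; elim: s u => [|x s IHs] u Fs.
  rewrite big_nil => /(congr1 (fun h => ev (0 : 'rV[k]_3) h)) /=; rewrite rmorph1 rmorphM /= lf_eval.
  have -> : dot a 0 = 0 by vring.
  by rewrite mul0r => /eqP; rewrite oner_eq0.
rewrite big_cons => /(lf_prime a0)[[v E]|[v E]].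
  have [|w aw Fw] := Fs x; first exact: mem_head.
  by move/eqP: Fw; apply; rewrite -lf_eval E rmorphM /= lf_eval aw mul0r.
by apply: IHs E => i si; apply: Fs; rewrite inE si orbT.
Qed.

End PointIdeals.

(** * Five or six collinear points *)

Section CollinearPoints.
Variables (k : fieldType) (k_char0 : [pchar k]%R =i pred0).
Local Notation R := {mpoly k[3]}.
Variables (e0 e1 q : 'rV[k]_3) (fr : framed e0 e1 q).
Local Notation x0 := (lf (cross e1 q)).
Local Notation x1 := (lf (cross q e0)).
Local Notation l := (lf (cross e0 e1)).
Variable Y : seq 'rV[k]_3.
Hypotheses (Yuniq : uniq Y) (Y0 : forall p, p \in Y -> p != 0)
  (Yl : forall p, p \in Y -> dot (cross e0 e1) p = 0)
  (Yind : forall p p', p \in Y -> p' \in Y -> p != p' -> cross p p' != 0).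
Local Notation g := (\prod_(p <- Y) lf (cross p q)).

Lemma frame_dual_neq0 : cross e0 e1 != 0.
Proof.
apply/eqP => E; move/eqP: (oner_neq0 k); apply.
by rewrite -[LHS]fr /det3 E /dot !zerovE; ring.
Qed.

Lemma collinear_join p p' : p \in Y -> p' \in Y -> p != p' -> dot (cross p q) p' != 0.
Proof.
move=> Yp Yp' pp'; have [||x Ex] := orth2P (p := cross e0 e1) (Yind Yp Yp' pp').
- by rewrite dotC Yl.
- by rewrite dotC Yl.
apply/eqP => E; have : dot (cross e0 e1) q = - (x * dot (cross p q) p') by rewrite Ex; vring.
by rewrite E mulr0 oppr0 => E'; move/eqP: (oner_neq0 k); apply; rewrite -fr.
Qed.

(** One chunk for each point, cut out by the line to [q], which misses the other points of [Y]. *)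
Lemma collinear_ideal d f : f \is d.-homog -> (forall p, p \in Y -> ev p f = 0) ->
  exists A B, f = l * A + g * B.
Proof.
move=> fd fY; have [||||A [B]] := chunk_decomp (s := [seq (cross p q, [:: p]) | p <- Y])
    (lf_homog (cross e0 e1)) _ _ _ fd.
- by move=> mc p /mapP[p' Yp' ->]; rewrite inE => /eqP ->; rewrite lf_eval Yl.
- move=> mc d' f' /mapP[p Yp ->] /= f'd f'p.
  have am : cross (cross e0 e1) (cross p q) != 0.
    have -> : cross (cross e0 e1) (cross p q)
      = det3 e0 e1 q *: p - dot (cross e0 e1) p *: q by rvring.
    by rewrite fr (Yl Yp) scale1r scale0r subr0; apply: Y0.
  apply: (two_forms_ideal k_char0 am (Yl Yp) _ (Y0 Yp) f'd); first by vring.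
  by apply: f'p; rewrite inE.
- rewrite pairwise_map; apply: (sub_in_pairwise (P := mem Y) (r := fun x y => x != y)).
  + by move=> p p' /= Yp Yp' pp'; rewrite andbT collinear_join.
  + by apply/allP.
  by rewrite -uniq_pairwise.
- move=> mc p /mapP[p' Yp' ->]; rewrite inE => /eqP ->; exact: fY.
by rewrite big_map; exists A, B.
Qed.

(** Only the factor of [g] that vanishes at p contributes to the derivatives there; y is the value
    of the other factors. *)
Lemma dd_collinear p : p \in Y -> exists2 y, y != 0 &
  ev p (dd e0 g) = y * ev p x1 /\ ev p (dd e1 g) = - (y * ev p x0).
Proof.
move=> Yp; rewrite (perm_big _ (perm_to_rem Yp)) /= big_cons.
set g' := \prod_(_ <- _) _; exists (ev p g').
  rewrite rmorph_prod /= prodf_seq_neq0; apply/allP => p'.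
  rewrite mem_rem_uniq // inE => /andP[pp' Yp'] /=.
  by rewrite lf_eval collinear_join.
have z : ev p (lf (cross p q)) = 0 by rewrite lf_eval; vring.
rewrite !ddM !rmorphD !rmorphM /= z !mul0r !addr0 !dd_lf !mevalC !lf_eval.
by split; vring.
Qed.

Local Notation D0 := (dd e0).
Local Notation D1 := (dd e1).
Definition hess (f : R) : R := D0 (D0 f) * D1 (D1 f) - D0 (D1 f) ^+ 2.

(** All the lines pass through [q], so [g] is a binary form in [x0] and [x1]. *)
Lemma dd_q_prod : dd q g = 0.
Proof. by apply: dd_prod0 => p; vring. Qed.

Lemma collinear_prod_homog : g \is (size Y).-homog.
Proof. exact: homog_prod. Qed.

Lemma collinear_ndvd u : (1 < size Y)%N -> g = l * u -> False.
Proof.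
move=> sY; apply: lf_ndvd_prod; first exact: frame_dual_neq0.
move=> p Yp; have [p' Yp' pp'] : exists2 p', p' \in Y & p != p'.
  case: Y sY Yuniq Yp => [|y1 [|y2 s]] //= _ /andP[]; rewrite inE negb_or => /andP[y12 _] _ _.
  by case: (eqVneq p y1) => [->|]; [exists y2; rewrite ?inE ?eqxx ?orbT | exists y1; rewrite ?inE ?eqxx].
by exists p'; rewrite ?Yl // collinear_join.
Qed.

(* On the points of Y the gradient of g is proportional to (x1, - x0), with a
   factor y, and the Hessian is a multiple of y ^ 2; so if the Hessian were a
   combination of the partial derivatives, y would be the restriction of a form
   F with g_0 = - F x1 and g_1 = F x0 modulo l, against Euler's identity. *)
Lemma hess_notin n A B C : size Y = n.+3 ->
  hess g = A * D0 g + B * D1 g + l * C -> False.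
Proof.
move=> sY EH; have gh := collinear_prod_homog; rewrite sY in gh.
have hD v : dd v g \is n.+2.-homog by exact: (dd_homog v gh).
have hDD v w : dd v (dd w g) \is n.+1.-homog by exact: (dd_homog v (hD w)).
have Hh : hess g \is (n.+1 + n.+1).-homog.
  by rewrite /hess expr2; apply: rpredB; exact: (dhomogM (hDD _ _) (hDD _ _)).
pose A' := pihomog mdeg n A; pose B' := pihomog mdeg n B.
have [C' EH'] : exists C', hess g = A' * D0 g + B' * D1 g + l * C'.
  exists (pihomog mdeg (n.+1 + n.+1 - 1) C).
  rewrite -[LHS](pihomog_dE Hh) EH !raddfD /= [l * C]mulrC.
  rewrite (pihomogM _ _ (hD e0)) (pihomogM _ _ (hD e1)) (pihomogM _ _ (lf_homog _)).
  by rewrite addSnnS leq_addl addnK [in LHS]addnS /= -addnS [l * _]mulrC.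
(* Where (D0 g, D1 g) = g' (x1, - x0), Euler's identity gives the Hessian the value - (n + 2)^2
   g'^2; the factor [y] makes [F] equal to - g' there. *)
pose y := (n.+2%:R ^+ 2 : k)^-1.
have N0 : n.+2%:R != 0 :> k by exact: (natS_neq0 k_char0).
pose F := y%:MP * (x1 * A' - x0 * B').
have Fh : F \is n.+1.-homog.
  rewrite /F mul_mpolyC rpredZ // -[n.+1]add1n.
  by rewrite rpredB // dhomogM ?lf_homog // pihomogP.
have FY p : p \in Y -> ev p (D0 g + F * x1) = 0 /\ ev p (D1 g - F * x0) = 0.
  move=> Yp; have [g' g'0 [E0 E1]] := dd_collinear Yp.
  have lp : ev p l = 0 by rewrite lf_eval Yl.
  have st0 : (ev p x0 != 0) || (ev p x1 != 0).
    rewrite -negb_and; apply: contra (Y0 Yp) => /andP[/eqP z0 /eqP z1].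
    by rewrite (frame_expand fr p) -!lf_eval z0 z1 lp !scale0r !addr0.
  have V1 : forall u v : R, ev p (u + v) = ev p u + ev p v by move=> u v; rewrite rmorphD.
  have V2 : forall u v : R, ev p (u * v) = ev p u * ev p v by move=> u v; rewrite rmorphM.
  have V3 : forall u : R, ev p (- u) = - ev p u by move=> u; rewrite rmorphN.
  have V0 : forall u v : R, u = v -> ev p u = ev p v by move=> u v ->.
  have := frame_euler_ev fr p (hD e0).
  have := frame_euler_ev fr p (hD e1).
  have := V0 _ _ EH'.
  rewrite /hess expr2 !(V1, V2, V3) E0 E1 lp !mul0r !addr0.
  rewrite [D1 (D0 g)]dd_comm ?mevalC.
  move: g'0 st0; move: (ev p x0) (ev p x1) (ev p A') (ev p B') (ev p (D0 (D0 g)))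
     (ev p (D0 (D1 g))) (ev p (D1 (D1 g))) => s t a b u v w g'0 st0 H1 H2 H3.
  suff H : t * a - s * b = - (n.+2%:R ^+ 2 * g').
    by rewrite H /y; split; rewrite mulrN mulrA mulVf ?expf_neq0 // mul1r; ring.
  apply: (mulfI g'0).
  have H4 z : z = s \/ z = t -> z * (u * w - v * v) = - (n.+2%:R ^+ 2 * g' ^+ 2) * z.
    case=> ->.
      transitivity (w * (s * u + t * v) - v * (s * v + t * w)); first by ring.
      by rewrite H3 H2; transitivity (n.+2%:R * g' * (s * v + t * w)); [ring | rewrite H2; ring].
    transitivity (u * (s * v + t * w) - v * (s * u + t * v)); first by ring.
    by rewrite H3 H2; transitivity (- n.+2%:R * g' * (s * u + t * v)); [ring | rewrite H3; ring].
  have -> : g' * (t * a - s * b) = a * (g' * t) + b * - (g' * s) by ring.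
  rewrite -H1; case/orP: st0 => z0; apply: (mulfI z0); rewrite H4; auto; ring.
(* The degree n + 2 is below that of [g], so the cofactor of [g] is zero. *)
have Fdvd G : G \is n.+2.-homog -> (forall p, p \in Y -> ev p G = 0) ->
    exists u, G = l * u.
  move=> Gh GY; have [U [V E]] := collinear_ideal Gh GY.
  have := homog_quot gh Gh (lf_homog _) E; rewrite ltnn mulr0 addr0 => ->.
  by eexists.
have FFh : F * x1 \is n.+2.-homog /\ F * x0 \is n.+2.-homog.
  by split; rewrite -[n.+2]addn1 dhomogM ?lf_homog.
have [|p Yp|u Eu] := Fdvd (D0 g + F * x1); [by apply: rpredD; [exact: hD | exact: FFh.1]|by have [] := FY p Yp|].
have [|p Yp|v Ev] := Fdvd (D1 g - F * x0); [by apply: rpredB; [exact: hD | exact: FFh.2]|by have [] := FY p Yp|].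
apply: (@collinear_ndvd ((n.+3%:R : k)^-1%:MP * (x0 * u + x1 * v))); first by rewrite sY.
rewrite [LHS](@eq_divC _ n.+3%:R _ (l * (x0 * u + x1 * v))) ?(natS_neq0 k_char0) //; first by ring.
rewrite mpolyC_nat -(frame_euler fr gh) dd_q_prod mulr0 addr0.
transitivity (x0 * (l * u) + x1 * (l * v)); last by ring.
by rewrite -Eu -Ev; ring.
Qed.

(** A form of degree at least two gives one linear factor to y and another to z, which yields
    products of two elements of I. For five points on the line, the derivatives of [g] are only
    shown to be in I after such a multiplication. *)
Lemma mul_quad_pow2 (I : R -> Prop) d y z f : is_ideal I ->
  [/\ I (x0 * y), I (x1 * y) & I (l * y)] -> [/\ I (x0 * z), I (x1 * z) & I (l * z)] ->
  f \is d.+2.-homog -> ideal_pow I 2 (y * z * f).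
Proof.
move=> idI [y0 y1 y2] [z0 z1 z2] fd.
have id2 := ideal_pow_ideal I 2.
have S1 w h : I (w * y) -> h \is d.+1.-homog -> ideal_pow I 2 (w * y * z * h).
  move=> wy /(homog_split k_char0 fr)[f0 [f1 [f2 [-> _ _ _]]]].
  have -> : w * y * z * (x0 * f0 + x1 * f1 + l * f2) = (w * y) * (x0 * z) * f0
    + (w * y) * (x1 * z) * f1 + (w * y) * (l * z) * f2 by ring.
  by apply: (idlD id2); [apply: (idlD id2)|]; apply: (idlMr id2); apply: mem_ideal_pow2.
have [f0 [f1 [f2 [-> h0 h1 h2]]]] := homog_split k_char0 fr fd.
have -> : y * z * (x0 * f0 + x1 * f1 + l * f2) = x0 * y * z * f0 + x1 * y * z * f1
  + l * y * z * f2 by ring.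
by apply: (idlD id2); [apply: (idlD id2)|]; apply: S1.
Qed.

(** Places the witness in I^2: up to a constant it is a combination of products of two first
    derivatives, with second derivatives as coefficients. *)
Lemma hess_euler n f : f \is n.+1.-homog -> dd q f = 0 ->
  n.+1%:R * (f * hess f) = n%:R * (D0 f * D0 f * D1 (D1 f)
    + (- 2%:R) * (D0 f * D1 f * D0 (D1 f)) + D1 f * D1 f * D0 (D0 f)).
Proof.
move=> fh fq; rewrite mulrA -(frame_euler fr fh) fq mulr0 addr0 /hess.
have E v := frame_euler fr (dd_homog v fh).
have q0 v : dd q (dd v f) = 0 by rewrite dd_comm fq dd0.
have /= := E e0; have /= := E e1; rewrite !q0 !mulr0 !addr0 [D1 (D0 f)]dd_comm.
move: (n%:R : R) x0 x1 (D0 f) (D1 f) (D0 (D0 f)) (D0 (D1 f)) (D1 (D1 f))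
  => N s t u v a b c H1 H0.
transitivity (u * (c * (s * a + t * b) - b * (s * b + t * c))
  + v * (a * (s * b + t * c) - b * (s * a + t * b))); first by ring.
by rewrite H0 H1; ring.
Qed.

Lemma collinear_not_VV (J I : R -> Prop) n : size Y = n.+4.+1 ->
  is_ideal J -> is_ideal I -> J g ->
  (forall f, J f -> exists A B, f = l * A + g * B) ->
  (forall v, v = e0 \/ v = e1 -> [/\ I (x0 * dd v g), I (x1 * dd v g) & I (l * dd v g)]) ->
  (forall f, I f -> exists A B C, f = A * D0 g + B * D1 g + l * C) ->
  ~ VV_torsion_free J I.
Proof.
move=> sY idJ idI Jg JY Ig IY.
have gh := collinear_prod_homog; rewrite sY in gh.
have hDD v w : dd v (dd w g) \is n.+1.+2.-homog by exact: (dd_homog v (dd_homog w gh)).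
apply: (VV_torsion_freePn (f := g * hess g)) => //.
- exact: (idlMr idJ).
- have id2 := ideal_pow_ideal I 2.
  have E := hess_euler gh dd_q_prod; rewrite -mpolyC_nat in E.
  rewrite (eq_divC (natS_neq0 k_char0 _) E).
  have I0 := Ig e0 (or_introl erefl); have I1 := Ig e1 (or_intror erefl).
  apply: (idlMl id2); apply: (idlMl id2).
  apply: (idlD id2); [apply: (idlD id2)|]; last exact: mul_quad_pow2.
    exact: mul_quad_pow2.
  by apply: (idlMl id2); apply: mul_quad_pow2.
move=> /(ideal_prod_sub (T := fun f => exists i C, I i /\ f = g * i + l * C)).
case=> [|f i /JY[A [B ->]] Ii|i [C [Ii E]]].
- split=> [|x z [x' [C [Ix ->]]] [z' [D [Iz ->]]]|r x [x' [C [Ix ->]]]].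
  + by exists 0, 0; rewrite !mulr0 addr0; split=> //; apply: (idl0 idI).
  + by exists (x' + z'), (C + D); split; [apply: (idlD idI) | ring].
  by exists (r * x'), (r * C); split; [apply: (idlMl idI) | ring].
- by exists (B * i), (A * i); split; [apply: (idlMl idI) | ring].
have E' : g * (hess g - i) = l * C by rewrite mulrBr E; ring.
have [[u Eu]|[u Eu]] := lf_prime frame_dual_neq0 E'.
  by apply: (collinear_ndvd _ Eu); rewrite sY.
have [A [B [D Ei]]] := IY _ Ii.
apply: (@hess_notin n.+2 A B (D + u)) => //.
by rewrite -[LHS](subrK i) Eu Ei; ring.
Qed.

Lemma collinear_sub s (J : R -> Prop) : ideal_of_points s J -> {subset Y <= s} ->
  forall f, J f -> exists A B, f = l * A + g * B.
Proof.
case=> _ homJ J0 _ Ys; apply: (homog_ind _ homJ) => [|f d Jf fd].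
  split=> [|x z [A [B ->]] [A' [B' ->]]|r x [A [B ->]]].
  - by exists 0, 0; rewrite !mulr0 addr0.
  - by exists (A + A'), (B + B'); ring.
  by exists (r * A), (r * B); ring.
by apply: (collinear_ideal fd) => p Yp; apply: J0 => //; apply: Ys.
Qed.

(** Every term of a minor in this frame contains a derivative along [e0] or [e1], and these
    derivatives kill [l]. By Euler's identity [g] is itself a combination of [D0 g] and [D1 g]. *)
Lemma jacobian_collinear_sub n s (J I : R -> Prop) : size Y = n.+1 ->
  ideal_of_points s J -> jacobian_of J I -> {subset Y <= s} ->
  forall f, I f -> exists A B C, f = A * D0 g + B * D1 g + l * C.
Proof.
move=> sY ptsJ [idI JI _ genI] Ys; pose T f := exists A B C, f = A * D0 g + B * D1 g + l * C.
have gh := collinear_prod_homog; rewrite sY in gh.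
have idT : is_ideal T.
  split=> [|x z [A [B [C ->]]] [A' [B' [C' ->]]]|r x [A [B [C ->]]]].
  - by exists 0, 0, 0; ring.
  - by exists (A + A'), (B + B'), (C + C'); ring.
  by exists (r * A), (r * B), (r * C); ring.
have Tl h : T (l * h) by exists 0, 0, h; ring.
have TD h : T (D0 g * h) /\ T (D1 g * h).
  by split; [exists h, 0, 0 | exists 0, h, 0]; ring.
have Tg h : T (g * h).
  exists ((n.+1%:R : k)^-1%:MP * (x0 * h)), ((n.+1%:R : k)^-1%:MP * (x1 * h)), 0.
  rewrite [g in LHS](@eq_divC _ n.+1%:R _ (x0 * D0 g + x1 * D1 g)) ?(natS_neq0 k_char0) //.
    by ring.
  by rewrite mpolyC_nat -(frame_euler fr gh) dd_q_prod mulr0 addr0.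
have DT f : J f -> T (D0 f) /\ T (D1 f).
  move=> /(collinear_sub ptsJ Ys)[A [B ->]].
  have dl0 : D0 l = 0 by rewrite dd_lf -(mpolyC0 3 k); congr _%:MP; vring.
  have dl1 : D1 l = 0 by rewrite dd_lf -(mpolyC0 3 k); congr _%:MP; vring.
  rewrite !ddD !ddM dl0 dl1 !mul0r !add0r.
  by split; apply: (idlD idT) => //; apply: (idlD idT) => //; case: (TD B).
have JT f : J f -> T f.
  by move=> /(collinear_sub ptsJ Ys)[A [B ->]]; apply: (idlD idT).
apply: (genI J T e0 e1 q fr idT) => // [f Jf|f h /DT[f0 f1] /DT[h0 h1]].
  exact: mem_ideal_gen.
by split; rewrite /dd_minor; apply: (idlB idT);
  do ?[exact: (idlMl idT) | exact: (idlMr idT)].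
Qed.

Lemma frame_dd_dual :
  [/\ [/\ D0 x0 = 1, D0 x1 = 0 & D0 l = 0], [/\ D1 x0 = 0, D1 x1 = 1 & D1 l = 0]
    & [/\ dd q x0 = 0, dd q x1 = 0 & dd q l = 1]].
Proof.
rewrite !dd_lf -(mpolyC0 3 k) -(mpolyC1 3 k) -fr.
by split; split; congr _%:MP; vring.
Qed.

Lemma collinear_not_VV6 (J I : R -> Prop) : ideal_of_points Y J -> jacobian_of J I ->
  size Y = 6%N -> ~ VV_torsion_free J I.
Proof.
move=> ptsJ jacI sY; have [idJ _ _ memJ] := ptsJ; have [idI _ minI _] := jacI.
have gh := collinear_prod_homog; rewrite sY in gh.
have Jg : J g.
  apply: (memJ _ _ gh) => p Yp; rewrite (perm_big _ (perm_to_rem Yp)) /= big_cons.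
  by rewrite rmorphM /= lf_eval [X in X * _](_ : _ = 0) ?mul0r //; vring.
have Jl : J l by apply: (memJ _ _ (lf_homog _)) => p Yp; rewrite lf_eval Yl.
have [[_ _ l0] [_ _ l1] [_ _ lq]] := frame_dd_dual.
apply: (collinear_not_VV sY idJ idI Jg (collinear_sub ptsJ _)) => // [v vE|].
  have Iv : I (dd v g).
    have := minI _ _ q v Jl Jg; rewrite /dd_minor lq mul1r.
    by case: vE => ->; rewrite ?l0 ?l1 mul0r subr0.
  by split; apply: (idlMl idI).
exact: (jacobian_collinear_sub sY ptsJ jacI).
Qed.

Lemma collinear_not_VV5 (J I : R -> Prop) : ideal_of_points (q :: Y) J -> jacobian_of J I ->
  size Y = 5%N -> ~ VV_torsion_free J I.
Proof.
move=> ptsJ jacI sY; have [idJ _ _ memJ] := ptsJ; have [idI JI minI _] := jacI.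
have gh := collinear_prod_homog; rewrite sY in gh.
have YqY : {subset Y <= q :: Y} by move=> p Yp; rewrite inE Yp orbT.
have Jg : J g.
  apply: (memJ _ _ gh) => p; rewrite inE => /orP[/eqP->|Yp].
    case: Y sY => [|y s] // _; rewrite big_cons.
    by rewrite rmorphM /= lf_eval [X in X * _](_ : _ = 0) ?mul0r //; vring.
  rewrite (perm_big _ (perm_to_rem Yp)) /= big_cons.
  by rewrite rmorphM /= lf_eval [X in X * _](_ : _ = 0) ?mul0r //; vring.
have Jlx a : dot a q = 0 -> J (l * lf a).
  move=> aq; apply: (memJ _ 2) => [|p]; first exact: (dhomogM (lf_homog _) (lf_homog _)).
  rewrite inE rmorphM /= !lf_eval => /orP[/eqP->|Yp]; first by rewrite aq mulr0.
  by rewrite Yl ?mul0r.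
have Jl0 : J (l * x0) by apply: Jlx; vring.
have Jl1 : J (l * x1) by apply: Jlx; vring.
have [[d00 d01 l0] [d10 d11 l1] [dq0 dq1 lq]] := frame_dd_dual.
have Ill : I (l * l).
  have := minI _ _ e0 e1 Jl0 Jl1; rewrite /dd_minor !ddM l0 l1 d00 d01 d10 d11.
  by congr I; ring.
apply: (collinear_not_VV sY idJ idI Jg (collinear_sub ptsJ YqY)) => [v _|].
  (* The minors of [l * x0] and [l * x1] with [g] are the derivative of [g] times [x0] and [x1]; the
     multiple by [l] follows from expanding the derivative in the frame, since [l] times each of the
     three dual forms is in I. *)
  have Iq := minI _ _ q v _ Jg; split.
  - by have := Iq _ Jl0; rewrite /dd_minor ddM lq dq0 dd_q_prod; congr I; ring.
  - by have := Iq _ Jl1; rewrite /dd_minor ddM lq dq1 dd_q_prod; congr I; ring.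
  have [f0 [f1 [f2 [-> _ _ _]]]] := homog_split k_char0 fr (dd_homog v gh).
  have -> : l * (x0 * f0 + x1 * f1 + l * f2) = l * x0 * f0 + l * x1 * f1 + l * l * f2 by ring.
  by apply: (idlD idI); [apply: (idlD idI)|]; apply: (idlMr idI) => //; apply: JI.
exact: (jacobian_collinear_sub sY ptsJ jacI YqY).
Qed.

End CollinearPoints.

(** The dual quadratic form: the adjugate of the symmetric matrix (a_ij), evaluated at w. *)
Definition adj_quad (A : comNzRingType) (a00 a01 a02 a11 a12 a22 w0 w1 w2 : A) : A :=
  (a11 * a22 - a12 * a12) * (w0 * w0) + (a00 * a22 - a02 * a02) * (w1 * w1)
  + (a00 * a11 - a01 * a01) * (w2 * w2) + (a02 * a12 - a01 * a22) * (w0 * w1) *+ 2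
  + (a01 * a12 - a02 * a11) * (w0 * w2) *+ 2
  + (a01 * a02 - a00 * a12) * (w1 * w2) *+ 2.

(* For H symmetric, M = H x cross w satisfies
   M^T H M = (x^T H x) (w^T adj(H) w) - det(H) (x^T w)^2. *)
Lemma adj_quadE (A : comNzRingType) (a00 a01 a02 a11 a12 a22 w0 w1 w2 x0 x1 x2 q0 q1 q2 m0 m1 m2 : A) :
  q0 = a00 * x0 + a01 * x1 + a02 * x2 -> q1 = a01 * x0 + a11 * x1 + a12 * x2 ->
  q2 = a02 * x0 + a12 * x1 + a22 * x2 ->
  m0 = q1 * w2 - q2 * w1 -> m1 = q2 * w0 - q0 * w2 -> m2 = q0 * w1 - q1 * w0 ->
  (x0 * q0 + x1 * q1 + x2 * q2) * adj_quad a00 a01 a02 a11 a12 a22 w0 w1 w2 =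
  a00 * (m0 * m0) + a11 * (m1 * m1) + a22 * (m2 * m2)
  + 2%:R * (a01 * (m0 * m1) + a02 * (m0 * m2) + a12 * (m1 * m2))
  + (a00 * (a11 * a22 - a12 * a12) - a01 * (a01 * a22 - a12 * a02)
     + a02 * (a01 * a12 - a11 * a02)) * ((x0 * w0 + x1 * w1 + x2 * w2) * (x0 * w0 + x1 * w1 + x2 * w2)).
Proof. by move=> -> -> -> -> -> ->; rewrite /adj_quad; ring. Qed.

(** * Complete intersections of a conic and a cubic *)

Section CompleteIntersection.
Variables (k : fieldType) (k_char0 : [pchar k]%R =i pred0).
Local Notation R := {mpoly k[3]}.
Variables (e0 e1 e2 : 'rV[k]_3) (fr : framed e0 e1 e2).
Local Notation x0 := (lf (cross e1 e2)).
Local Notation x1 := (lf (cross e2 e0)).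
Local Notation x2 := (lf (cross e0 e1)).
Local Notation D0 := (dd e0).
Local Notation D1 := (dd e1).
Local Notation D2 := (dd e2).
Variables q c : R.
Hypotheses (qh : q \is 2.-homog) (ch : c \is 3.-homog).

Local Notation h00 := (ev (0 : 'rV[k]_3) (D0 (D0 q))).
Local Notation h01 := (ev (0 : 'rV[k]_3) (D0 (D1 q))).
Local Notation h02 := (ev (0 : 'rV[k]_3) (D0 (D2 q))).
Local Notation h11 := (ev (0 : 'rV[k]_3) (D1 (D1 q))).
Local Notation h12 := (ev (0 : 'rV[k]_3) (D1 (D2 q))).
Local Notation h22 := (ev (0 : 'rV[k]_3) (D2 (D2 q))).

Lemma dd_quadricE :
  [/\ D0 q = h00%:MP * x0 + h01%:MP * x1 + h02%:MP * x2,
      D1 q = h01%:MP * x0 + h11%:MP * x1 + h12%:MP * x2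
    & D2 q = h02%:MP * x0 + h12%:MP * x1 + h22%:MP * x2].
Proof.
have C v w : (ev (0 : 'rV[k]_3) (dd v (dd w q)))%:MP = dd v (dd w q).
  by have [y ->] := homog0P (dd_homog v (dd_homog w qh)); rewrite mevalC.
have E v : dd v q = x0 * D0 (dd v q) + x1 * D1 (dd v q) + x2 * D2 (dd v q).
  by rewrite (frame_euler fr (dd_homog v qh)) mul1r.
rewrite !C; split; rewrite [LHS]E.
- by rewrite [D1 (D0 q)]dd_comm [D2 (D0 q)]dd_comm; ring.
- by rewrite [D2 (D1 q)]dd_comm; ring.
by ring.
Qed.

Definition adjN : R := adj_quad h00%:MP h01%:MP h02%:MP h11%:MP h12%:MP h22%:MP
  (D0 c) (D1 c) (D2 c).

Local Notation M0 := (dd_minor e1 e2 q c).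
Local Notation M1 := (dd_minor e2 e0 q c).
Local Notation M2 := (dd_minor e0 e1 q c).

Lemma adjN_homog : adjN \is 4.-homog.
Proof.
have H v w (a : R) : a \is 0.-homog -> a * (dd v c * dd w c) \is 4.-homog.
  move=> a0; apply: (dhomogM a0 (dhomogM (dd_homog v ch) (dd_homog w ch))).
have Z (x y z t : k) : x%:MP * y%:MP - z%:MP * t%:MP \is [in k[3], 0.-homog].
  by apply: rpredB; exact: (dhomogM (homogC _) (homogC _)).
by rewrite /adjN /adj_quad; do 5?[apply: rpredD]; do ?apply: rpredMn; apply: H; apply: Z.
Qed.

Lemma quad_minors : exists y : k, 2%:R * (q * adjN) =
  h00%:MP * (M0 * M0) + h11%:MP * (M1 * M1) + h22%:MP * (M2 * M2)
  + 2%:R * (h01%:MP * (M0 * M1) + h02%:MP * (M0 * M2) + h12%:MP * (M1 * M2))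
  + y%:MP * (c * c).
Proof.
have [E0 E1 E2] := dd_quadricE.
(* The determinant of the Hessian matrix, times 9 = 3^2 because Euler's identity turns x . grad c
   into 3 c. *)
exists (9%:R * (h00 * (h11 * h22 - h12 * h12) - h01 * (h01 * h22 - h12 * h02)
     + h02 * (h01 * h12 - h11 * h02))).
rewrite mulrA -(frame_euler fr qh).
rewrite (@adj_quadE _ _ _ _ _ _ _ _ _ _ x0 x1 x2 (D0 q) (D1 q) (D2 q) M0 M1 M2) //.
rewrite (frame_euler fr ch).
move: (M0 * M0) (M1 * M1) => m00 m11.
move: c h00 h01 h02 h11 h12 h22 => f a b d e g h.
ring.
Qed.

Variables (J I : R -> Prop) (s : seq 'rV[k]_3).
Hypotheses (ptsJ : ideal_of_points s J) (jacI : jacobian_of J I).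
Hypotheses (Jq : J q) (Jc : J c) (Jqc : forall f, J f -> exists A B, f = q * A + c * B).
Hypothesis coprime_qc : forall y b : R, q * y = c * b -> exists y', y = c * y' /\ b = q * y'.
(** Both gradients are orthogonal to p, by Euler's identity, so their cross product M is a multiple
    of p; a nonzero ratio h means that the two curves meet transversally. *)
Hypothesis transversal : forall p, p \in s -> exists h : k, [/\ h != 0,
  ev p M0 = h * ev p x0, ev p M1 = h * ev p x1, ev p M2 = h * ev p x2
  & ev p adjN = - h ^+ 2].
Hypothesis vertex : forall b : 'rV[k]_3, b != 0 -> ev b (D0 q) = 0 -> ev b (D1 q) = 0 ->
  ev b (D2 q) = 0 -> ev b c != 0.
Hypothesis q_neq0 : q != 0.
Hypothesis s_neq0 : exists p, p \in s.

Lemma complete_intersection_jac f : I f ->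
  exists A B C0 C1 C2, f = q * A + c * B + (M0 * C0 + M1 * C1 + M2 * C2).
Proof.
have [_ _ _ genI] := jacI; have [idJ _ _ _] := ptsJ.
pose T f := exists A B C0 C1 C2, f = q * A + c * B + (M0 * C0 + M1 * C1 + M2 * C2).
have idT : is_ideal T.
  split=> [|x z [A [B [C0 [C1 [C2 ->]]]]] [A' [B' [C0' [C1' [C2' ->]]]]]|r x [A [B [C0 [C1 [C2 ->]]]]]].
  - by exists 0, 0, 0, 0, 0; ring.
  - by exists (A + A'), (B + B'), (C0 + C0'), (C1 + C1'), (C2 + C2'); ring.
  by exists (r * A), (r * B), (r * C0), (r * C1), (r * C2); ring.
apply: (genI (fun g => g = q \/ g = c) T e0 e1 e2 fr idT) => [g [->|->]||g|g g' Gg Gg'] //.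
- move=> g /Jqc[A [B ->]]; apply: (idlD (ideal_gen_ideal _));
    apply: (idlMr (ideal_gen_ideal _)); apply: mem_ideal_gen; auto.
- by move=> /Jqc[A [B ->]]; exists A, B, 0, 0, 0; ring.
have T0 : T 0 by apply: (idl0 idT).
have alt v w g1 : dd_minor v w g1 g1 = 0 by rewrite /dd_minor; ring.
have swp v w : dd_minor v w c q = - dd_minor v w q c by rewrite /dd_minor; ring.
have swp2 v w g1 g2 : dd_minor v w g1 g2 = - dd_minor w v g1 g2 by rewrite /dd_minor; ring.
have TM : [/\ T (dd_minor e0 e1 q c), T (dd_minor e0 e2 q c) & T (dd_minor e1 e2 q c)].
  split; first by exists 0, 0, 0, 0, 1; ring.
    by exists 0, 0, 0, (-1), 0; rewrite swp2; ring.
  by exists 0, 0, 1, 0, 0; ring.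
have [T1 T2 T3] := TM.
by case: Gg Gg' => [->|->] [->|->]; rewrite ?alt ?swp; split=> //; apply: (idlN idT).
Qed.

(* On s, M = h x and adjN = - h ^ 2; if adjN were in I then h would agree on s
   with a quadratic form F, so M - F x would vanish modulo (q, c). Contracting
   with the gradients of q and c shows that F is in (q), or that c vanishes at
   the vertex of q. *)
Lemma adjN_notin : I adjN -> False.
Proof.
have [idJ homJ evJ memJ] := ptsJ.
move=> /complete_intersection_jac[A [B [C0 [C1 [C2 EN]]]]].
have hM v w : dd_minor v w q c \is 3.-homog.
  by apply: rpredB; exact: (dhomogM (dd_homog _ qh) (dd_homog _ ch)).
pose G0 := pihomog mdeg 1 C0; pose G1 := pihomog mdeg 1 C1; pose G2 := pihomog mdeg 1 C2.
have [A' [B' EN']] : exists A' B', adjN = q * A' + c * B' + (M0 * G0 + M1 * G1 + M2 * G2).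
  exists (pihomog mdeg 2 A), (pihomog mdeg 1 B).
  rewrite -[LHS](pihomog_dE adjN_homog) EN !raddfD /=.
  rewrite [q * A]mulrC [c * B]mulrC [M0 * C0]mulrC [M1 * C1]mulrC [M2 * C2]mulrC.
  rewrite (pihomogM _ _ qh) (pihomogM _ _ ch) !(pihomogM _ _ (hM _ _)) /=.
  by rewrite [q * _]mulrC [c * _]mulrC [M0 * G0]mulrC [M1 * G1]mulrC [M2 * G2]mulrC.
(* At a point of [s] the expression of [adjN] reads - h^2 = h (x . G); with this sign [F] takes the
   value h. *)
pose F := - (x0 * G0 + x1 * G1 + x2 * G2).
have hF : F \is 2.-homog.
  by rewrite /F rpredN; do 2?[apply: rpredD]; exact: (dhomogM (lf_homog _) (pihomogP _ _ _)).
have Fp p : p \in s -> exists h : k, [/\ h != 0, ev p F = h,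
    ev p M0 = h * ev p x0, ev p M1 = h * ev p x1 & ev p M2 = h * ev p x2].
  move=> sp; have [h [h0 H0 H1 H2 HN]] := transversal sp; exists h; split=> //.
  apply: (mulfI h0); rewrite -expr2 -[RHS]opprK -HN EN'.
  move: (M0) (M1) (M2) H0 H1 H2 => m0 m1 m2 H0 H1 H2.
  rewrite !rmorphD !rmorphM /= (evJ _ _ Jq sp) (evJ _ _ Jc sp) !mul0r !add0r.
  rewrite rmorphN !rmorphD !rmorphM /= H0 H1 H2; ring.
have MJ v w x : x \is 1.-homog -> (forall p h, p \in s -> ev p F = h ->
     ev p M0 = h * ev p x0 -> ev p M1 = h * ev p x1 -> ev p M2 = h * ev p x2 ->
     ev p (dd_minor v w q c) = h * ev p x) ->
  exists A (b : k), dd_minor v w q c = F * x + q * A + c * b%:MP.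
  move=> xh Ev; have hMF : dd_minor v w q c - F * x \is 3.-homog.
    by apply: rpredB => //; exact: (dhomogM hF xh).
  have /Jqc[P [Q E]] : J (dd_minor v w q c - F * x).
    apply: (memJ _ _ hMF) => p sp; have [h [_ Fh H0 H1 H2]] := Fp _ sp.
    by rewrite rmorphB rmorphM /= (Ev p h) // Fh subrr.
  have := homog_quot ch hMF qh E; rewrite /= subnn.
  have [b ->] := homog0P (pihomogP mdeg 0 Q) => E'.
  by exists (pihomog mdeg (3 - 2) P), b; rewrite -addrA -E'; ring.
have [||A0 [b0 EA0]] := MJ e1 e2 x0; [exact: lf_homog|by []|].
have [||A1 [b1 EA1]] := MJ e2 e0 x1; [exact: lf_homog|by []|].
have [||A2 [b2 EA2]] := MJ e0 e1 x2; [exact: lf_homog|by []|].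
have Eq := frame_euler fr qh; have Ec := frame_euler fr ch.
pose L := b0%:MP * D0 q + b1%:MP * D1 q + b2%:MP * D2 q.
pose S := 2%:R * F + (A0 * D0 q + A1 * D1 q + A2 * D2 q).
(* The cross product M is orthogonal to the gradients of q and c, so the right-hand side vanishes
   for g = q and for g = c. *)
have contract g d : g \is d.-homog -> F * (d%:R * g)
    + q * (A0 * D0 g + A1 * D1 g + A2 * D2 g)
    + c * (b0%:MP * D0 g + b1%:MP * D1 g + b2%:MP * D2 g)
    = M0 * D0 g + M1 * D1 g + M2 * D2 g.
  by move=> gh; rewrite -(frame_euler fr gh) EA0 EA1 EA2; ring.
have EQ : q * - S = c * L.
  have := contract _ _ qh; rewrite -/L.
  have -> : M0 * D0 q + M1 * D1 q + M2 * D2 q = 0 by rewrite /dd_minor; ring.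
  move=> E; rewrite -[RHS]subr0 -E /S; ring.
have EC : q * (A0 * D0 c + A1 * D1 c + A2 * D2 c)
    + c * (3%:R * F + (b0%:MP * D0 c + b1%:MP * D1 c + b2%:MP * D2 c)) = 0.
  transitivity (M0 * D0 c + M1 * D1 c + M2 * D2 c); last by rewrite /dd_minor; ring.
  by rewrite -(contract _ _ ch); ring.
have L0 : L = 0.
  have [y [_ EL]] := coprime_qc EQ.
  have hL : L \is 1.-homog.
    by do 2?[apply: rpredD]; rewrite mul_mpolyC rpredZ ?(dd_homog _ qh).
  by rewrite -(pihomog_dE hL) EL mulrC (pihomogM _ _ qh) mul0r.
have S0 : S = 0.
  move/eqP: EQ; rewrite L0 mulr0 mulf_eq0 (negPf q_neq0) oppr_eq0 => /eqP //.
(* Since L = 0 and the Hessian matrix is symmetric, the gradient of q vanishes at [v]. If [v] is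
   zero, [EC] makes q divide [F], which is nonzero on [s]. *)
pose v := b0 *: e0 + b1 *: e1 + b2 *: e2.
have v0 : ev v x0 = b0.
  by rewrite lf_eval -[RHS]mulr1 -[X in _ * X]fr /v; vring.
have v1 : ev v x1 = b1.
  by rewrite lf_eval -[RHS]mulr1 -[X in _ * X]fr /v; vring.
have v2 : ev v x2 = b2.
  by rewrite lf_eval -[RHS]mulr1 -[X in _ * X]fr /v; vring.
have [vz|vn0] := eqVneq v 0.
  have [p sp] := s_neq0; have [h [h0 Fh _ _ _]] := Fp p sp.
  have z0 : ev (0 : 'rV[k]_3) x0 = 0 by rewrite lf_eval; vring.
  have z1 : ev (0 : 'rV[k]_3) x1 = 0 by rewrite lf_eval; vring.
  have z2 : ev (0 : 'rV[k]_3) x2 = 0 by rewrite lf_eval; vring.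
  move: EC; rewrite -v0 -v1 -v2 vz z0 z1 z2 !mpolyC0 !mul0r !addr0.
  move=> /eqP; rewrite addr_eq0 -mulrN => /eqP /coprime_qc[y [_ E]].
  have := congr1 (fun f => ev p f) E; rewrite /= rmorphN !rmorphM /= rmorph_nat Fh (evJ _ _ Jq sp) mul0r.
  by move/eqP; rewrite oppr_eq0 mulf_eq0 (negPf (natS_neq0 k_char0 2)) (negPf h0).
have [E0 E1 E2] := dd_quadricE.
have dL w : b0 * ev (0 : 'rV[k]_3) (dd w (D0 q)) + b1 * ev (0 : 'rV[k]_3) (dd w (D1 q))
    + b2 * ev (0 : 'rV[k]_3) (dd w (D2 q)) = 0.
  have := congr1 (fun f => ev (0 : 'rV[k]_3) (dd w f)) L0; rewrite /= dd0 rmorph0 /L.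
  by rewrite !ddD !ddM !ddC !mul0r !add0r !rmorphD !rmorphM /= !mevalC.
have vD0 : ev v (D0 q) = 0.
  by rewrite E0 !rmorphD !rmorphM /= !mevalC v0 v1 v2 -(dL e0); ring.
have vD1 : ev v (D1 q) = 0.
  rewrite E1 !rmorphD !rmorphM /= !mevalC v0 v1 v2 -(dL e1) [D1 (D0 q)]dd_comm; ring.
have vD2 : ev v (D2 q) = 0.
  rewrite E2 !rmorphD !rmorphM /= !mevalC v0 v1 v2 -(dL e2) [D2 (D0 q)]dd_comm.
  rewrite [D2 (D1 q)]dd_comm; ring.
have cv := vertex vn0 vD0 vD1 vD2.
have two0 : (2%:R : k) != 0 by exact: natS_neq0 k_char0 1.
have three0 : (3%:R : k) != 0 by exact: natS_neq0 k_char0 2.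
have vF : ev v F = 0.
  have := congr1 (fun f => ev v f) S0; rewrite /= /S rmorph0 !rmorphD !rmorphM /= rmorph_nat.
  by rewrite vD0 vD1 vD2 !mulr0 !addr0 => /eqP; rewrite mulf_eq0 (negPf two0) => /eqP.
have vq : ev v q = 0.
  have := frame_euler_ev fr v qh; rewrite vD0 vD1 vD2 !mulr0 !addr0 => /esym/eqP.
  by rewrite mulf_eq0 (negPf two0) => /eqP.
(* At [v] both q and [F] vanish and b . grad c = 3 c, so [EC] becomes 3 c^2 = 0. *)
have := congr1 (fun f => ev v f) EC; rewrite /= rmorph0 !rmorphD !rmorphM !rmorphD !rmorphM /=.
rewrite rmorph_nat vq mul0r add0r !mevalC vF mulr0 add0r -{1}v0 -{1}v1 -{1}v2.
rewrite (frame_euler_ev fr v ch) => /eqP.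
by rewrite !mulf_eq0 (negPf cv) (negPf three0).
Qed.

Lemma complete_intersection_not_VV : ~ VV_torsion_free J I.
Proof.
have [idJ _ _ _] := ptsJ; have [idI JI minI _] := jacI.
apply: (VV_torsion_freePn (f := q * adjN)) => //.
- exact: (idlMr idJ).
- have [y E] := quad_minors; have id2 := ideal_pow_ideal I 2.
  rewrite -mpolyC_nat in E; rewrite (eq_divC (natS_neq0 k_char0 1) E).
  have I2 := @mem_ideal_pow2 _ I.
  have IM v w := minI _ _ v w Jq Jc; have Ic := JI _ Jc.
  have II (a : k) f f' : I f -> I f' -> ideal_pow I 2 (a%:MP * (f * f')).
    by move=> If If'; apply: (idlMl id2); apply: I2.
  apply: (idlMl id2); apply: (idlD id2); last exact: II.
  apply: (idlD id2); last apply: (idlMl id2); do 2?[apply: (idlD id2)]; apply: II; exact: IM.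
move=> H; apply: adjN_notin.
have [i [j [Ii Ij E]]] : exists i j, [/\ I i, I j & q * adjN = q * i + c * j].
  move: H; apply: (ideal_prod_sub (T := fun f => exists i j, [/\ I i, I j & f = q * i + c * j]))
     => [|f i /Jqc[A [B ->]] Ii].
    split=> [|x z [i [j [Ii Ij ->]]] [i' [j' [Ii' Ij' ->]]]|r x [i [j [Ii Ij ->]]]].
    - by exists 0, 0; rewrite !mulr0 addr0; split=> //; apply: (idl0 idI).
    - by exists (i + i'), (j + j'); split; [apply: (idlD idI)|apply: (idlD idI)|ring].
    by exists (r * i), (r * j); split; [apply: (idlMl idI)|apply: (idlMl idI)|ring].
  by exists (A * i), (B * i); split; [apply: (idlMl idI)|apply: (idlMl idI)|ring].
have [|y [Ey _]] := coprime_qc (y := adjN - i) (b := j); first by rewrite mulrBr E; ring.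
rewrite -[adjN](subrK i) Ey; apply: (idlD idI) => //; apply: (idlMr idI); exact: JI.
Qed.

End CompleteIntersection.

(** * Polar forms and secants of a conic *)

Section Quadrics.
Variables (k : fieldType) (k_char0 : [pchar k]%R =i pred0).
Local Notation R := {mpoly k[3]}.
Implicit Types (a b v w : 'rV[k]_3) (f q : R).

(** Reduces identities linear in the conic to products of two linear forms. *)
Lemma homog2_ind (P : R -> Prop) q : q \is 2.-homog -> (forall f g, P f -> P g -> P (f + g)) ->
  (forall a b, P (lf a * lf b)) -> P q.
Proof.
move=> qh PD PM; have e0 : (\row_i (i == i0)%:R : 'rV[k]_3) != 0.
  by apply/eqP => /rowP/(_ i0)/eqP; rewrite !mxE /= oner_eq0.
have [b [c fr]] := frame_with e0.
have [f0 [f1 [f2 [-> /homog1P[r0 ->] /homog1P[r1 ->] /homog1P[r2 ->]]]]] := homog_split k_char0 fr qh.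
by apply: (PD); [apply: (PD)|].
Qed.

(** [ev a (dd b q)] is the polar form of q. For two distinct points of the conic it vanishes exactly
    when the line through them lies on the conic. *)
Lemma quad_polar q a b (x y : k) : q \is 2.-homog ->
  ev (x *: a + y *: b) q = x ^+ 2 * ev a q + y ^+ 2 * ev b q + x * y * ev a (dd b q).
Proof.
move=> qh; apply: (homog2_ind (P := fun q => ev (x *: a + y *: b) q
  = x ^+ 2 * ev a q + y ^+ 2 * ev b q + x * y * ev a (dd b q)) qh) => [f g|u v].
  by rewrite ddD !rmorphD /= => -> ->; ring.
rewrite ddM !dd_lf !mevalD !mevalM !mevalC !lf_eval; vring.
Qed.

Lemma quad_polarC q a b : q \is 2.-homog -> ev a (dd b q) = ev b (dd a q).
Proof.
move=> qh; apply: (homog2_ind (P := fun q => ev a (dd b q) = ev b (dd a q)) qh) => [f g|u v].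
  by rewrite !ddD !rmorphD /= => -> ->.
rewrite !ddM !dd_lf !mevalD !mevalM !mevalC !lf_eval; ring.
Qed.

Lemma quad_polar_diag q a : q \is 2.-homog -> ev a (dd a q) = 2%:R * ev a q.
Proof.
move=> qh; apply: (homog2_ind (P := fun q => ev a (dd a q) = 2%:R * ev a q) qh) => [f g|u v].
  by rewrite !ddD !rmorphD /= => -> ->; ring.
rewrite !ddM !dd_lf !mevalD !mevalM !mevalC !lf_eval; ring.
Qed.

Lemma det3_span a b v : cross a b != 0 -> dot (cross a b) v = 0 ->
  exists x y, v = x *: a + y *: b.
Proof.
move=> /frame_complete[c fr] abv.
by exists (dot (cross b c) v), (dot (cross c a) v); rewrite {1}(frame_expand fr v) abv scale0r addr0.
Qed.

(** The ideal of the two points is generated by their line and u v. Modulo the line q is a multiple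
    of u v, and the multiplier is nonzero because the polar form is, so q can replace u v. *)
Lemma secant_ideal q a b d f : q \is 2.-homog -> cross a b != 0 ->
  ev a q = 0 -> ev b q = 0 -> ev a (dd b q) != 0 ->
  f \is d.-homog -> ev a f = 0 -> ev b f = 0 ->
  exists A B, f = q * A + lf (cross a b) * B.
Proof.
move=> qh ab qa qb qab fd fa fb; have [c fr] := frame_complete ab.
have fr' : framed b c a by exact: frame_rot.
pose u := lf (cross c a); pose v := lf (cross b c).
have bu : ev b u = 1 by rewrite lf_eval -fr; vring.
have av : ev a v = 1 by rewrite lf_eval -fr; vring.
have au : ev a u = 0 by rewrite lf_eval; vring.
have bv : ev b v = 0 by rewrite lf_eval; vring.
have am : ev a (lf (cross a b)) = 0 by rewrite lf_eval; vring.
have bm : ev b (lf (cross a b)) = 0 by rewrite lf_eval; vring.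
have S e h : h \is e.-homog -> ev a h = 0 -> ev b h = 0 ->
    exists A B, h = u * v * A + lf (cross a b) * B.
  move=> he ha hb; have [A [B E]] := point_ideal k_char0 fr he ha.
  have := homog_quot (lf_homog (cross a b)) he (lf_homog (cross c a)) E.
  set A' := (X in _ * X + _); set B' := (X in _ + _ * X) => E'.
  have hA' : A' \is e.-1.-homog.
    by rewrite /A'; case: (e) => [|e'] /=; rewrite ?rpred0 // subn1 pihomogP.
  have bA : ev b A' = 0.
    by move: hb; rewrite E' rmorphD !rmorphM /= bu bm mul1r mul0r addr0.
  have [P [Q EA]] := point_ideal k_char0 fr' hA' bA.
  by exists Q, (u * P + B'); rewrite E' EA /u /v; ring.
have [A [B E]] := S _ _ fd fa fb; have [Q [P EQ]] := S _ _ qh qa qb.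
have uvh : u * v \is 2.-homog := dhomogM (lf_homog _) (lf_homog _).
have := homog_quot (lf_homog (cross a b)) qh uvh EQ; rewrite /= subnn.
have [y ->] := homog0P (pihomogP mdeg 0 Q); set P' := pihomog _ _ _ => EQ'.
have y0 : y != 0.
  apply: contraNneq qab => y0.
  move: EQ'; rewrite y0 mpolyC0 mulr0 add0r => ->.
  by rewrite ddM rmorphD !rmorphM /= am mul0r addr0 dd_lf [X in X%:MP](_ : _ = 0) ?mpolyC0 ?rmorph0 ?mul0r //; vring.
exists (y^-1%:MP * A), (B - y^-1%:MP * P' * A).
rewrite E (eq_divC (f := u * v) (g := q - lf (cross a b) * P') y0); first by ring.
by rewrite EQ'; ring.
Qed.

End Quadrics.

Section Transversality.
Variables (k : fieldType) (k_char0 : [pchar k]%R =i pred0).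
Variables (e0 e1 e2 : 'rV[k]_3) (fr : framed e0 e1 e2).
Local Notation x0 := (lf (cross e1 e2)).
Local Notation x1 := (lf (cross e2 e0)).
Local Notation x2 := (lf (cross e0 e1)).

Lemma frame_cross a b :
  [/\ dot (cross a b) e0 = ev a x1 * ev b x2 - ev a x2 * ev b x1,
      dot (cross a b) e1 = ev a x2 * ev b x0 - ev a x0 * ev b x2
    & dot (cross a b) e2 = ev a x0 * ev b x1 - ev a x1 * ev b x0].
Proof. by rewrite !lf_eval; split; rewrite -[LHS]mul1r -[X in X * _ = _]fr; vring. Qed.

Lemma frame_dd b f : dd b f = (ev b x0)%:MP * dd e0 f + (ev b x1)%:MP * dd e1 f
  + (ev b x2)%:MP * dd e2 f.
Proof. by rewrite {1}(frame_expand fr b) !ddDv !ddZv !lf_eval. Qed.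

(** On cross products the adjugate acts through 2 x 2 minors: at t (a x b) its value is t^2 times
    the Gram determinant of a and b. *)
Lemma adj_quad_cross (A : comNzRingType) (h00 h01 h02 h11 h12 h22 a0 a1 a2 b0 b1 b2 t : A) :
  let H u0 u1 u2 v0 v1 v2 := u0 * (h00 * v0 + h01 * v1 + h02 * v2)
    + u1 * (h01 * v0 + h11 * v1 + h12 * v2) + u2 * (h02 * v0 + h12 * v1 + h22 * v2) in
  adj_quad h00 h01 h02 h11 h12 h22 (t * (a1 * b2 - a2 * b1)) (t * (a2 * b0 - a0 * b2))
    (t * (a0 * b1 - a1 * b0))
  = t * t * (H a0 a1 a2 a0 a1 a2 * H b0 b1 b2 b0 b1 b2
    - H b0 b1 b2 a0 a1 a2 * H b0 b1 b2 a0 a1 a2).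
Proof. by rewrite /= /adj_quad; ring. Qed.

(** At a the gradient of c is C(a) (a x b). Since grad q . a = 2 q(a) = 0, the formula for a double
    cross product leaves M = C(a) (grad q . b) a, and in the Gram determinant only the square of the
    polar form survives. *)
Lemma secant_transversal q c C a b : q \is 2.-homog -> c = lf (cross a b) * C ->
  ev a q = 0 -> ev b q = 0 -> ev a (dd b q) != 0 -> ev a C != 0 ->
  exists h : k, [/\ h != 0, ev a (dd_minor e1 e2 q c) = h * ev a x0,
    ev a (dd_minor e2 e0 q c) = h * ev a x1, ev a (dd_minor e0 e1 q c) = h * ev a x2
  & ev a (adjN e0 e1 e2 q c) = - h ^+ 2].
Proof.
move=> qh Ec qa qb qab Ca; exists (ev a C * ev a (dd b q)).
have dc w : ev a (dd w c) = ev a C * dot (cross a b) w.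
  rewrite Ec ddM dd_lf mevalD !mevalM mevalC lf_eval.
  have -> : dot (cross a b) a = 0 by vring.
  by rewrite mul0r addr0 mulrC.
have [w0 w1 w2] := frame_cross a b.
have Ea := frame_euler_ev fr a qh; have Eb := frame_euler_ev fr b qh.
have Eab : ev a (dd b q) = ev b x0 * ev a (dd e0 q) + ev b x1 * ev a (dd e1 q)
   + ev b x2 * ev a (dd e2 q) by rewrite (frame_dd b) !mevalD !mevalM !mevalC.
have EN : ev a (adjN e0 e1 e2 q c) = - (ev a C * ev a (dd b q)) ^+ 2.
  have [E0 E1 E2] := dd_quadricE fr qh.
  have A00 (u00 u01 u02 u11 u12 u22 : k) f0 f1 f2 :
      ev a (adj_quad u00%:MP u01%:MP u02%:MP u11%:MP u12%:MP u22%:MP f0 f1 f2)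
      = adj_quad u00 u01 u02 u11 u12 u22 (ev a f0) (ev a f1) (ev a f2).
    by rewrite /adj_quad !(mevalMn, mevalD, mevalN, mevalM, mevalC).
  have Dq v : [/\ ev v (dd e0 q) = ev (0 : 'rV[k]_3) (dd e0 (dd e0 q)) * ev v x0
      + ev (0 : 'rV[k]_3) (dd e0 (dd e1 q)) * ev v x1 + ev (0 : 'rV[k]_3) (dd e0 (dd e2 q)) * ev v x2,
      ev v (dd e1 q) = ev (0 : 'rV[k]_3) (dd e0 (dd e1 q)) * ev v x0
      + ev (0 : 'rV[k]_3) (dd e1 (dd e1 q)) * ev v x1 + ev (0 : 'rV[k]_3) (dd e1 (dd e2 q)) * ev v x2
    & ev v (dd e2 q) = ev (0 : 'rV[k]_3) (dd e0 (dd e2 q)) * ev v x0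
      + ev (0 : 'rV[k]_3) (dd e1 (dd e2 q)) * ev v x1 + ev (0 : 'rV[k]_3) (dd e2 (dd e2 q)) * ev v x2].
    by split; [have := congr1 (fun f => ev v f) E0|have := congr1 (fun f => ev v f) E1
      |have := congr1 (fun f => ev v f) E2]; rewrite /= !mevalD !mevalM !mevalC.
  rewrite /adjN A00 !dc w0 w1 w2 adj_quad_cross /=.
  have [<- <- <-] := Dq a; have [<- <- <-] := Dq b.
  by rewrite Ea Eb qa qb -Eab; ring.
split=> //; first by rewrite mulf_neq0.
all: rewrite /dd_minor mevalB !mevalM !dc ?w0 ?w1 ?w2 Eab; move: Ea; rewrite qa mulr0.
all: move: (ev a x0) (ev a x1) (ev a x2) (ev b x0) (ev b x1) (ev b x2)
  (ev a (dd e0 q)) (ev a (dd e1 q)) (ev a (dd e2 q)) (ev a C) => a0 a1 a2 b0 b1 b2 g0 g1 g2 t E.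
- by rewrite -[LHS]addr0 -[X in _ + X](mulr0 (t * b0)) -E; ring.
- by rewrite -[LHS]addr0 -[X in _ + X](mulr0 (t * b1)) -E; ring.
by rewrite -[LHS]addr0 -[X in _ + X](mulr0 (t * b2)) -E; ring.
Qed.

End Transversality.

(** * Six points of a conic joined in three pairs *)

Section ThreePairs.
Variables (k : fieldType) (k_char0 : [pchar k]%R =i pred0).
Local Notation R := {mpoly k[3]}.
Variable q : R.
Hypothesis qh : q \is 2.-homog.
Variables a1 b1 a2 b2 a3 b3 : 'rV[k]_3.
Local Notation s := [:: a1; b1; a2; b2; a3; b3].
Hypotheses (s_uniq : uniq s) (s_ind : {in s &, forall p p', p != p' -> cross p p' != 0})
  (sq : {in s, forall p, ev p q = 0}).
Hypotheses (q1 : ev a1 (dd b1 q) != 0) (q2 : ev a2 (dd b2 q) != 0) (q3 : ev a3 (dd b3 q) != 0).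

Lemma secant_join a b p : a \in s -> b \in s -> p \in s -> a != b -> p != a -> p != b ->
  ev a (dd b q) != 0 -> dot (cross a b) p != 0.
Proof.
move=> sa sb sp ab pa pb qab; apply/eqP => /(det3_span (s_ind sa sb ab))[x [y E]].
have := sq sp; rewrite E quad_polar // (sq sa) (sq sb) !mulr0 !add0r => /eqP.
rewrite mulf_eq0 (negPf qab) orbF mulf_eq0 => /orP[]/eqP z.
  have /eqP := s_ind sp sb pb; apply; rewrite E z; rvring.
have /eqP := s_ind sp sa pa; apply; rewrite E z; rvring.
Qed.

Local Notation m1 := (lf (cross a1 b1)).
Local Notation m2 := (lf (cross a2 b2)).
Local Notation m3 := (lf (cross a3 b3)).
Local Notation c := (m1 * m2 * m3).

Variables (J I : R -> Prop).
Hypotheses (ptsJ : ideal_of_points s J) (jacI : jacobian_of J I).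

Lemma secant_coprime m y z : m != 0 -> (exists p, dot m p = 0 /\ ev p q != 0) ->
  q * y = lf m * z -> exists y', y = lf m * y' /\ z = q * y'.
Proof.
move=> m0 [p [mp qp]] E; have [[u Eu]|[u Eu]] := lf_prime m0 E.
  by move/eqP: qp; case; rewrite Eu mevalM lf_eval mp mul0r.
exists u; split=> //; apply: (mulfI (x := lf m)); last by rewrite -E Eu; ring.
have [w mw] := dot_surj m0; apply: contraTneq isT => lm0.
by move/eqP: (oner_neq0 k); case; rewrite -mw -lf_eval lm0 meval0.
Qed.

(** The polar form pairs a singular point with every vector to zero, whereas its restriction to the
    secant through a and b is nondegenerate. *)
Lemma secant_vertex a b v : cross a b != 0 -> ev a q = 0 -> ev b q = 0 ->
  ev a (dd b q) != 0 -> v != 0 -> (forall w, ev v (dd w q) = 0) -> dot (cross a b) v != 0.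
Proof.
move=> ab qa qb qab v0 qv; apply/eqP => /(det3_span ab)[x [y E]].
have Ea : ev a (dd v q) = y * ev a (dd b q).
  by rewrite E ddDv !ddZv mevalD !mevalM !mevalC quad_polar_diag // qa !mulr0 add0r.
have Eb : ev b (dd v q) = x * ev a (dd b q).
  rewrite E ddDv !ddZv mevalD !mevalM !mevalC quad_polar_diag // qb !mulr0 addr0.
  by rewrite (quad_polarC k_char0 _ _ qh).
move/eqP: Ea; rewrite (quad_polarC k_char0 _ _ qh) qv eq_sym mulf_eq0 (negPf qab) orbF => /eqP y0.
move/eqP: Eb; rewrite (quad_polarC k_char0 _ _ qh) qv eq_sym mulf_eq0 (negPf qab) orbF => /eqP x0.
by move/eqP: v0; case; rewrite E x0 y0 !scale0r addr0.
Qed.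

Ltac distinct := by apply: contraTneq s_uniq => ->; rewrite /= !inE ?eqxx ?orbT /= ?andbF.
Ltac in_s := by rewrite !inE ?eqxx ?orbT.

Lemma three_pairs_transversal e0 e1 e2 p : framed e0 e1 e2 -> p \in s ->
  exists h : k, [/\ h != 0, ev p (dd_minor e1 e2 q c) = h * ev p (lf (cross e1 e2)),
    ev p (dd_minor e2 e0 q c) = h * ev p (lf (cross e2 e0)),
    ev p (dd_minor e0 e1 q c) = h * ev p (lf (cross e0 e1))
  & ev p (adjN e0 e1 e2 q c) = - h ^+ 2].
Proof.
move=> fr sp; have tr a b C : c = lf (cross a b) * C -> a \in s -> b \in s ->
    ev a (dd b q) != 0 -> ev a C != 0 -> _ :=
  fun Ec sa sb qab Ca => secant_transversal fr qh Ec (sq sa) (sq sb) qab Ca.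
have nv (f g : 'rV[k]_3) : lf (cross g f) = - lf (cross f g).
  by rewrite -mulN1r -mpolyC1 -mpolyCN -lfZ; congr lf; rvring.
have [r1 r2 r3] : [/\ ev b1 (dd a1 q) != 0, ev b2 (dd a2 q) != 0 & ev b3 (dd a3 q) != 0].
  by split; rewrite (quad_polarC k_char0 _ _ qh).
have sj a b v : a \in s -> b \in s -> v \in s -> a != b -> v != a -> v != b ->
  ev a (dd b q) != 0 -> ev v (lf (cross a b)) != 0.
  by move=> *; rewrite lf_eval; apply: secant_join.
move: sp; rewrite !inE => /or4P[/eqP->|/eqP->|/eqP->|/or3P[]/eqP->].
- apply: (tr a1 b1 (m2 * m3)); [ring|in_s|in_s|done|].
  by rewrite mevalM mulf_neq0 //; apply: sj => //; (in_s || distinct).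
(* For the second point of a pair the line is b1 x a1 = - (a1 x b1), and the sign passes to the
   cofactor. *)
- apply: (tr b1 a1 (- m2 * m3)); [by rewrite nv; ring|in_s|in_s|done|].
  by rewrite mevalM mevalN mulf_neq0 ?oppr_eq0 //; apply: sj => //; (in_s || distinct).
- apply: (tr a2 b2 (m1 * m3)); [ring|in_s|in_s|done|].
  by rewrite mevalM mulf_neq0 //; apply: sj => //; (in_s || distinct).
- apply: (tr b2 a2 (- m1 * m3)); [by rewrite (nv b2 a2); ring|in_s|in_s|done|].
  by rewrite mevalM mevalN mulf_neq0 ?oppr_eq0 //; apply: sj => //; (in_s || distinct).
- apply: (tr a3 b3 (m1 * m2)); [ring|in_s|in_s|done|].
  by rewrite mevalM mulf_neq0 //; apply: sj => //; (in_s || distinct).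
apply: (tr b3 a3 (- m1 * m2)); [by rewrite (nv b3 a3); ring|in_s|in_s|done|].
by rewrite mevalM mevalN mulf_neq0 ?oppr_eq0 //; apply: sj => //; (in_s || distinct).
Qed.

Lemma three_pairs_not_VV : ~ VV_torsion_free J I.
Proof.
have [idJ homJ evJ memJ] := ptsJ.
have [sa1 sb1 sa2] : [/\ a1 \in s, b1 \in s & a2 \in s] by split; in_s.
have [sb2 sa3 sb3] : [/\ b2 \in s, a3 \in s & b3 \in s] by split; in_s.
have [n1 n2 n3] : [/\ a1 != b1, a2 != b2 & a3 != b3] by split; distinct.
have m1_0 := s_ind sa1 sb1 n1; have m2_0 := s_ind sa2 sb2 n2; have m3_0 := s_ind sa3 sb3 n3.
have qsum a b : ev a q = 0 -> ev b q = 0 -> ev a (dd b q) != 0 ->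
    exists p, dot (cross a b) p = 0 /\ ev p q != 0.
  (* At a + b the conic takes the value of the polar form, so it does not contain the line. *)
  move=> qa qb qab; exists (1 *: a + 1 *: b); split; first by vring.
  by rewrite quad_polar // qa qb !mulr0 !add0r !mul1r.
have qN0 : q != 0.
  by apply: contraNneq q1 => ->; rewrite dd0 meval0.
have ch : c \is 3.-homog.
  exact: (dhomogM (dhomogM (lf_homog _) (lf_homog _)) (lf_homog _)).
have [|e1 [e2 fr]] := frame_with (a := a1).
  by apply: contraNneq m1_0 => ->; apply/eqP; rvring.
apply: (complete_intersection_not_VV k_char0 fr qh ch ptsJ jacI _ _ _ _ _ _ qN0).
- exact: memJ qh sq.
- apply: (memJ _ _ ch) => p; rewrite !mevalM !lf_eval !inE.
  have D a b : dot (cross a b) a = 0 by vring.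
  have D' a b : dot (cross a b) b = 0 by vring.
  by case/or4P=> [/eqP->|/eqP->|/eqP->|/or3P[]/eqP->]; rewrite ?D ?D' ?(mulr0, mul0r).
- apply: (homog_ind _ homJ) => [|f d Jf fd].
    split=> [|x z [A [B ->]] [A' [B' ->]]|r x [A [B ->]]].
    + by exists 0, 0; rewrite !mulr0 addr0.
    + by exists (A + A'), (B + B'); ring.
    by exists (r * A), (r * B); ring.
  have f0 p : p \in s -> ev p f = 0 by apply: evJ.
  pose cs := [:: (cross a1 b1, [:: a1; b1]); (cross a2 b2, [:: a2; b2]); (cross a3 b3, [:: a3; b3])].
  have cs_s mc p : mc \in cs -> p \in mc.2 -> p \in s.
    by rewrite !inE => /or3P[]/eqP-> /=; rewrite !inE => /orP[]/eqP->; rewrite ?eqxx ?orbT.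
  have [||||A [B]] := chunk_decomp qh (s := cs) _ _ _ fd.
  + by move=> mc p mcs pmc; apply: sq; apply: cs_s pmc.
  + move=> mc d' f'; rewrite !inE => /or3P[]/eqP-> /= f'd f'0;
      by apply: (secant_ideal k_char0 qh _ _ _ _ f'd); rewrite ?sq ?f'0 ?inE ?eqxx ?orbT.
  + by rewrite /= !andbT; do ?[apply/andP; split]; apply: secant_join => //; (in_s || distinct).
  + by move=> mc p mcs pmc; apply: f0; apply: cs_s pmc.
  by rewrite !big_cons big_nil mulr1 mulrA; exists A, B.
- move=> y z E; have E1 : q * y = m1 * (m2 * m3 * z) by rewrite E; ring.
  have [y1 [-> /esym E2]] := secant_coprime m1_0 (qsum _ _ (sq sa1) (sq sb1) q1) E1.
  have {}E2 : q * y1 = m2 * (m3 * z) by rewrite E2; ring.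
  have [y2 [-> /esym E3]] := secant_coprime m2_0 (qsum _ _ (sq sa2) (sq sb2) q2) E2.
  have [y3 [-> ->]] := secant_coprime m3_0 (qsum _ _ (sq sa3) (sq sb3) q3) E3.
  by exists y3; split=> //; ring.
- by move=> p; apply: three_pairs_transversal.
- move=> v v0 q_0 q_1 q_2; have qv w : ev v (dd w q) = 0.
    by rewrite (frame_dd fr w) !mevalD !mevalM q_0 q_1 q_2 !mulr0 !addr0.
  by rewrite !mevalM !lf_eval !mulf_neq0 //; apply: secant_vertex => //; apply: sq.
by exists a1.
Qed.

End ThreePairs.

(** * Points on no conic *)

Section MaximalIdealPowers.
Variables (k : fieldType) (k_char0 : [pchar k]%R =i pred0).
Local Notation R := {mpoly k[3]}.
Implicit Types (a b v w p : 'rV[k]_3) (f g : R) (d n t : nat).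

(** The n-th power of the ideal generated by the coordinates. *)
Definition mm n : R -> Prop := ideal_gen (fun f : R => f \is n.-homog).

Lemma mm_ideal n : is_ideal (mm n). Proof. exact: ideal_gen_ideal. Qed.

Lemma frame_exists : exists e0 e1 e2 : 'rV[k]_3, framed e0 e1 e2.
Proof.
have e0 : (\row_i (i == i0)%:R : 'rV[k]_3) != 0.
  by apply/eqP => /rowP/(_ i0)/eqP; rewrite !mxE /= oner_eq0.
by have [b [c fr]] := frame_with e0; exists (\row_i (i == i0)%:R), b, c.
Qed.

Lemma homog_mul_ind (T : R -> Prop) n t f : (forall f g, T f -> T g -> T (f + g)) ->
  (forall f g, f \is n.-homog -> g \is t.-homog -> T (f * g)) ->
  f \is (n + t).-homog -> T f.
Proof.
move=> TD; have [e0 [e1 [e2 fr]]] := frame_exists.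
elim: n T TD f => [|n IHa] T TD f TM fh.
  by rewrite -[f]mul1r; apply: TM => //; apply: dhomog1.
have [f0 [f1 [f2 [-> h0 h1 h2]]]] := homog_split k_char0 fr fh.
have H v h : h \is (n + t).-homog -> T (lf v * h).
  move=> hh; apply: (IHa (fun h => T (lf v * h)) _ h _ hh) => [x y Tx Ty|x y xh yh].
    by rewrite mulrDr; apply: (TD).
  rewrite mulrA; apply: (TM) => //; exact: (dhomogM (lf_homog _) xh).
by do 2?[apply: (TD)]; apply: (H).
Qed.

Lemma mem_mm n d f : (n <= d)%N -> f \is d.-homog -> mm n f.
Proof.
move=> nd; rewrite -(subnKC nd).
apply: homog_mul_ind => [x y|x y xh yh]; first exact: (idlD (mm_ideal n)).
by apply: (idlMr (mm_ideal n)); apply: mem_ideal_gen.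
Qed.

Lemma mm_mul n t f g : mm n f -> mm t g -> mm (n + t) (f * g).
Proof.
move=> + gt; apply: (ideal_gen_sub (T := fun f => mm (n + t) (f * g))).
  exact/idl_colon/mm_ideal.
move=> {}f fh; rewrite mulrC; move: gt.
apply: (ideal_gen_sub (T := fun g => mm (n + t) (g * f))).
  exact/idl_colon/mm_ideal.
by move=> {}g gh; rewrite mulrC; apply: mem_ideal_gen; apply: dhomogM.
Qed.

Lemma mm_pow n t f : mm (n * t) f -> ideal_pow (mm n) t f.
Proof.
have idP := ideal_pow_ideal (mm n) t; apply: ideal_gen_sub => // {}f.
elim: t f {idP} => [//|t IHt] f; rewrite mulnS.
have idP := ideal_pow_ideal (mm n) t.+1.
apply: homog_mul_ind => [x y|x y xh yh]; first exact: (idlD idP).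
by apply: mem_ideal_prod; [apply: mem_ideal_gen | apply: IHt].
Qed.

Lemma pow_mm n t f : ideal_pow (mm n) t f -> mm (n * t) f.
Proof.
elim: t f => [|t IHt] f.
  by move=> _; rewrite muln0 -[f]mulr1; apply: (idlMl (mm_ideal 0)); apply: mem_ideal_gen; apply: dhomog1.
rewrite mulnS; apply: ideal_prod_sub => [|x y xn /IHt]; first exact: mm_ideal.
exact: mm_mul.
Qed.

Lemma mm_low n d f : mm n f -> (d < n)%N -> pihomog mdeg d f = 0.
Proof.
case=> cs csn -> dn; rewrite raddf_sum big_seq big1 //= => cg /csn gn.
by rewrite (pihomogM _ _ gn) leqNgt dn mul0r.
Qed.

End MaximalIdealPowers.

(** * Interpolation and the degrees of generators *)

Section Interpolation.
Variables (k : fieldType) (k_char0 : [pchar k]%R =i pred0).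
Local Notation R := {mpoly k[3]}.
Implicit Types (a b v w p : 'rV[k]_3) (f g : R) (d n t : nat).
Variables (s : seq 'rV[k]_3) (J : R -> Prop).
Hypothesis ptsJ : ideal_of_points s J.

Definition separator p n f : Prop :=
  [/\ f \is n.-homog, ev p f != 0 & forall p', p' \in s -> p' != p -> ev p' f = 0].

Lemma separator_ideal (T : R -> Prop) n : is_ideal T ->
  (forall f, f \is n.-homog -> (forall p, p \in s -> ev p f = 0) -> T f) ->
  (forall p, p \in s -> exists2 E, T E & separator p n E) ->
  forall f, f \is n.-homog -> T f.
Proof.
move=> idT T0 sepT f fh.
suff H (s' : seq 'rV[k]_3) : {subset s' <= s} -> forall g : R, g \is n.-homog ->
    (forall p, p \in s -> p \notin s' -> ev p g = 0) -> T g.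
  by apply: (H s) => // p ->.
elim: s' => [|p s' IHs] s's g gh g0; first by apply: (T0 _ gh) => p sp; apply: g0.
have sp : p \in s by apply: s's; rewrite inE eqxx.
have [E TE [Eh Ep E0]] := sepT p sp.
pose y := ev p g / ev p E.
rewrite -(subrK (y%:MP * E) g); apply: (idlD idT); last exact: (idlMl idT).
apply: IHs => [v vs'||v sv vs'].
- by apply: s's; rewrite inE vs' orbT.
- by apply: rpredB => //; rewrite mul_mpolyC rpredZ.
rewrite mevalB mevalM mevalC; have [->|vp] := eqVneq v p.
  by rewrite /y divfK // subrr.
by rewrite E0 // mulr0 subr0; apply: g0; rewrite // inE negb_or vp.
Qed.

Variable r : nat.
Hypothesis s_neq0 : forall p, p \in s -> p != 0.
Hypothesis sep_r : forall p, p \in s -> exists E, separator p r E.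

(* If the points impose independent conditions on forms of degree r then
   J is generated in degree at most r + 1. *)
Lemma ideal_of_points_step e0 e1 e2 d f : framed e0 e1 e2 -> (r < d)%N ->
  f \is d.+1.-homog -> J f -> exists j0 j1 j2, [/\ [/\ J j0, J j1 & J j2],
   [/\ j0 \is d.-homog, j1 \is d.-homog & j2 \is d.-homog] &
  f = lf (cross e1 e2) * j0 + lf (cross e2 e0) * j1 + lf (cross e0 e1) * j2].
Proof.
move=> fr rd fh Jf; have [idJ _ evJ memJ] := ptsJ.
have [f0 [f1 [f2 [Ef h0 h1 h2]]]] := homog_split k_char0 fr fh.
set x0 := lf (cross e1 e2) in Ef *; set x1 := lf (cross e2 e0) in Ef *.
set x2 := lf (cross e0 e1) in Ef *.
pose T f := exists j0 j1 j2, [/\ [/\ J j0, J j1 & J j2],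
   [/\ j0 \is d.-homog, j1 \is d.-homog & j2 \is d.-homog] & f = x0 * j0 + x1 * j1 + x2 * j2].
have TD x y : T x -> T y -> T (x + y).
  move=> [j0 [j1 [j2 [[J0 J1 J2] [H0 H1 H2] ->]]]] [i0 [i1 [i2 [[I0 I1 I2] [K0 K1 K2] ->]]]].
  exists (j0 + i0), (j1 + i1), (j2 + i2); split; last by ring.
    by split; apply: (idlD idJ).
  by split; apply: rpredD.
suff H (s' : seq 'rV[k]_3) : {subset s' <= s} -> forall g0 g1 g2 : R,
    g0 \is d.-homog -> g1 \is d.-homog -> g2 \is d.-homog ->
    (forall p, p \in s -> p \notin s' -> [/\ ev p g0 = 0, ev p g1 = 0 & ev p g2 = 0]) ->
    J (x0 * g0 + x1 * g1 + x2 * g2) -> T (x0 * g0 + x1 * g1 + x2 * g2).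
  by rewrite Ef; apply: (H s) => // [p ->|] //; rewrite -Ef.
elim: s' => [|p s' IHs] s's g0 g1 g2 G0 G1 G2 gs' Jg.
  by exists g0, g1, g2; split=> //; split; [apply: (memJ _ _ G0) | apply: (memJ _ _ G1)
    | apply: (memJ _ _ G2)] => p sp; have [] := gs' p sp.
have sp : p \in s by apply: s's; rewrite inE eqxx.
have [C [Ch Cp C0]] := sep_r sp.
have [a ap] := dot_surj (s_neq0 sp); rewrite dotC in ap.
(* The separator, scaled to value 1 at p and raised to degree d by a linear form that is itself 1 at
   p. *)
pose E := (ev p C)^-1%:MP * (C * lf a ^+ (d - r)).
have Ep : ev p E = 1 by rewrite /E !mevalM mevalC rmorphXn /= lf_eval ap expr1n mulr1 mulVf.
have Eh : E \is d.-homog.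
  have := dhomogM Ch (dhomogMn (d - r) (lf_homog a)).
  by rewrite mul1n (subnKC (ltnW rd)) => h; rewrite /E mul_mpolyC rpredZ.
have E0 v : v \in s -> v != p -> ev v E = 0.
  by move=> sv vp; rewrite /E !mevalM (C0 v) // mul0r mulr0.
pose w := (ev p g0)%:MP * x0 + (ev p g1)%:MP * x1 + (ev p g2)%:MP * x2.
have wh : w \is 1.-homog by do 2?[apply: rpredD]; rewrite mul_mpolyC rpredZ // lf_homog.
have wp : ev p w = 0.
  rewrite -(evJ _ _ Jg sp) !mevalD !mevalM !mevalC; ring.
(* Making the three cofactors vanish at p changes the sum by [E * w]. As w vanishes at p, C w is in
   J; since r < d a factor [lf a] of [E] remains to be expanded in the frame. *)
have TEw : T (E * w).
  pose h := (ev p C)^-1%:MP * (C * w) * lf a ^+ (d - r.+1).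
  have Jh : J h.
    apply: (idlMr idJ); apply: (idlMl idJ); apply: (memJ _ _ (dhomogM Ch wh)) => v sv.
    by rewrite mevalM; have [->|vp] := eqVneq v p; [rewrite wp mulr0 | rewrite C0 ?mul0r].
  have hh : h \is d.-homog.
    have := dhomogM (dhomogM Ch wh) (dhomogMn (d - r.+1) (lf_homog a)).
    by rewrite mul1n addn1 (subnKC rd) => h'; rewrite /h -mulrA mul_mpolyC rpredZ.
  exists ((dot a e0)%:MP * h), ((dot a e1)%:MP * h), ((dot a e2)%:MP * h); split.
  - by split; apply: (idlMl idJ).
  - by split; rewrite mul_mpolyC rpredZ.
  transitivity (lf a * h); last by rewrite {1}(frame_lf fr a) -/x0 -/x1 -/x2; ring.
  rewrite /h /E; have -> : (d - r)%N = (d - r.+1).+1 by rewrite subnSK.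
  by rewrite exprS; ring.
clearbody E.
have -> : x0 * g0 + x1 * g1 + x2 * g2 = (x0 * (g0 - (ev p g0)%:MP * E)
   + x1 * (g1 - (ev p g1)%:MP * E) + x2 * (g2 - (ev p g2)%:MP * E)) + E * w.
  by rewrite /w; ring.
have sub g : g \is d.-homog -> g - (ev p g)%:MP * E \is d.-homog.
  by move=> gh; apply: rpredB => //; rewrite mul_mpolyC rpredZ.
apply: (TD) => //; apply: IHs => [v vs'||||v sv vs'|]; rewrite ?sub //.
- by apply: s's; rewrite inE vs' orbT.
- rewrite !mevalB !mevalM !mevalC; have [->|vp] := eqVneq v p.
    by rewrite Ep !mulr1 !subrr.
  have [|-> -> ->] := gs' v sv; first by rewrite inE negb_or vp.
  by rewrite E0 // !mulr0 subr0.
have Jw : J (E * w).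
  apply: (memJ _ _ (dhomogM Eh wh)) => v sv; rewrite mevalM.
  by have [->|vp] := eqVneq v p; [rewrite wp mulr0 | rewrite E0 ?mul0r].
have := idlB idJ Jg Jw; congr J; rewrite /w; ring.
Qed.

Lemma ideal_of_points_gen n d f : (r.+1 + n <= d)%N -> f \is d.-homog -> J f ->
  ideal_prod J (mm n) f.
Proof.
have [e0 [e1 [e2 fr]]] := frame_exists k; have [idJ _ _ _] := ptsJ.
elim: n d f => [|n IHn] d f nd fh Jf.
  by rewrite -[f]mulr1; apply: mem_ideal_prod => //; apply: mem_ideal_gen; apply: dhomog1.
case: d nd fh => [|d]; first by rewrite addnS.
rewrite addnS ltnS => nd fh.
have [|j0 [j1 [j2 [[J0 J1 J2] [h0 h1 h2] ->]]]] := ideal_of_points_step fr _ fh Jf.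
  by apply: leq_trans nd; rewrite leq_addr.
have H v j : J j -> j \is d.-homog -> ideal_prod J (mm n.+1) (lf v * j).
  move=> Jj jh; move: (IHn _ _ nd jh Jj); rewrite mulrC.
  apply: (ideal_prod_sub (T := fun j => ideal_prod J (mm n.+1) (j * lf v))) => [|x y Jx my].
    exact/idl_colon/ideal_prod_ideal.
  rewrite -mulrA; apply: mem_ideal_prod => //; rewrite -[n.+1]addn1.
  by apply: mm_mul => //; apply: mem_ideal_gen; apply: lf_homog.
have idP := ideal_prod_ideal J (mm n.+1).
by do 2?[apply: (idlD idP)]; apply: H.
Qed.

End Interpolation.

Section NoConic.
Variables (k : fieldType) (k_char0 : [pchar k]%R =i pred0).
Local Notation R := {mpoly k[3]}.
Variables (s : seq 'rV[k]_3) (J I : R -> Prop).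
Hypotheses (ptsJ : ideal_of_points s J) (jacI : jacobian_of J I).
Hypothesis s_neq0 : forall p, p \in s -> p != 0.
Hypothesis sep2 : forall p, p \in s -> exists E, separator s p 2 E.
Hypothesis no_conic : forall d f, (d <= 2)%N -> f \is d.-homog -> J f -> f = 0.

(** For two lines x1 and x2 through p and a conic C through the other points, x1 C and x2 C are in
    J. Their minor is a multiple of C and has the value C(p)^2 at p. *)
Lemma no_conic_separator p : p \in s -> exists2 E, I E & separator s p 4 E.
Proof.
move=> sp; have [C [Ch Cp C0]] := sep2 sp.
have [_ _ minI _] := jacI; have [idJ _ _ memJ] := ptsJ.
have [e1 [e2 fr]] := frame_with (s_neq0 sp).
have [[d00 d01 d02] [d10 d11 d12] [d20 d21 d22]] := frame_dd_dual fr.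
set x1 := lf (cross e2 p) in d00 d01 d02 d10 d11 d12 d20 d21 d22 *.
set x2 := lf (cross p e1) in d00 d01 d02 d10 d11 d12 d20 d21 d22 *.
have J' a : dot a p = 0 -> J (lf a * C).
  move=> ap; apply: (memJ _ _ (dhomogM (lf_homog a) Ch)) => v sv.
  by rewrite mevalM; have [->|vp] := eqVneq v p; [rewrite lf_eval ap mul0r | rewrite C0 ?mulr0].
have x1p : dot (cross e2 p) p = 0 by vring.
have x2p : dot (cross p e1) p = 0 by vring.
exists (dd_minor e1 e2 (x1 * C) (x2 * C)).
  by apply: minI; apply: J'.
have E : dd_minor e1 e2 (x1 * C) (x2 * C) = C * (C + x1 * dd e1 C + x2 * dd e2 C).
  by rewrite /dd_minor !ddM d11 d12 d21 d22; ring.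
split.
- have h v w a b : dd v (lf a * C) * dd w (lf b * C) \is 4.-homog.
    by apply: (dhomogM (dd_homog v (dhomogM (lf_homog a) Ch)) (dd_homog w (dhomogM (lf_homog b) Ch))).
  by apply: rpredB; apply: h.
- rewrite E mevalM !mevalD !mevalM !lf_eval x1p x2p !mul0r !addr0.
  by rewrite mulf_neq0.
by move=> v sv vp; rewrite E mevalM C0 // mul0r.
Qed.

Lemma no_conic_VV : VV_torsion_free J I.
Proof.
have [idI JI minI genI] := jacI; have [idJ homJ _ memJ] := ptsJ.
have mI f : mm 4 f -> I f.
  apply: ideal_gen_sub => // {}f; apply: (separator_ideal idI _ no_conic_separator) => g gh g0.
  by apply: JI; apply: (memJ _ _ gh).
have [e0 [e1 [e2 fr]]] := frame_exists k.
apply: (VV_torsion_freeI (K := mm 4)) => // [f If|t f _ Jf].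
  pose T f := exists a b, [/\ J a, mm 4 b & f = a + b].
  have m4 := @mm_ideal k 4.
  have idT : is_ideal T.
    split=> [|x z [a [b [Ja mb ->]]] [a' [b' [Ja' mb' ->]]]|c x [a [b [Ja mb ->]]]].
    - by exists 0, 0; rewrite addr0; split=> //; [apply: (idl0 idJ) | apply: (idl0 m4)].
    - by exists (a + a'), (b + b'); split; [apply: (idlD idJ)|apply: (idlD m4)|ring].
    by exists (c * a), (c * b); split; [apply: (idlMl idJ)|apply: (idlMl m4)|ring].
  (* Without forms of degree at most two, J is generated by its forms of degree at least three,
     whose minors have degree at least four. *)
  pose G (f : R) := J f /\ exists2 d, (3 <= d)%N & f \is d.-homog.
  apply: (genI G T e0 e1 e2 fr idT) => // [f' []||f' Jf'|f' g' [Jf' [d d3 fd]] [Jg' [d' d'3 gd]]] //.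
  - apply: (homog_ind (ideal_gen_ideal _) homJ) => f' d Jf' fd.
    have [d3|d2] := leqP 3 d; first by apply: mem_ideal_gen; split=> //; exists d.
    by rewrite (no_conic d2 fd Jf'); apply: (idl0 (ideal_gen_ideal _)).
  - by exists f', 0; rewrite addr0; split=> //; apply: (idl0 m4).
  have H v w : T (dd_minor v w f' g').
    exists 0, (dd_minor v w f' g'); rewrite add0r; split=> //; first exact: (idl0 idJ).
    have dd4 : (4 <= d.-1 + d'.-1)%N.
      by case: d d' d3 d'3 {fd gd} => [|d] [|d'] //=; rewrite !ltnS => *; apply: (@leq_add 2 2).
    apply: (mem_mm k_char0 dd4).
    by apply: rpredB; exact: (dhomogM (dd_homog _ fd) (dd_homog _ gd)).
  by split; apply: H.
move=> /pow_mm fm; have idP := ideal_prod_ideal J (ideal_pow I t).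
rewrite (pihomog_partitionE (leqnn (mmeasure mdeg f))).
apply: (idl_sum idP) => i _.
have [id|di] := ltnP i (4 * t.+1); first by rewrite (mm_low fm id); apply: (idl0 idP).
(* With r = 2 the bound is 3 + 4 t, and the degree here is at least 4 + 4 t. *)
have := ideal_of_points_gen k_char0 ptsJ s_neq0 sep2 (n := 4 * t) _ (pihomogP _ i f) (homJ _ _ Jf).
move=> H; apply: ideal_prodS (H _) => // [g|]; last by apply: leq_trans di; rewrite mulnS leq_add2r.
by move=> /(mm_pow k_char0); apply: ideal_powS.
Qed.

End NoConic.

(** * Four collinear points *)

Section HomogeneousIdeals.
Variable k : fieldType.
Local Notation R := {mpoly k[3]}.

Definition hom_ideal (T : R -> Prop) := forall f d, T f -> T (pihomog mdeg d f).

Lemma ideal_gen_hom (S : R -> Prop) : (forall f, S f -> exists d, f \is d.-homog) ->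
  hom_ideal (ideal_gen S).
Proof.
move=> Sh _ d [cs csS ->]; rewrite raddf_sum /=.
apply: (idl_sum_seq (ideal_gen_ideal S)) => cg csg; have Sg := csS _ csg.
have [n gn] := Sh _ Sg; rewrite (pihomogM _ _ gn).
by apply: (idlMl (ideal_gen_ideal S)); apply: mem_ideal_gen.
Qed.

Lemma ideal_prod_hom (A B : R -> Prop) : hom_ideal A -> hom_ideal B ->
  hom_ideal (ideal_prod A B).
Proof.
move=> hA hB.
pose S (f : R) := exists a b, [/\ A a, B b, f = a * b & exists d, f \is d.-homog].
have SAB f : ideal_gen S f -> ideal_prod A B f.
  apply: ideal_gen_sub; first exact: ideal_prod_ideal.
  by move=> {}f [a [b [Aa Bb -> _]]]; apply: mem_ideal_prod.
move=> f d ABf; apply: SAB.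
have : ideal_gen S f.
  move: f ABf; apply: ideal_prod_sub => [|a b Aa Bb]; first exact: ideal_gen_ideal.
  rewrite (pihomog_partitionE (leqnn (mmeasure mdeg a))).
  rewrite (pihomog_partitionE (leqnn (mmeasure mdeg b))) mulr_suml.
  apply: (idl_sum (ideal_gen_ideal S)) => i _; rewrite mulr_sumr.
  apply: (idl_sum (ideal_gen_ideal S)) => j _; apply: mem_ideal_gen.
  exists (pihomog mdeg i a), (pihomog mdeg j b); split; [exact: hA | exact: hB | by [] |].
  by exists (i + j)%N; apply: dhomogM; apply: pihomogP.
by apply: ideal_gen_hom => g [a [b [_ _ _ ?]]].
Qed.

Lemma ideal_pow_hom (A : R -> Prop) n : hom_ideal A -> hom_ideal (ideal_pow A n).
Proof. by move=> hA; elim: n => [|n IHn] //=; apply: ideal_prod_hom. Qed.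

End HomogeneousIdeals.

(** * Multiples of the line and their restriction to a residual point *)

Section ResidualPoint.
Variables (k : fieldType) (k_char0 : [pchar k]%R =i pred0).
Local Notation R := {mpoly k[3]}.
Variables (e0 e1 e2 : 'rV[k]_3) (fr : framed e0 e1 e2).
Local Notation s := (lf (cross e1 e2)).
Local Notation u := (lf (cross e2 e0)).
Local Notation v := (lf (cross e0 e1)).
Implicit Types (f g h : R) (d n t : nat).

Lemma frame_X i : 'X_i = (e0 0 i)%:MP * s + (e1 0 i)%:MP * u + (e2 0 i)%:MP * v :> R.
Proof.
rewrite -[LHS]mul1r -[X in X * _ = _](mpolyC1 3 k) -[X in X%:MP * _ = _]fr !lfE.
by move: i; apply: ord3P; rewrite /det3 /dot !crossE; ring.
Qed.

(* The restriction to the line spanned by the vector e1, with values c u^d. *)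
Definition axis (f : R) : R := f \mPo [tuple (e1 0 i)%:MP * u | i < 3].

Lemma axisD f g : axis (f + g) = axis f + axis g. Proof. exact: rmorphD. Qed.
Lemma axisM f g : axis (f * g) = axis f * axis g. Proof. exact: rmorphM. Qed.
Lemma axisX f n : axis (f ^+ n) = axis f ^+ n. Proof. exact: rmorphXn. Qed.
Lemma axisC (x : k) : axis x%:MP = x%:MP. Proof. exact: comp_mpolyC. Qed.
Lemma axis_lf a : axis (lf a) = (dot a e1)%:MP * u.
Proof.
rewrite /axis [lf a]lfE !rmorphD !rmorphM /= !comp_mpolyC !comp_mpolyXU -!tnth_nth !tnth_mktuple.
by rewrite /dot; ring.
Qed.
Lemma axis_s : axis s = 0.
Proof. by rewrite axis_lf -(mpolyC0 3 k) -[RHS](mul0r u) -(mpolyC0 3 k); congr (_%:MP * _); vring. Qed.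
Lemma axis_v : axis v = 0.
Proof. by rewrite axis_lf -[RHS](mul0r u) -(mpolyC0 3 k); congr (_%:MP * _); vring. Qed.
Lemma axis_u : axis u = u.
Proof. by rewrite axis_lf -[RHS](mul1r u) -(mpolyC1 3 k) -fr; congr (_%:MP * _); vring. Qed.

Lemma axis_mod f : exists A B, f = axis f + s * A + v * B.
Proof.
pose T f := exists A B, f = s * A + v * B.
have idT : is_ideal T.
  split=> [|x z [A [B ->]] [A' [B' ->]]|r x [A [B ->]]].
  - by exists 0, 0; rewrite !mulr0 addr0.
  - by exists (A + A'), (B + B'); ring.
  by exists (r * A), (r * B); ring.
have [i|A [B E]] := comp_mpoly_mod (y := [tuple (e1 0 i)%:MP * u | i < 3]) f idT.
  by rewrite tnth_mktuple; exists (e0 0 i)%:MP, (e2 0 i)%:MP; rewrite {1}frame_X; ring.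
by exists A, B; rewrite -addrA -E /axis; ring.
Qed.

Lemma u_neq0 : u != 0.
Proof.
apply/eqP => u0; move/eqP: (oner_neq0 k); apply.
by rewrite -[RHS](meval0 (@fun_of_matrix _ 1 3 e1 0)) -u0 lf_eval -fr; vring.
Qed.

Lemma homog_axis n f : f \is n.+1.-homog -> exists A B (c : k), [/\
  A \is n.-homog, B \is n.-homog & f = s * A + v * B + c%:MP * u ^+ n.+1].
Proof.
elim: n f => [|n IHn] f fh; have [f0 [f1 [f2 [-> h0 h1 h2]]]] := homog_split k_char0 fr fh.
  by have [c ->] := homog0P h1; exists f0, f2, c; split=> //; ring.
have [A [B [c [Ah Bh ->]]]] := IHn _ h1.
exists (f0 + u * A), (f2 + u * B), c; split; last by rewrite [u ^+ n.+2]exprS; ring.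
  by apply: rpredD => //; exact: (dhomogM (lf_homog _) Ah).
by apply: rpredD => //; exact: (dhomogM (lf_homog _) Bh).
Qed.

Variables (l G : R) (J I : R -> Prop).
Hypotheses (lE : l = u + v) (Gh : G \is 3.-homog).

(** Modulo [s] and [l] the form [v] equals - [u], so again only a power of [u] remains. *)
Lemma homog_axis_l n f : f \is n.+1.-homog -> exists A B (c : k), [/\
  A \is n.-homog, B \is n.-homog & f = s * A + l * B + c%:MP * u ^+ n.+1].
Proof.
elim: n f => [|n IHn] f fh; have [f0 [f1 [f2 [-> h0 h1 h2]]]] := homog_split k_char0 fr fh.
  have [c E] : exists c, f1 - f2 = c%:MP by apply: homog0P; apply: rpredB.
  by exists f0, f2, c; split=> //; rewrite -E lE; ring.
have [|A [B [c [Ah Bh E]]]] := IHn (f1 - f2); first exact: rpredB.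
exists (f0 + u * A), (f2 + u * B), c; split.
- by apply: rpredD => //; exact: (dhomogM (lf_homog _) Ah).
- by apply: rpredD => //; exact: (dhomogM (lf_homog _) Bh).
transitivity (s * f0 + l * f2 + u * (f1 - f2)); first by rewrite lE; ring.
by rewrite E [u ^+ n.+2]exprS; ring.
Qed.

Definition tangent_cone : R -> Prop := ideal_gen (fun f : R =>
  [\/ exists2 b, b \is 2.-homog & f = l * b, exists2 b, b \is 1.-homog & f = G * b
    | f \is 5.-homog]).
Local Notation K := tangent_cone.

Hypotheses (idJ : is_ideal J) (idI : is_ideal I) (JI : forall f, J f -> I f)
  (KI : forall f, K f -> I f).
Hypotheses (Jls : J (l * s)) (Jluv : J (l * (u * v))).

Lemma Il b : b \is 2.-homog -> I (l * b).
Proof. by move=> bh; apply/KI/mem_ideal_gen; constructor 1; exists b. Qed.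
Lemma IG b : b \is 1.-homog -> I (G * b).
Proof. by move=> bh; apply/KI/mem_ideal_gen; constructor 2; exists b. Qed.
Lemma I5 b : b \is 5.-homog -> I b.
Proof. by move=> bh; apply/KI/mem_ideal_gen; constructor 3. Qed.

Local Notation P n := (ideal_prod J (ideal_pow I n)).

Lemma homog_lf_mul d a f : f \is d.-homog -> lf a * f \is d.+1.-homog.
Proof. by move=> fh; rewrite -[d.+1]add1n; apply: dhomogM => //; apply: lf_homog. Qed.

Lemma mem_ls f : I f -> P 1 (l * s * f).
Proof. by move=> If; apply: mem_ideal_prod => //; apply/ideal_pow1. Qed.
Lemma mem_luv f : I f -> P 1 (l * (u * v) * f).
Proof. by move=> If; apply: mem_ideal_prod => //; apply/ideal_pow1. Qed.

(* Modulo J I every multiple of l u^2 by an element of K is a multiple of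
   l^2 u^4, the factor being determined on the axis s = v = 0. *)
Lemma residual_step f : K f -> exists p, P 1 (l * u ^+ 2 * f - p * (l * u ^+ 2) ^+ 2)
  /\ axis f = axis (p * u ^+ 3).
Proof.
have idP := ideal_prod_ideal J (ideal_pow I 1).
have vE : v = l - u by rewrite lE; ring.
have uu : u * u \is 2.-homog by apply: homog_lf_mul; apply: lf_homog.
have Iluu x : I (l * u ^+ 2 * x) by apply: (idlMr idI); apply: Il; rewrite expr2.
move: f; apply: ideal_gen_sub => [|f].
  split=> [|x z [p [Px Ex]] [p' [Px' Ex']]|r x [p [Px Ex]]].
  - exists 0; split; last by rewrite mul0r.
    by rewrite mulr0 mul0r subr0; apply: (idl0 idP).
  - exists (p + p'); split; last by rewrite mulrDl !axisD Ex Ex'.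
    by have := idlD idP Px Px'; congr (P 1); ring.
  exists (r * p); split; last by rewrite (axisM r x) Ex -(axisM r) mulrA.
  by have := idlMl idP r Px; congr (P 1); ring.
case=> [[b bh ->]|[b bh ->]|fh].
- have [A [B [c [Ah Bh ->]]]] := homog_axis bh; exists c%:MP; split; last first.
    by rewrite lE !(axisM, axisD, axisX, axisC) axis_s axis_v axis_u; ring.
  have -> : l * u ^+ 2 * (l * (s * A + v * B + c%:MP * u ^+ 2)) - c%:MP * (l * u ^+ 2) ^+ 2
     = l * s * (l * u ^+ 2 * A) + l * (u * v) * (l * (u * B)) by ring.
  apply: (idlD idP); [apply: mem_ls | apply: mem_luv] => //.
  by apply: Il; apply: homog_lf_mul.
- have [y0 [y1 [y2 [-> _ /homog0P[x ->] _]]]] := homog_split k_char0 fr bh.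
  have [A2 [B2 [c [Ah Bh EG]]]] := homog_axis_l Gh.
  have [A3 [B3 [c' [A3h B3h EB]]]] := homog_axis Bh.
  have IGu : I (G * u) by apply: IG; apply: lf_homog.
  (* On the axis [l] restricts to [u], so the pure powers of [u] in G and in its cofactor [B2] of
     [l] add up to c + c'. *)
  exists (x%:MP * (c + c')%:MP * u); split; last first.
    rewrite EG EB lE !(axisM, axisD, axisX, axisC) axis_s axis_v axis_u; ring.
  have -> : l * u ^+ 2 * (G * (s * y0 + u * x%:MP + v * y2))
      - x%:MP * (c + c')%:MP * u * (l * u ^+ 2) ^+ 2
    = l * s * (G * u * (u * y0)) + l * (u * v) * (G * u * y2)
      + x%:MP * (l * u ^+ 3 * G - (c + c')%:MP * u * (l * u ^+ 2) ^+ 2) by ring.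
  apply: (idlD idP).
    by apply: (idlD idP); [apply: mem_ls | apply: mem_luv]; apply: (idlMr idI).
  apply: (idlMl idP).
  (* The form c u^4 is not known to be in I, but G u is, and their difference is in (s, l). *)
  have Ecu : c%:MP * u ^+ 4 = G * u - s * (u * A2) - l * (u * B2) by rewrite EG; ring.
  have -> : l * u ^+ 3 * G - (c + c')%:MP * u * (l * u ^+ 2) ^+ 2 =
     l * s * (u ^+ 3 * A2) + l * u ^+ 3 * (l * B2) + (l * u ^+ 2 * (c%:MP * u ^+ 4))
      - (c + c')%:MP * u * (l * u ^+ 2) ^+ 2 by rewrite [in LHS]EG; ring.
  have -> : l * s * (u ^+ 3 * A2) + l * u ^+ 3 * (l * B2) + (l * u ^+ 2 * (c%:MP * u ^+ 4))
      - (c + c')%:MP * u * (l * u ^+ 2) ^+ 2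
    = l * s * (u ^+ 3 * A2) + l * s * (l * u ^+ 2 * (u * A3)) + l * (u * v) * (l * (u * u * B3))
      - l * (u * v) * (c%:MP * u ^+ 4).
    by rewrite EB mpolyCD vE; ring.
  apply: (idlB idP); first apply: (idlD idP); first apply: (idlD idP).
  - apply: mem_ls; apply: I5; rewrite !exprS expr0 mulr1 -!mulrA.
    by do 3?apply: homog_lf_mul.
  - by apply: mem_ls; apply: Iluu.
  - apply: mem_luv; have -> : l * (u * u * B3) = l * (u * u) * B3 by ring.
    by apply: (idlMr idI); apply: Il.
  have -> : l * (u * v) * (c%:MP * u ^+ 4) = l * (u * v) * (G * u)
      - l * s * (u * (v * (u * A2))) - l * (u * v) * (l * (u * B2)) by rewrite Ecu; ring.
  apply: (idlB idP); first apply: (idlB idP).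
  - exact: mem_luv.
  - by apply: mem_ls; apply: I5; do 3?apply: homog_lf_mul.
  apply: mem_luv; have -> : l * (u * B2) = u * (l * B2) by ring.
  by apply: (idlMl idI); apply: Il.
have [A [B [c [Ah Bh ->]]]] := homog_axis fh; exists (c%:MP * u ^+ 2); split; last first.
  by rewrite !(axisM, axisD, axisX, axisC) axis_s axis_v axis_u; ring.
have -> : l * u ^+ 2 * (s * A + v * B + c%:MP * u ^+ 5) - c%:MP * u ^+ 2 * (l * u ^+ 2) ^+ 2
  = l * s * (u * (u * A)) + l * (u * v) * (u * B) - l * (u * v) * (c%:MP * u ^+ 5).
  by rewrite vE; ring.
apply: (idlB idP); first apply: (idlD idP).
- by apply: mem_ls; apply: (idlMl idI); apply: I5; apply: homog_lf_mul.
- by apply: mem_luv; apply: I5; apply: homog_lf_mul.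
apply: mem_luv; apply: (idlMl idI); apply: I5.
by rewrite -[5%N]mul1n; apply: dhomogMn; apply: lf_homog.
Qed.

(** Iterates [residual_step]: each factor from K is traded for a factor [l * u ^+ 2], which is in I
    and restricts to u^3 on the axis. *)
Lemma residual_pow n f : ideal_pow K n f -> exists p,
  P n (l * u ^+ 2 * f - p * (l * u ^+ 2) ^+ n.+1) /\ axis f = axis (p * u ^+ (3 * n)).
Proof.
have Iluu : I (l * u ^+ 2).
  by apply: Il; rewrite expr2; apply: homog_lf_mul; apply: lf_homog.
elim: n f => [|n IHn] f.
  move=> _; exists f; rewrite muln0 expr0 mulr1; split=> //.
  by rewrite mulrC subrr; apply: (idl0 (ideal_prod_ideal _ _)).
have idP := ideal_prod_ideal J (ideal_pow I n.+1).
apply: (ideal_prod_sub (T := fun f => exists p, P n.+1 (l * u ^+ 2 * f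
    - p * (l * u ^+ 2) ^+ n.+2) /\ axis f = axis (p * u ^+ (3 * n.+1)))) => [|x y Kx Ky].
  split=> [|x z [p [Px Ex]] [p' [Px' Ex']]|r x [p [Px Ex]]].
  - exists 0; split; last by rewrite !mul0r.
    by rewrite mulr0 mul0r subr0; apply: (idl0 idP).
  - exists (p + p'); split; last by rewrite mulrDl !axisD Ex Ex'.
    by have := idlD idP Px Px'; congr (P n.+1); ring.
  exists (r * p); split; last by rewrite (axisM r x) Ex -(axisM r) mulrA.
  by have := idlMl idP r Px; congr (P n.+1); ring.
have [p [Px Ex]] := residual_step Kx; have [p' [Py Ey]] := IHn y Ky.
exists (p * p'); split; last first.
  have -> : p * p' * u ^+ (3 * n.+1) = p * u ^+ 3 * (p' * u ^+ (3 * n)) by rewrite mulnS exprD; ring.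
  by rewrite (axisM x y) Ex Ey -axisM.
have -> : l * u ^+ 2 * (x * y) - p * p' * (l * u ^+ 2) ^+ n.+2
  = (l * u ^+ 2 * x - p * (l * u ^+ 2) ^+ 2) * y
  + p * ((l * u ^+ 2 * y - p' * (l * u ^+ 2) ^+ n.+1) * (l * u ^+ 2)).
  by rewrite [(l * u ^+ 2) ^+ n.+2]exprS [(l * u ^+ 2) ^+ 2]expr2; ring.
apply: (idlD idP).
  by have := ideal_prod_mul Px (ideal_powS KI Ky); rewrite add1n.
apply: (idlMl idP); have I1 := (ideal_pow1 (l * u ^+ 2) idI).2 Iluu.
by have := ideal_prod_mul Py I1; rewrite addn1.
Qed.

(** The coefficient p then vanishes on the axis, so it is in (s, v); the remaining powers of
    [l * u ^+ 2] provide the factors that complete [s] and [v] to the elements l s and l u v of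
    J. *)
Lemma residual_vanish n f : ideal_pow K n f -> axis f = 0 -> P n (l * u ^+ 2 * f).
Proof.
move=> Kf f0; have [p [Pf Ef]] := residual_pow Kf.
have idP := ideal_prod_ideal J (ideal_pow I n).
have Iluu : I (l * u ^+ 2).
  by apply: Il; rewrite expr2; apply: homog_lf_mul; apply: lf_homog.
have p0 : axis p = 0.
  move/eqP: Ef; rewrite f0 axisM axisX axis_u eq_sym mulf_eq0 expf_eq0 (negPf u_neq0) andbF orbF.
  by move/eqP.
have [A [B E]] := axis_mod p; rewrite p0 add0r in E.
rewrite -[_ * f](subrK (p * (l * u ^+ 2) ^+ n.+1)); apply: (idlD idP) => //.
have -> : p * (l * u ^+ 2) ^+ n.+1 = l * s * (u ^+ 2 * A * (l * u ^+ 2) ^+ n)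
    + l * (u * v) * (u * B * (l * u ^+ 2) ^+ n) by rewrite E exprS; ring.
have In := ideal_pow_ideal I n.
by apply: (idlD idP); apply: mem_ideal_prod => //; apply: (idlMl In); apply: ideal_pow_exp.
Qed.

End ResidualPoint.

(** * Powers of the ideal K *)

Section ConePowers.
Variables (k : fieldType) (k_char0 : [pchar k]%R =i pred0).
Local Notation R := {mpoly k[3]}.
Variables l G : R.
Hypotheses (lh : l \is 1.-homog) (Gh : G \is 3.-homog).
Local Notation K := (tangent_cone l G).
Implicit Types (f Q : R) (n m e t d : nat).

Lemma KG b : b \is 1.-homog -> K (G * b).
Proof. by move=> bh; apply: mem_ideal_gen; constructor 2; exists b. Qed.

Lemma cone_hom : hom_ideal K.
Proof.
apply: ideal_gen_hom => f [[b bh ->]|[b bh ->]|fh].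
- by exists (1 + 2)%N; apply: dhomogM.
- by exists (3 + 1)%N; apply: dhomogM.
by exists 5%N.
Qed.

(** Each factor G takes one linear form, and the m other factors of K are taken from m^5. *)
Lemma cone_pow_G e m Q : mm (e + 5 * m) Q -> ideal_pow K (e + m) (G ^+ e * Q).
Proof.
elim: e Q => [|e IHe] Q mQ.
  rewrite mul1r; have := mm_pow k_char0 mQ; apply: ideal_powS => f.
  by apply: ideal_gen_sub => [|{}f fh]; [exact: ideal_gen_ideal | apply: mem_ideal_gen; constructor 3].
have idP := ideal_pow_ideal K (e.+1 + m).
move: Q mQ; apply: (ideal_gen_sub (T := fun Q => ideal_pow K (e.+1 + m) (G ^+ e.+1 * Q))) => [|Q Qh].
  split=> [|x y|r x]; first by rewrite mulr0; apply: (idl0 idP).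
    by rewrite mulrDr; apply: (idlD idP).
  by rewrite mulrCA; apply: (idlMl idP).
move: Qh; rewrite -[(e.+1 + 5 * m)%N]/(1 + (e + 5 * m))%N.
apply: (homog_mul_ind (T := fun Q => ideal_pow K (e.+1 + m) (G ^+ e.+1 * Q)) k_char0) => [x y|x y xh yh].
  by rewrite mulrDr; apply: (idlD idP).
have -> : G ^+ e.+1 * (x * y) = G * x * (G ^+ e * y) by rewrite exprS; ring.
by apply: mem_ideal_prod; [apply: KG | apply: IHe; apply: mem_ideal_gen].
Qed.

(** What remains of a power of K when [l] is removed from one generator: its quadratic cofactor
    times K^n. *)
Definition cone_pow2 n : R -> Prop := ideal_prod (@mm k 2) (ideal_pow K n).

Lemma cone_pow2_G e m Q : mm (2 + (e + 5 * m)) Q -> cone_pow2 (e + m) (G ^+ e * Q).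
Proof.
have idP := ideal_prod_ideal (@mm k 2) (ideal_pow K (e + m)).
apply: (ideal_gen_sub (T := fun Q => cone_pow2 (e + m) (G ^+ e * Q))) => [|{}Q].
  split=> [|x y|r x]; first by rewrite mulr0; apply: (idl0 idP).
    by rewrite mulrDr; apply: (idlD idP).
  by rewrite mulrCA; apply: (idlMl idP).
apply: (homog_mul_ind (T := fun Q => cone_pow2 (e + m) (G ^+ e * Q)) k_char0) => [x y|x y xh yh].
  by rewrite mulrDr; apply: (idlD idP).
rewrite mulrCA; apply: mem_ideal_prod; first exact: mem_ideal_gen.
by apply: cone_pow_G; apply: mem_ideal_gen.
Qed.

(** The power (G m + m^5)^t, that is, the part of K^t made without the generators in l m^2. *)
Definition cone_top t : R -> Prop := ideal_gen (fun f : R => exists e Q,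
  [/\ (e <= t)%N, Q \is (e + 5 * (t - e)).-homog & f = G ^+ e * Q]).

Lemma cone_top_sub t f : cone_top t f -> ideal_pow K t f.
Proof.
apply: ideal_gen_sub => [|{}f [e [Q [et Qh ->]]]]; first exact: ideal_pow_ideal.
by have := @cone_pow_G e (t - e) Q (mem_mm k_char0 (leqnn _) Qh); rewrite subnKC.
Qed.

(** When the power is expanded, a term with a generator from l m^2 is [l] times an element of m^2
    K^t, and all other terms form [cone_top]. *)
Lemma cone_pow_decomp t f : ideal_pow K t.+1 f ->
  exists x r, [/\ cone_pow2 t x, cone_top t.+1 r & f = l * x + r].
Proof.
clear lh; have idT n m : is_ideal (fun f => exists x r, [/\ cone_pow2 n x, cone_top m r & f = l * x + r]).
  have id1 := ideal_prod_ideal (@mm k 2) (ideal_pow K n).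
  have id2 : is_ideal (cone_top m) by exact: ideal_gen_ideal.
  split=> [|y z [x [r [Px Tr ->]]] [x' [r' [Px' Tr' ->]]]|c y [x [r [Px Tr ->]]]].
  - by exists 0, 0; rewrite mulr0 addr0; split=> //; [apply: (idl0 id1) | apply: (idl0 id2)].
  - by exists (x + x'), (r + r'); split; [apply: (idlD id1)|apply: (idlD id2)|ring].
  by exists (c * x), (c * r); split; [apply: (idlMl id1)|apply: (idlMl id2)|ring].
have z1 n : cone_pow2 n 0 by apply: (idl0 (ideal_prod_ideal _ _)).
have z2 n : cone_top n 0 by apply: (idl0 (ideal_gen_ideal _)).
elim: t f => [|t IHt] f.
  have idK : is_ideal K by exact: ideal_gen_ideal.
  move=> /(ideal_pow1 _ idK).
  apply: (ideal_gen_sub (T := fun f => exists x r, [/\ cone_pow2 0 x, cone_top 1 r & f = l * x + r]))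
    => [|{}f]; first exact: idT.
  case=> [[b bh ->]|[b bh ->]|fh].
  - exists b, 0; rewrite addr0; split=> //.
    by rewrite -[b]mulr1; apply: mem_ideal_prod => //; apply: mem_ideal_gen.
  - exists 0, (G * b); rewrite mulr0 add0r; split=> //; apply: mem_ideal_gen.
    by exists 1%N, b; rewrite expr1.
  exists 0, f; rewrite mulr0 add0r; split=> //; apply: mem_ideal_gen.
  by exists 0%N, f; rewrite expr0 mul1r.
apply: (ideal_prod_sub (T := fun f => exists x r, [/\ cone_pow2 t.+1 x, cone_top t.+2 r & f = l * x + r]))
  => [|y z Ky /IHt[x [r [Px Tr ->]]]]; first exact: idT.
rewrite mulrDr; apply: (idlD (idT _ _)).
  exists (y * x), 0; rewrite addr0 mulrCA; split=> //; move: Px; rewrite mulrC.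
  have id1 := ideal_prod_ideal (@mm k 2) (ideal_pow K t.+1).
  apply: (ideal_prod_sub (T := fun x => cone_pow2 t.+1 (x * y))) => [|c d mc Kd].
    exact: (idl_colon id1).
  by rewrite -mulrA; apply: mem_ideal_prod => //; rewrite mulrC; apply: mem_ideal_prod.
move: y Ky; apply: (ideal_gen_sub (T := fun y => exists x0 r0,
    [/\ cone_pow2 t.+1 x0, cone_top t.+2 r0 & y * r = l * x0 + r0])) => [|y].
  exact: (idl_colon (idT _ _)).
have id2 : is_ideal (cone_top t.+2) by exact: ideal_gen_ideal.
case=> [[b bh ->]|[b bh ->]|yh].
- exists (b * r), 0; rewrite addr0 mulrA; split=> //; apply: mem_ideal_prod; first exact: mem_ideal_gen.
  exact: cone_top_sub.
- exists 0, (G * b * r); rewrite mulr0 add0r; split=> //; rewrite mulrC.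
  move: r Tr; apply: (ideal_gen_sub (T := fun r => cone_top t.+2 (r * (G * b)))) => [|r].
    exact: (idl_colon id2).
  move=> [e [Q [et Qh ->]]]; apply: mem_ideal_gen; exists e.+1, (b * Q); split=> //.
    exact: (dhomogM bh Qh).
  by rewrite exprS; ring.
exists 0, (y * r); rewrite mulr0 add0r; split=> //; rewrite mulrC.
move: r Tr; apply: (ideal_gen_sub (T := fun r => cone_top t.+2 (r * y))) => [|r].
  exact: (idl_colon id2).
move=> [e [Q [et Qh ->]]]; apply: mem_ideal_gen; exists e, (Q * y); split.
- exact: leqW.
- have -> : (e + 5 * (t.+2 - e) = e + 5 * (t.+1 - e) + 5)%N by lia.
  exact: dhomogM.
by rewrite mulrA.
Qed.

(** A generator G^e Q has degree 5 t - e, so in degree d only e >= 5 t - d occurs and this power of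
    G splits off. The subtraction is truncated: from d = 5 t on no power of G is forced. *)
Lemma cone_top_homog t d r : cone_top t r -> exists Q, [/\
  pihomog mdeg d r = G ^+ (5 * t - d) * Q, Q \is (d - 3 * (5 * t - d)).-homog
  & (t < 5 * t - d)%N -> Q = 0].
Proof.
clear lh; case=> cs csT ->; rewrite raddf_sum /= big_seq; set e0 := (5 * t - d)%N.
pose T (f : R) := exists Q, [/\ f = G ^+ e0 * Q, Q \is (d - 3 * e0).-homog & (t < e0)%N -> Q = 0].
have T0 : T 0 by exists 0; rewrite mulr0 rpred0.
apply: (big_ind T) => [|x y [Q [-> Qh Q0]] [Q' [-> Qh' Q0']]|cg csg] //.
  exists (Q + Q'); split; [by rewrite mulrDr | exact: rpredD |].
  by move=> te; rewrite Q0 // Q0' // addr0.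
have [e [Q [et Qh E]]] := csT _ csg.
have gh : cg.2 \is (e * 3 + (e + 5 * (t - e))).-homog.
  by rewrite E; apply: dhomogM => //; rewrite mulnC; apply: dhomogMn.
have Ed : (e * 3 + (e + 5 * (t - e)) = 5 * t - e)%N by lia.
rewrite Ed in gh; rewrite (pihomogM _ _ gh); case: leqP => [ted|_]; last by rewrite mul0r.
have e0e : (e0 <= e)%N by rewrite /e0; lia.
set c := pihomog _ _ _; exists (G ^+ (e - e0) * (c * Q)); split.
- by rewrite E -{1}(subnKC e0e) exprD; ring.
- have h1 : G ^+ (e - e0) * (c * Q) \is (3 * (e - e0) + ((d - (5 * t - e)) + (e + 5 * (t - e)))).-homog.
    by apply: dhomogM; [apply: dhomogMn | apply: dhomogM => //; apply: pihomogP].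
  have <- : (3 * (e - e0) + ((d - (5 * t - e)) + (e + 5 * (t - e))) = d - 3 * e0)%N.
    by rewrite /e0 in e0e *; lia.
  exact: h1.
by move=> te; move: (leq_trans te (leq_trans e0e et)); rewrite ltnn.
Qed.

End ConePowers.

Section LinesThroughPoints.
Variables (k : fieldType) (k_char0 : [pchar k]%R =i pred0).
Local Notation R := {mpoly k[3]}.

Lemma join_off (a p p' q : 'rV[k]_3) : dot a p = 0 -> dot a p' = 0 -> cross p p' != 0 ->
  dot a q != 0 -> dot (cross p q) p' != 0.
Proof.
move=> ap ap' pp' aq; have [||x Ex] := orth2P (p := a) pp'; [by rewrite dotC|by rewrite dotC|].
apply: contraNneq aq => E; have -> : dot a q = - (x * dot (cross p q) p') by rewrite Ex; vring.
by rewrite E mulr0 oppr0.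
Qed.

(** Unlike in [collinear_ideal], each point has its own outside point, so that the product of the
    lines can be made to pass through several of them. *)
Lemma line_ideal (a : 'rV[k]_3) (Y : seq ('rV[k]_3 * 'rV[k]_3)) d (f : R) :
  uniq (unzip1 Y) -> {in unzip1 Y &, forall p p', p != p' -> cross p p' != 0} ->
  (forall p, p \in unzip1 Y -> p != 0 /\ dot a p = 0) ->
  (forall q, q \in unzip2 Y -> dot a q != 0) ->
  f \is d.-homog -> (forall p, p \in unzip1 Y -> ev p f = 0) ->
  exists A B, f = lf a * A + (\prod_(pq <- Y) lf (cross pq.1 pq.2)) * B.
Proof.
move=> Yu Yind Ya Yq fd fY.
have Y1 pq : pq \in Y -> pq.1 \in unzip1 Y by move=> ?; apply: map_f.
have Y2 pq : pq \in Y -> pq.2 \in unzip2 Y by move=> ?; apply: map_f.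
have [||||A [B]] := chunk_decomp (s := [seq (cross pq.1 pq.2, [:: pq.1]) | pq <- Y])
    (lf_homog a) _ _ _ fd.
- move=> mc p /mapP[pq Ypq ->]; rewrite inE => /eqP ->; rewrite lf_eval.
  by have [] := Ya _ (Y1 _ Ypq).
- move=> mc d' f' /mapP[[p q] Ypq ->] /= f'd f'p.
  have [p0 ap] := Ya _ (Y1 _ Ypq); have aq := Yq _ (Y2 _ Ypq).
  have am : cross a (cross p q) != 0.
    have -> : cross a (cross p q) = dot a q *: p - dot a p *: q by rvring.
    by rewrite /= in ap; rewrite ap scale0r subr0 scaler_eq0 negb_or aq.
  apply: (two_forms_ideal k_char0 am ap _ p0 f'd); first by vring.
  by apply: f'p; rewrite inE.
- rewrite pairwise_map; apply: (sub_in_pairwise (P := mem Y) (r := fun x y => x.1 != y.1)).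
  + move=> pq pq' /= Ypq Ypq' pp'; rewrite andbT.
    apply: (join_off (a := a)); last exact: Yq (Y2 _ Ypq).
    * by have [] := Ya _ (Y1 _ Ypq).
    * by have [] := Ya _ (Y1 _ Ypq').
    by apply: Yind => //; apply: Y1.
  + by apply/allP.
  by have := Yu; rewrite uniq_pairwise pairwise_map.
- by move=> mc p /mapP[pq Ypq ->]; rewrite inE => /eqP ->; apply: fY; apply: Y1.
by rewrite big_map; exists A, B.
Qed.

Lemma two_points_ideal e0 e1 e2 d (f : R) : framed e0 e1 e2 -> f \is d.-homog ->
  ev e1 f = 0 -> ev e2 f = 0 -> exists A B,
  f = lf (cross e1 e2) * A + lf (cross e2 e0) * lf (cross e0 e1) * B.
Proof.
move=> fr fd f1 f2; have fr1 := frame_rot fr.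
have fr2 : framed e2 e0 e1 by exact: frame_rot.
have [A [B E]] := point_ideal k_char0 fr1 fd f1.
have := homog_quot (lf_homog (cross e1 e2)) fd (lf_homog (cross e0 e1)) E.
set A' := (X in _ * X + _); set B' := (X in _ + _ * X) => E'.
have hA' : A' \is d.-1.-homog.
  by rewrite /A'; case: (d) => [|e'] /=; rewrite ?rpred0 // subn1 pihomogP.
have bA : ev e2 A' = 0.
  move: f2; rewrite E' mevalD !mevalM !lf_eval.
  have -> : dot (cross e0 e1) e2 = 1 by exact: fr.
  have -> : dot (cross e1 e2) e2 = 0 by vring.
  by rewrite mul1r mul0r addr0.
have [P [Q EA]] := point_ideal k_char0 fr2 hA' bA.
by exists (lf (cross e0 e1) * P + B'), Q; rewrite E' EA; ring.
Qed.

End LinesThroughPoints.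

(** * Four points on a line and two outside it *)

Section FourCollinear.
Variables (k : fieldType) (k_char0 : [pchar k]%R =i pred0).
Local Notation R := {mpoly k[3]}.
Variables (e0 e1 e2 : 'rV[k]_3) (fr : framed e0 e1 e2).
Local Notation s := (lf (cross e1 e2)).
Local Notation u := (lf (cross e2 e0)).
Local Notation v := (lf (cross e0 e1)).
Local Notation al := (cross e2 e0 + cross e0 e1).
Local Notation l := (lf al).
Local Notation D0 := (dd e0).
Local Notation D1 := (dd e1).
Local Notation D2 := (dd e2).
Variables p1 p2 p3 p4 : 'rV[k]_3.
Local Notation Y := [:: p1; p2; p3; p4].
Hypotheses (Yuniq : uniq Y) (Yind : {in Y &, forall p p', p != p' -> cross p p' != 0})
  (Yl : forall p, p \in Y -> p != 0 /\ dot al p = 0).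
(** The lines alternate between [e1] and [e2], so that this quartic also passes through the two
    residual points. *)
Local Notation g := (lf (cross p1 e1) * lf (cross p2 e2) * lf (cross p3 e1) * lf (cross p4 e2)).
Local Notation G := (D1 g - D2 g).
Local Notation K := (tangent_cone l G).
Variables (J I : R -> Prop).
Hypotheses (ptsJ : ideal_of_points [:: e1, e2 & Y] J) (jacI : jacobian_of J I).

Lemma lE : l = u + v. Proof. by rewrite lfD. Qed.

Lemma al_off : dot al e1 = 1 /\ dot al e2 = 1.
Proof. by rewrite -fr; split; vring. Qed.

Lemma g_homog : g \is 4.-homog.
Proof.
exact: (dhomogM (dhomogM (dhomogM (lf_homog _) (lf_homog _)) (lf_homog _)) (lf_homog _)).
Qed.

Lemma G_homog : G \is 3.-homog.
Proof. by apply: rpredB; exact: (dd_homog _ g_homog). Qed.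

Lemma dotcc (a b : 'rV[k]_3) : dot (cross a b) a = 0 /\ dot (cross a b) b = 0.
Proof. by split; vring. Qed.

Lemma Y_ideal d f : f \is d.-homog -> (forall p, p \in Y -> ev p f = 0) ->
  exists A B, f = l * A + g * B.
Proof.
move=> fd fY; have [d1 d2] := al_off.
have [|||||A [B ->]] := line_ideal k_char0 (a := al)
   (Y := [:: (p1, e1); (p2, e2); (p3, e1); (p4, e2)]) _ _ _ _ fd _; rewrite //=.
  by move=> q; rewrite !inE => /or4P[]/eqP->; rewrite ?d1 ?d2 oner_neq0.
by exists A, B; rewrite !big_cons big_nil /=; ring.
Qed.

Ltac distinct := by apply: contraTneq Yuniq => ->; rewrite /= !inE ?eqxx ?orbT /= ?andbF.
Ltac in_Y := by rewrite !inE ?eqxx ?orbT.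

Lemma lp0 p : p \in Y -> ev p l = 0.
Proof. by move=> /Yl[_]; rewrite lf_eval. Qed.

Lemma vpE p : p \in Y -> ev p v = - ev p u.
Proof. by move=> /lp0/eqP; rewrite lE mevalD addr_eq0 => /eqP->; rewrite opprK. Qed.

Lemma join_Y p p' i : p \in Y -> p' \in Y -> p != p' -> i = e1 \/ i = e2 ->
  ev p' (lf (cross p i)) != 0.
Proof.
move=> Yp Yp' pp' iE; rewrite lf_eval; apply: (join_off (a := al)).
- by have [] := Yl Yp.
- by have [] := Yl Yp'.
- exact: Yind.
by have [d1 d2] := al_off; case: iE => ->; rewrite ?d1 ?d2 oner_neq0.
Qed.

(** Only the factor through p contributes to the derivatives. In the coordinates [s] and [u] of the
    line l = 0, where v = - u, the pair (D0 g, G) is then a nonzero multiple of (- u, s). *)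
Lemma gradient_Y p : p \in Y -> exists2 h : k, h != 0 &
  ev p (D0 g) = - (h * ev p u) /\ ev p G = h * ev p s.
Proof.
move=> Yp.
have H i C : i = e1 \/ i = e2 -> g = lf (cross p i) * C -> ev p C != 0 -> exists2 h : k, h != 0 &
  ev p (D0 g) = - (h * ev p u) /\ ev p G = h * ev p s.
  move=> iE -> Cp; exists (- ev p C); first by rewrite oppr_eq0.
  have z : ev p (lf (cross p i)) = 0 by rewrite lf_eval; case: (dotcc p i).
  rewrite !ddM !dd_lf !(mevalD, mevalN, mevalM, mevalC) z !mul0r !addr0.
  have uE : ev p u = - dot (cross e0 e1) p by apply/esym; rewrite -lf_eval vpE ?opprK.
  split; case: iE => ->.
  - have -> : dot (cross p e1) e0 = - dot (cross e0 e1) p by vring.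
    by rewrite uE; ring.
  - have -> : dot (cross p e2) e0 = ev p u by rewrite lf_eval; vring.
    by ring.
  - have -> : dot (cross p e1) e1 = 0 by vring.
    have -> : dot (cross p e1) e2 = ev p s by rewrite lf_eval; vring.
    by ring.
  have -> : dot (cross p e2) e2 = 0 by vring.
  have -> : dot (cross p e2) e1 = - ev p s by rewrite lf_eval; vring.
  by ring.
move: Yp; rewrite !inE => /or4P[]/eqP Ep; subst p.
- apply: (H e1 (lf (cross p2 e2) * lf (cross p3 e1) * lf (cross p4 e2))); [by left|ring|].
  by rewrite !mevalM !mulf_neq0 //; apply: join_Y; (in_Y || distinct || auto).
- apply: (H e2 (lf (cross p1 e1) * lf (cross p3 e1) * lf (cross p4 e2))); [by right|ring|].
  by rewrite !mevalM !mulf_neq0 //; apply: join_Y; (in_Y || distinct || auto).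
- apply: (H e1 (lf (cross p1 e1) * lf (cross p2 e2) * lf (cross p4 e2))); [by left|ring|].
  by rewrite !mevalM !mulf_neq0 //; apply: join_Y; (in_Y || distinct || auto).
apply: (H e2 (lf (cross p1 e1) * lf (cross p2 e2) * lf (cross p3 e1))); [by right|ring|].
by rewrite !mevalM !mulf_neq0 //; apply: join_Y; (in_Y || distinct || auto).
Qed.

Lemma mem_pts : [/\ e1 \in [:: e1, e2 & Y], e2 \in [:: e1, e2 & Y]
  & {subset Y <= [:: e1, e2 & Y]}].
Proof.
split; [by rewrite inE eqxx | by rewrite !inE eqxx orbT |].
by move=> p Yp; rewrite 2!in_cons; apply/or3P; constructor 3.
Qed.

Lemma ev_frame : [/\ ev e1 s = 0, ev e1 v = 0, ev e2 s = 0 & ev e2 u = 0].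
Proof. by rewrite !lf_eval; split; vring. Qed.

Lemma g_ends : ev e1 g = 0 /\ ev e2 g = 0.
Proof.
have [_ z1] := dotcc p1 e1; have [_ z2] := dotcc p2 e2.
by rewrite !mevalM !lf_eval z1 z2 !(mul0r, mulr0).
Qed.

Lemma J_gens : [/\ J (l * s), J (l * (u * v)) & J g].
Proof.
have [_ _ _ memJ] := ptsJ; have [s1 v1 s2 u2] := ev_frame; have [g1 g2] := g_ends.
have lh := lf_homog al; split.
- apply: (memJ _ _ (dhomogM lh (lf_homog _))) => p; rewrite 2!in_cons mevalM.
  by move=> /or3P[/eqP->|/eqP->|Yp]; rewrite ?s1 ?s2 ?mulr0 // lp0 // mul0r.
- apply: (memJ _ _ (dhomogM lh (dhomogM (lf_homog _) (lf_homog _)))) => p; rewrite 2!in_cons !mevalM.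
  by move=> /or3P[/eqP->|/eqP->|Yp]; rewrite ?v1 ?u2 ?mulr0 ?mul0r ?mulr0 // lp0 // mul0r.
apply: (memJ _ _ g_homog) => p; rewrite 2!in_cons => /or3P[/eqP->|/eqP->|] //.
by rewrite !mevalM !lf_eval !inE => /or4P[]/eqP->; rewrite (dotcc _ _).1 ?(mul0r, mulr0).
Qed.

(** In f = l A + g B the line takes the value 1 at the two residual points and [g] vanishes there,
    so A vanishes at both and is in (s, u v). *)
Lemma J_decomp f : J f -> exists A B C, f = l * s * A + l * (u * v) * B + g * C.
Proof.
have [idJ homJ evJ _] := ptsJ; have [m1 m2 mY] := mem_pts.
move: f; apply: (homog_ind _ homJ) => [|f d Jf fd].
  split=> [|x z [A [B [C ->]]] [A' [B' [C' ->]]]|r x [A [B [C ->]]]].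
  - by exists 0, 0, 0; rewrite !mulr0 !addr0.
  - by exists (A + A'), (B + B'), (C + C'); ring.
  by exists (r * A), (r * B), (r * C); ring.
have [A [B E]] := Y_ideal fd (fun p Yp => evJ _ _ Jf (mY _ Yp)).
have := homog_quot g_homog fd (lf_homog al) E.
set A' := (X in _ * X + _); set B' := (X in _ + _ * X) => E'.
have hA' : A' \is d.-1.-homog.
  by rewrite /A'; case: (d) => [|e'] /=; rewrite ?rpred0 // subn1 pihomogP.
have [d1 d2] := al_off; have [g1 g2] := g_ends.
have A1 : ev e1 A' = 0.
  by have := evJ _ _ Jf m1; rewrite E' mevalD [ev _ (g * _)]mevalM g1 mevalM lf_eval d1 mul0r mul1r addr0.
have A2 : ev e2 A' = 0.
  by have := evJ _ _ Jf m2; rewrite E' mevalD [ev _ (g * _)]mevalM g2 mevalM lf_eval d2 mul0r mul1r addr0.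
have [P [Q EA]] := two_points_ideal k_char0 fr hA' A1 A2.
by exists P, Q, B'; rewrite E' EA; ring.
Qed.

Lemma dd_dual : [/\ [/\ D0 s = 1, D0 u = 0 & D0 v = 0], [/\ D1 s = 0, D1 u = 1 & D1 v = 0]
  & [/\ D2 s = 0, D2 u = 0 & D2 v = 1]].
Proof. exact: frame_dd_dual. Qed.

Lemma dd_l : [/\ D0 l = 0, D1 l = 1 & D2 l = 1].
Proof.
have [[_ u0 v0] [_ u1 v1] [_ u2 v2]] := dd_dual.
by rewrite lE !ddD u0 u1 u2 v0 v1 v2 !addr0 add0r.
Qed.

Local Notation a := (l * s).
Local Notation b := (l * (u * v)).

Lemma minors_ab : [/\ dd_minor e0 e1 a b = l * (v * (l + u)),
   dd_minor e0 e2 a b = l * (u * (l + v)) & dd_minor e1 e2 a b = l * s * (u - v)].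
Proof.
have [[s0 u0 v0] [s1 u1 v1] [s2 u2 v2]] := dd_dual; have [l0 l1 l2] := dd_l.
rewrite /dd_minor !ddM s0 u0 v0 s1 u1 v1 s2 u2 v2 l0 l1 l2 lE.
by split; ring.
Qed.

Lemma minors_ag : [/\ dd_minor e0 e1 a g = l * D1 g - s * D0 g,
   dd_minor e0 e2 a g = l * D2 g - s * D0 g & dd_minor e1 e2 a g = - (s * G)].
Proof.
have [[s0 u0 v0] [s1 u1 v1] [s2 u2 v2]] := dd_dual; have [l0 l1 l2] := dd_l.
move: g => f; rewrite /dd_minor !ddM s0 s1 s2 l0 l1 l2.
by split; ring.
Qed.

Lemma minor_bg : dd_minor e0 e2 b g = - (u * (l + v) * D0 g).
Proof.
have [[s0 u0 v0] [s1 u1 v1] [s2 u2 v2]] := dd_dual; have [l0 l1 l2] := dd_l.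
move: g => f; rewrite /dd_minor !ddM u0 v0 u2 v2 l0 l2; ring.
Qed.

Lemma euler_g : 4%:R * g = s * D0 g + u * G + l * D2 g.
Proof. by rewrite -(frame_euler fr g_homog) lE; ring. Qed.

(** The minors of l s and l u v give l u^2 and l v^2 modulo J, and [u] and [v] squared span the
    conics modulo (s, u v). *)
Lemma I_l2 f : f \is 2.-homog -> I (l * f).
Proof.
move=> fh; have [idI JI minI _] := jacI; have [Ja Jb Jg] := J_gens.
have [E01 E02 _] := minors_ab; have Ia := JI _ Ja; have Ib := JI _ Jb.
have Iuu : I (l * (u * u)).
  have := idlB idI (minI _ _ e0 e2 Ja Jb) (idlMl idI 2%:R Ib).
  by rewrite E02 lE; congr I; ring.
have Ivv : I (l * (v * v)).
  have := idlB idI (minI _ _ e0 e1 Ja Jb) (idlMl idI 2%:R Ib).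
  by rewrite E01 lE; congr I; ring.
have [y0 [y1 [y2 [-> _ h1 h2]]]] := homog_split k_char0 fr fh.
have [z0 [z1 [z2 [-> _ _ _]]]] := homog_split k_char0 fr h1.
have [w0 [w1 [w2 [-> _ _ _]]]] := homog_split k_char0 fr h2.
have -> : l * (s * y0 + u * (s * z0 + u * z1 + v * z2) + v * (s * w0 + u * w1 + v * w2))
  = a * (y0 + u * z0 + v * w0) + b * (z2 + w1) + l * (u * u) * z1 + l * (v * v) * w2 by ring.
by do 3?[apply: (idlD idI)]; apply: (idlMr idI).
Qed.

Lemma I_ln n f : f \is n.+2.-homog -> I (l * f).
Proof.
have [idI _ _ _] := jacI; rewrite -[n.+2]addn2 addnC.
apply: (homog_mul_ind (T := fun f => I (l * f)) k_char0) => [x y|x y xh yh].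
  by rewrite mulrDr; apply: (idlD idI).
by rewrite mulrA; apply: (idlMr idI); apply: I_l2.
Qed.

Lemma dd_g_homog w : dd w g \is 3.-homog.
Proof. exact: (dd_homog w g_homog). Qed.

Lemma I_sD0 : I (s * D0 g).
Proof.
have [idI _ minI _] := jacI; have [Ja _ Jg] := J_gens.
have [E01 _ _] := minors_ag; have := minI _ _ e0 e1 Ja Jg; rewrite E01 => H.
by have := idlB idI (I_ln (dd_g_homog e1)) H; congr I; ring.
Qed.

(** A minor gives s G, Euler's identity for [g] gives u G, and v G = l G - u G. *)
Lemma I_G f : f \is 1.-homog -> I (G * f).
Proof.
have [idI JI minI _] := jacI; have [Ja _ Jg] := J_gens.
have [_ _ E12] := minors_ag.
have IsG : I (s * G).
  by have := idlN idI (minI _ _ e1 e2 Ja Jg); rewrite E12 opprK.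
have IuG : I (u * G).
  have := idlB idI (idlB idI (idlMl idI 4%:R (JI _ Jg)) I_sD0) (I_ln (dd_g_homog e2)).
  by rewrite euler_g; congr I; ring.
have IvG : I (v * G).
  by have := idlB idI (I_ln G_homog) IuG; rewrite {1}lE; congr I; ring.
move=> fh; have [y0 [y1 [y2 [-> _ _ _]]]] := homog_split k_char0 fr fh.
have -> : G * (s * y0 + u * y1 + v * y2) = s * G * y0 + u * G * y1 + v * G * y2 by ring.
by do 2?[apply: (idlD idI)]; apply: (idlMr idI).
Qed.

Lemma I_uuD0 : I (u * u * D0 g).
Proof.
have [idI JI minI _] := jacI; have [_ Jb Jg] := J_gens.
have := minI _ _ e0 e2 Jb Jg; rewrite minor_bg => H.
have h : u * D0 g \is 4.-homog by apply: homog_lf_mul; apply: dd_g_homog.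
have := idlD idI H (idlMl idI 2%:R (I_ln h)).
by congr I; rewrite lE; ring.
Qed.

(** On the four points, up to the factor h of [gradient_Y], the forms in m^2 G and u^2 [D0 g] take
    the values of all binary cubics in [s] and [u]; [w] and [c] hold the coefficients of the product
    of three factors that vanish at r1, r2 and r3. *)
Lemma I_quintic_separator p r1 r2 r3 : Y =i [:: p; r1; r2; r3] -> uniq [:: p; r1; r2; r3] ->
  exists2 E, I E & separator Y p 5 E.
Proof.
move=> EY; rewrite /= !inE !negb_or => /and4P[/and3P[pr1 pr2 pr3] _ _ _].
have [idI _ _ _] := jacI.
have [Yp Yr1 Yr2 Yr3] : [/\ p \in Y, r1 \in Y, r2 \in Y & r3 \in Y].
  by rewrite !EY !inE !eqxx !orbT.
pose w := (ev r1 u * ev r2 s * ev r3 s + ev r1 s * ev r2 u * ev r3 s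
    + ev r1 s * ev r2 s * ev r3 u)%:MP * (u * u)
  - (ev r1 u * ev r2 u * ev r3 s + ev r1 u * ev r2 s * ev r3 u
    + ev r1 s * ev r2 u * ev r3 u)%:MP * (u * s)
  + (ev r1 u * ev r2 u * ev r3 u)%:MP * (s * s).
pose c := (- (ev r1 s * ev r2 s * ev r3 s))%:MP : R.
have wh : w \is 2.-homog.
  by do 3?[apply: rpredD || apply: rpredB || rewrite rpredN]; rewrite mul_mpolyC rpredZ //; apply: homog_lf_mul; apply: lf_homog.
exists (w * G - c * (u * u * D0 g)).
  apply: (idlB idI); last by apply: (idlMl idI); apply: I_uuD0.
  have [y0 [y1 [y2 [-> _ _ _]]]] := homog_split k_char0 fr wh.
  have -> : (s * y0 + u * y1 + v * y2) * G = G * s * y0 + G * u * y1 + G * v * y2 by ring.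
  by do 2?[apply: (idlD idI)]; apply: (idlMr idI); apply: I_G; apply: lf_homog.
have val q : q \in Y -> exists2 h : k, h != 0 & ev q (w * G - c * (u * u * D0 g))
   = h * ((ev r1 u * ev q s - ev r1 s * ev q u) * (ev r2 u * ev q s - ev r2 s * ev q u)
        * (ev r3 u * ev q s - ev r3 s * ev q u)).
  move=> Yq; have [h h0 [E0 E1]] := gradient_Y Yq; exists h => //.
  rewrite mevalB mevalM E1 [ev q (c * _)]mevalM [ev q (u * u * _)]mevalM E0.
  by rewrite /w /c !(mevalD, mevalN, mevalM, mevalC); ring.
have nz r : r \in Y -> p != r -> ev r u * ev p s - ev r s * ev p u != 0.
  move=> Yr pr; have [p0 _] := Yl Yp; apply: contraNneq (Yind Yp Yr pr) => E.
  have [f0 f1 f2] := frame_cross fr p r.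
  rewrite (vpE Yp) (vpE Yr) in f0 f1.
  have e0z : dot (cross p r) e0 = 0 by rewrite f0; ring.
  have e1z : dot (cross p r) e1 = 0.
    by rewrite f1; transitivity (ev r u * ev p s - ev r s * ev p u); [ring|].
  have e2z : dot (cross p r) e2 = 0.
    by rewrite f2; transitivity (ev r u * ev p s - ev r s * ev p u); [ring|].
  have := frame_lf fr (cross p r); rewrite e0z e1z e2z !mpolyC0 !mul0r !addr0 => lz.
  apply/eqP; have [//|n0] := eqVneq (cross p r) 0; have [x xn] := dot_surj n0.
  by move/eqP: (oner_neq0 k); case; rewrite -xn -lf_eval lz meval0.
split.
- have ch : c * (u * u * D0 g) \is 5.-homog.
    rewrite mul_mpolyC rpredZ // -mulrA; apply: homog_lf_mul; apply: homog_lf_mul.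
    exact: dd_g_homog.
  by apply: rpredB => //; exact: (dhomogM wh G_homog).
- by have [h h0 ->] := val _ Yp; rewrite !mulf_neq0 // nz.
move=> q Yq; move: (Yq); rewrite EY !inE => /or4P[]/eqP-> qp; [by rewrite eqxx in qp| | |];
  by [have [h _ ->] := val _ Yr1; ring | have [h _ ->] := val _ Yr2; ring | have [h _ ->] := val _ Yr3; ring].
Qed.

(** Only values on the four points matter, since l m^4 and [g] are in I. *)
Lemma I_5 f : f \is 5.-homog -> I f.
Proof.
have [idI JI _ _] := jacI; have [_ _ Jg] := J_gens.
apply: (separator_ideal idI) => [h hh h0|p].
  have [A [B E]] := Y_ideal hh h0.
  rewrite (homog_quot g_homog hh (lf_homog al) E) /=; apply: (idlD idI).
    by apply: (@I_ln 2); apply: pihomogP.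
  by apply: (idlMr idI); apply: JI.
have U := Yuniq; have perm q1 q2 q3 q4 : perm_eq Y [:: q1; q2; q3; q4] ->
    exists2 E, I E & separator Y q1 5 E.
  move=> EY; apply: (@I_quintic_separator q1 q2 q3 q4); first exact: perm_mem.
  by rewrite -(perm_uniq EY).
rewrite !inE => /or4P[]/eqP->.
- exact: (perm p1 p2 p3 p4).
- by apply: (perm p2 p1 p3 p4); rewrite (perm_catCA [:: p1] [:: p2]).
- by apply: (perm p3 p1 p2 p4); rewrite (perm_catCA [:: p1; p2] [:: p3]).
by apply: (perm p4 p1 p2 p3); rewrite (perm_catC [:: p1; p2; p3] [:: p4]).
Qed.

Lemma KI f : K f -> I f.
Proof.
have [idI _ _ _] := jacI; apply: ideal_gen_sub => // {}f.
by case=> [[x xh ->]|[x xh ->]|fh]; [apply: I_l2 | apply: I_G | apply: I_5].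
Qed.

Lemma I_decomp f : I f -> exists x y, [/\ J x, K y & f = x + y].
Proof.
have [idI JI minI genI] := jacI; have [idJ _ _ _] := ptsJ.
have [Ja Jb Jg] := J_gens.
have idK : is_ideal K by exact: ideal_gen_ideal.
pose T f := exists x y, [/\ J x, K y & f = x + y].
have idT : is_ideal T.
  split=> [|x z [x' [y [Jx Ky ->]]] [z' [y' [Jz Ky' ->]]]|r x [x' [y [Jx Ky ->]]]].
  - by exists 0, 0; rewrite addr0; split=> //; [apply: (idl0 idJ) | apply: (idl0 idK)].
  - by exists (x' + z'), (y + y'); split; [apply: (idlD idJ)|apply: (idlD idK)|ring].
  by exists (r * x'), (r * y); split; [apply: (idlMl idJ)|apply: (idlMl idK)|ring].
have JT x : J x -> T x by move=> Jx; exists x, 0; rewrite addr0; split=> //; apply: (idl0 idK).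
have KT y : K y -> T y by move=> Ky; exists 0, y; rewrite add0r; split=> //; apply: (idl0 idJ).
have Kl2 y : y \is 2.-homog -> K (l * y).
  by move=> yh; apply: mem_ideal_gen; constructor 1; exists y.
have Kl3 y : y \is 3.-homog -> K (l * y).
  rewrite -[3%N]/(2 + 1)%N; apply: (homog_mul_ind (T := fun f => K (l * f)) k_char0) => [x z|x z xh zh].
    by rewrite mulrDr; apply: (idlD idK).
  by rewrite mulrA; apply: (idlMr idK); apply: Kl2.
have KG y : y \is 1.-homog -> K (G * y).
  by move=> yh; apply: mem_ideal_gen; constructor 2; exists y.
have K5 y : y \is 5.-homog -> K y by move=> yh; apply: mem_ideal_gen; constructor 3.
have TsD0 : T (s * D0 g).
  have -> : s * D0 g = 4%:R * g - G * u - l * D2 g by rewrite euler_g; ring.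
  apply: (idlB idT); first apply: (idlB idT).
  - by apply: (idlMl idT); apply: JT.
  - by apply: KT; apply: KG; apply: lf_homog.
  by apply: KT; apply: Kl3; apply: dd_g_homog.
have alt w w' h : T (dd_minor w w' h h).
  by rewrite /dd_minor mulrC subrr; apply: (idl0 idT).
have swp w w' (h h' : R) : dd_minor w w' h h' = - dd_minor w w' h' h by rewrite /dd_minor; ring.
have [ab1 ab2 ab3] := minors_ab; have [ag1 ag2 ag3] := minors_ag.
have luh w w' : lf w * (l + lf w') \is 2.-homog.
  by apply: homog_lf_mul; apply: rpredD; apply: lf_homog.
have Tab : [/\ T (dd_minor e0 e1 a b), T (dd_minor e0 e2 a b) & T (dd_minor e1 e2 a b)].
  rewrite ab1 ab2 ab3; split; [by apply: KT; apply: Kl2 | by apply: KT; apply: Kl2 |].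
  by apply: JT; apply: (idlMr idJ).
have Tag : [/\ T (dd_minor e0 e1 a g), T (dd_minor e0 e2 a g) & T (dd_minor e1 e2 a g)].
  rewrite ag1 ag2 ag3; split.
  - by apply: (idlB idT) => //; apply: KT; apply: Kl3; apply: dd_g_homog.
  - by apply: (idlB idT) => //; apply: KT; apply: Kl3; apply: dd_g_homog.
  by apply: (idlN idT); rewrite mulrC; apply: KT; apply: KG; apply: lf_homog.
(* These minors have degree 2 + 3 = 5 and fall into m^5. *)
have Tbg w w' : T (dd_minor w w' b g).
  have bh : b \is 3.-homog by do 2?apply: homog_lf_mul; apply: lf_homog.
  apply: KT; apply: K5; apply: rpredB.
    exact: (dhomogM (dd_homog w bh) (dd_g_homog w')).
  exact: (dhomogM (dd_homog w' bh) (dd_g_homog w)).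
apply: (genI (fun x => [\/ x = a, x = b | x = g]) T e0 e1 e2 fr idT) => // [x||].
- by case=> ->.
- move=> x /J_decomp[A [B [C ->]]]; have idS := ideal_gen_ideal (fun x => [\/ x = a, x = b | x = g]).
  by do 2?[apply: (idlD idS)]; apply: (idlMr idS); apply: mem_ideal_gen;
    [constructor 1 | constructor 2 | constructor 3].
pose S (x y : R) := [/\ T (dd_minor e0 e1 x y), T (dd_minor e0 e2 x y) & T (dd_minor e1 e2 x y)].
have Salt (x : R) : S x x by split; apply: alt.
have Sswp (x y : R) : S x y -> S y x.
  by case=> T1 T2 T3; split; rewrite (swp _ _ y x); apply: (idlN idT).
have Sab : S a b := Tab.
have Sag : S a g := Tag.
have Sbg : S b g by split; apply: Tbg.
move: Sab Sag Sbg; rewrite -/(S _ _); move: (a) (b) (g) => a' b' g' Sab Sag Sbg x y.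
case=> [->|->|->] [->|->|->]; [exact: (Salt a') | exact: Sab | exact: Sag
  | exact: (Sswp _ _ Sab) | exact: (Salt b') | exact: Sbg
  | exact: (Sswp _ _ Sag) | exact: (Sswp _ _ Sbg) | exact: (Salt g')].
Qed.

Local Notation P n := (ideal_prod J (ideal_pow I n)).

(** Exchanges the two residual points, so that results about one of them apply to the other; the
    sign of [e0] keeps the determinant equal to 1. *)
Lemma frame_swap : framed (- e0) e2 e1.
Proof. by rewrite /framed -fr; vring. Qed.

Lemma swap_forms : [/\ lf (cross e2 e1) = - s, lf (cross e1 (- e0)) = v & lf (cross (- e0) e2) = u].
Proof.
split; last 2 first; [by congr lf; rvring | by congr lf; rvring |].
by rewrite -mulN1r -mpolyC1 -mpolyCN -lfZ; congr lf; rvring.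
Qed.

Lemma axis_J f : J f -> axis e0 e1 e2 f = 0 /\ axis (- e0) e2 e1 f = 0.
Proof.
have mp0 : (0 : k)%:MP_[3] = 0 by exact: mpolyC0.
have [_ d1] := dotcc p1 e1; have [_ d2] := dotcc p2 e2.
have s1 : dot (cross e1 e2) e1 = 0 by vring.
have s2 : dot (cross e1 e2) e2 = 0 by vring.
have v1 : dot (cross e0 e1) e1 = 0 by vring.
have u2 : dot (cross e2 e0) e2 = 0 by vring.
move=> /J_decomp[A [B [C ->]]]; rewrite !(axisD, axisM, axis_lf) s1 s2 v1 u2 d1 d2 !mp0.
by rewrite !(mul0r, mulr0) !addr0.
Qed.

(** Modulo terms with a factor s or u v, x is u^2 x1 + v^2 x2 with x1 and x2 in K^t. Since l x
    vanishes at the residual points, x1 and x2 vanish on the respective axes and [residual_vanish]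
    applies to each. *)
Lemma residual_total t x : cone_pow2 l G t x -> J (l * x) -> P t (l * x).
Proof.
move=> Px Jlx; have [idI JI _ _] := jacI; have [idJ _ _ _] := ptsJ.
have [Ja Jb _] := J_gens; have [sE vE uE] := swap_forms.
have idP := ideal_prod_ideal J (ideal_pow I t); have idK := ideal_pow_ideal K t.
have [A [B [x1 [x2 [KA KB K1 K2 Ex]]]]] : exists A B x1 x2, [/\ ideal_pow K t A,
    ideal_pow K t B, ideal_pow K t x1, ideal_pow K t x2 &
    x = s * A + u * v * B + u ^+ 2 * x1 + v ^+ 2 * x2].
  pose T x := exists A B x1 x2, [/\ ideal_pow K t A, ideal_pow K t B, ideal_pow K t x1,
    ideal_pow K t x2 & x = s * A + u * v * B + u ^+ 2 * x1 + v ^+ 2 * x2].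
  have idT : is_ideal T.
    split=> [|y z [A [B [x1 [x2 [KA KB K1 K2 ->]]]]] [A' [B' [x1' [x2' [KA' KB' K1' K2' ->]]]]]
        |c y [A [B [x1 [x2 [KA KB K1 K2 ->]]]]]].
    - by exists 0, 0, 0, 0; split; try exact: (idl0 idK); ring.
    - by exists (A + A'), (B + B'), (x1 + x1'), (x2 + x2'); split; try exact: (idlD idK); ring.
    by exists (c * A), (c * B), (c * x1), (c * x2); split; try exact: (idlMl idK); ring.
  move: x Px {Jlx}; apply: (ideal_prod_sub (T := T)) => // m y + Ky.
  apply: (ideal_gen_sub (T := fun m => T (m * y))) => [|{}m mh]; first exact: idl_colon.
  have [y0 [y1 [y2 [-> _ h1 h2]]]] := homog_split k_char0 fr mh.
  have [z0 [z1 [z2 [-> _ _ _]]]] := homog_split k_char0 fr h1.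
  have [w0 [w1 [w2 [-> _ _ _]]]] := homog_split k_char0 fr h2.
  exists ((y0 + u * z0 + v * w0) * y), ((z2 + w1) * y), (z1 * y), (w2 * y).
  by split; try exact: (idlMl idK); ring.
have [a1 a2] := axis_J Jlx; have sw := frame_swap.
have un0 := u_neq0 fr; have vn0 := u_neq0 sw; rewrite vE in vn0.
have [d1 d2] := al_off.
have ax1 : axis e0 e1 e2 x1 = 0.
  move/eqP: a1; rewrite axisM axis_lf d1 mpolyC1 mul1r mulf_eq0 (negPf un0) /= Ex.
  rewrite !(axisD, axisM, axisX) axis_s axis_v (axis_u fr) !(mul0r, mulr0, expr0n) /=.
  by rewrite ?mul0r ?addr0 ?add0r mulf_eq0 expf_eq0 (negPf un0) => /eqP.
have ax2 : axis (- e0) e2 e1 x2 = 0.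
  have As : axis (- e0) e2 e1 s = 0.
    by rewrite axis_lf [dot _ _](_ : _ = 0) ?mpolyC0 ?mul0r //; vring.
  have Au : axis (- e0) e2 e1 u = 0.
    by rewrite axis_lf [dot _ _](_ : _ = 0) ?mpolyC0 ?mul0r //; vring.
  have Av : axis (- e0) e2 e1 v = v.
    by rewrite axis_lf -[dot _ _]/(det3 e0 e1 e2) fr mpolyC1 mul1r vE.
  move/eqP: a2; rewrite axisM axis_lf d2 mpolyC1 mul1r mulf_eq0 vE (negPf vn0) /= Ex.
  rewrite !(axisD, axisM, axisX) As Au Av !(mul0r, mulr0, expr0n) /=.
  by rewrite ?mul0r ?addr0 ?add0r mulf_eq0 expf_eq0 (negPf vn0) => /eqP.
have KIt f : ideal_pow K t f -> ideal_pow I t f := ideal_powS KI (f := f).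
have -> : l * x = l * s * A + l * (u * v) * B + l * u ^+ 2 * x1 + l * v ^+ 2 * x2.
  by rewrite Ex; ring.
apply: (idlD idP); first apply: (idlD idP); first apply: (idlD idP).
- by apply: mem_ideal_prod => //; apply: KIt.
- by apply: mem_ideal_prod => //; apply: KIt.
- exact: (residual_vanish k_char0 fr lE G_homog idI KI Ja Jb K1 ax1).
have Ja' : J (l * lf (cross e2 e1)) by rewrite sE mulrN; apply: (idlN idJ).
have Jb' : J (l * (lf (cross e1 (- e0)) * lf (cross (- e0) e2))).
  by rewrite vE uE [v * u]mulrC.
have lE' : l = lf (cross e1 (- e0)) + lf (cross (- e0) e2) by rewrite vE uE [v + u]addrC lE.
have := residual_vanish k_char0 sw lE' G_homog idI KI Ja' Jb' K2 ax2.
by rewrite vE.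
Qed.

(** The part of f without factor [l] vanishes on the four points, because f and [l] do. Rewriting it
    in (l, g) gives f = l y + g w with w in K^t; then g w is in J I^t, and l y is left to
    [residual_total]. *)
Lemma four_collinear_homog t d f : f \is d.-homog -> J f -> ideal_pow K t.+1 f -> P t f.
Proof.
move=> fd Jf Kf; have [idI JI _ _] := jacI; have [idJ _ evJ _] := ptsJ.
have [_ _ mY] := mem_pts; have [_ _ Jg] := J_gens.
have idP := ideal_prod_ideal J (ideal_pow I t).
have id2 := ideal_prod_ideal (@mm k 2) (ideal_pow K t).
suff [y [w [Py Kw Ef]]] : exists y w, [/\ cone_pow2 l G t y, ideal_pow K t w & f = l * y + g * w].
  have Pgw : P t (g * w) by apply: mem_ideal_prod => //; move: Kw; apply: ideal_powS; apply: KI.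
  rewrite Ef; apply: (idlD idP) => //; apply: residual_total => //.
  have -> : l * y = f - g * w by rewrite Ef addrK.
  by apply: (idlB idJ) => //; apply: (idlMr idJ).
have [x [r [Px Tr E]]] := cone_pow_decomp k_char0 G_homog Kf.
have [Q [ErQ Qh Q0]] := cone_top_homog G_homog d Tr.
have [x' Px' Ef] : exists2 x', cone_pow2 l G t x' & f = l * x' + G ^+ (5 * t.+1 - d) * Q.
  exists (if (1 <= d)%N then pihomog mdeg (d - 1) x else 0).
    case: ifP => _; last exact: (idl0 id2).
    apply: ideal_prod_hom Px; first by apply: ideal_gen_hom => ? ?; exists 2.
    by apply: ideal_pow_hom; apply: cone_hom (lf_homog _) G_homog.
  by rewrite -ErQ -{1}(pihomog_dE fd) E raddfD /= mulrC (pihomogM _ _ (lf_homog _)) [l * _]mulrC.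
have fY p : p \in Y -> ev p (G ^+ (5 * t.+1 - d) * Q) = 0.
  by move=> Yp; have := evJ _ _ Jf (mY _ Yp); rewrite Ef mevalD mevalM lp0 // mul0r add0r.
have Qdecomp n h : h \is n.-homog -> (forall p, p \in Y -> ev p h = 0) ->
    exists A B, [/\ A \is (n - 1).-homog, B \is (n - 4).-homog & h = l * A + g * B].
  move=> hh h0; have [A [B EAB]] := Y_ideal hh h0.
  have := homog_quot g_homog hh (lf_homog al) EAB.
  set A' := (X in _ * X + _); set B' := (X in _ + _ * X) => E'.
  exists A', B'; split=> //; rewrite /A' /B'; case: ifP => _; rewrite ?rpred0 //; exact: pihomogP.
have [te|et] := ltnP t.+1 (5 * t.+1 - d).
  by exists x', 0; split=> //; [exact: (idl0 (ideal_pow_ideal _ _)) | rewrite Ef Q0 // !mulr0].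
case Ee : (5 * t.+1 - d)%N et Qh fY Ef => [|e] et Qh fY Ef.
  have [|A [B [Ah Bh EQ]]] := Qdecomp _ Q Qh; first by move=> p /fY; rewrite expr0 mul1r.
  exists (x' + A), B; split; last by rewrite Ef expr0 mul1r EQ; ring.
    apply: (idlD id2) => //; have := @cone_pow2_G _ k_char0 l G 0 t A; rewrite add0n expr0 mul1r.
    by apply; apply: (mem_mm k_char0 _ Ah); lia.
  have := @cone_pow_G _ k_char0 l G 0 t B; rewrite add0n expr0 mul1r.
  by apply; apply: (mem_mm k_char0 _ Bh); lia.
(* Where G vanishes, Q need not, so one factor G is kept. With d = 5 (t + 1) - (e + 1) the cofactor
   B of [g] has exactly the degree e + 5 (t - e) needed for G^e B in K^t. *)
have GQh : G * Q \is (3 + (d - 3 * e.+1)).-homog by apply: dhomogM => //; apply: G_homog.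
have [|A [B [Ah Bh EQ]]] := Qdecomp _ _ GQh.
  move=> p /fY/eqP; rewrite !mevalM rmorphXn /= mulf_eq0 expf_eq0 /= -mulf_eq0 => /eqP.
  by [].
have et' : (e + (t - e) = t)%N by rewrite subnKC.
exists (x' + G ^+ e * A), (G ^+ e * B); split.
- apply: (idlD id2) => //; have := @cone_pow2_G _ k_char0 l G e (t - e) A; rewrite et'; apply.
  by apply: (mem_mm k_char0 _ Ah); lia.
- have := @cone_pow_G _ k_char0 l G e (t - e) B; rewrite et'; apply.
  by apply: (mem_mm k_char0 _ Bh); lia.
have -> : l * (x' + G ^+ e * A) + g * (G ^+ e * B) = l * x' + G ^+ e * (l * A + g * B) by ring.
by rewrite -EQ Ef exprS; ring.
Qed.

Theorem four_collinear_VV : VV_torsion_free J I.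
Proof.
have [idI JI _ _] := jacI; have [idJ homJ _ _] := ptsJ.
apply: (VV_torsion_freeI idJ idI JI KI I_decomp) => t f _ Jf Kf.
rewrite (pihomog_partitionE (leqnn (mmeasure mdeg f))).
apply: (idl_sum (ideal_prod_ideal _ _)) => i _.
apply: (four_collinear_homog (pihomogP _ i f)); first exact: homJ.
by apply: ideal_pow_hom => //; apply: cone_hom (lf_homog _) G_homog.
Qed.

End FourCollinear.

(** * Configurations of six points *)

Lemma uniq_pairs6 (T : eqType) (x1 x2 x3 x4 x5 x6 : T) :
  uniq [:: x1; x2; x3; x4; x5; x6] -> [/\ x1 != x2, x3 != x4 & x5 != x6].
Proof.
by move=> U; split; apply: contraTneq U => ->; rewrite /= !inE ?eqxx ?orbT /= ?andbF.
Qed.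

(** * Points, lines and Jacobian ideals in terms of vectors *)

Section PointsAndLines.
Variables (k : fieldType) (k_char0 : [pchar k]%R =i pred0).
Local Notation R := {mpoly k[3]}.
Implicit Types (P Q : point k) (L M : line k) (v w : 'rV[k]_3).

Lemma point_line P v : v \in subsp_val P -> v != 0 -> subsp_val P = <[v]>%VS.
Proof.
case: P => U /= /eqP dU vU v0; apply/esym/eqP; rewrite eqEdim -memvE vU dim_vline v0 dU.
by [].
Qed.

Definition rep P : 'rV[k]_3 := vpick (subsp_val P).

Lemma rep_neq0 P : rep P != 0.
Proof.
rewrite /rep vpick0; case: P => U /= /eqP dU; apply/eqP => U0.
by move: dU; rewrite U0 dimv0.
Qed.

Lemma rep_in P : rep P \in subsp_val P. Proof. exact: memv_pick. Qed.

Lemma subsp_val_inj d : injective (@subsp_val k d).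
Proof. exact: val_inj. Qed.

Definition represents (s : seq 'rV[k]_3) (X : {fset point k}) : Prop :=
  (forall v, v \in s -> v != 0 /\ exists2 P, P \in X & v \in subsp_val P) /\
  (forall P, P \in X -> exists2 v, v \in s & v \in subsp_val P).

Lemma points_ideal_of s X : represents s X -> ideal_of_points s (points_ideal X).
Proof.
move=> [sX Xs]; split.
- exact: ideal_gen_ideal.
- by move=> f d; apply: ideal_gen_hom => g [].
- move=> f v + /sX[v0 [P XP Pv]].
  apply: (ideal_gen_sub (T := fun f => ev v f = 0)) => [|g [_ g0]]; last exact: (g0 P).
  split=> [|x y|r x]; first by rewrite meval0.
    by rewrite mevalD => -> ->; rewrite addr0.
  by rewrite mevalM => ->; rewrite mulr0.
move=> f d fh f0; apply: mem_ideal_gen; split; first by exists d.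
move=> P XP w Pw w0; have [v sv Pv] := Xs P XP; have [v0 _] := sX v sv.
move: Pw; rewrite (point_line Pv v0) => /vlineP[x ->].
by rewrite (homog_eval _ _ fh) f0 // mulr0.
Qed.

Lemma det_mx22 (A : comNzRingType) (M : 'M[A]_2) :
  \det M = M 0 0 * M 1 1 - M 0 1 * M 1 0.
Proof.
rewrite (expand_det_row _ 0) !big_ord_recl big_ord0 addr0 /cofactor !det_mx11 !mxE /=.
rewrite expr0 mul1r expr1 mulN1r mulrN.
by congr (_ * M _ _ - M _ _ * M _ _); apply: val_inj.
Qed.

Lemma dd_minorE v w (f g : R) : dd_minor v w f g =
  (cross v w 0 i2)%:MP * (f^`M(i0) * g^`M(i1) - f^`M(i1) * g^`M(i0))
  - (cross v w 0 i1)%:MP * (f^`M(i0) * g^`M(i2) - f^`M(i2) * g^`M(i0))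
  + (cross v w 0 i0)%:MP * (f^`M(i1) * g^`M(i2) - f^`M(i2) * g^`M(i1)).
Proof. by rewrite /dd_minor !ddE !crossE; ring. Qed.

Lemma mderiv_minorE e0 e1 e2 i j (f g : R) : framed e0 e1 e2 ->
  exists c01 c02 c12 : k, f^`M(i) * g^`M(j) - f^`M(j) * g^`M(i) = c01%:MP * dd_minor e0 e1 f g
    + c02%:MP * dd_minor e0 e2 f g + c12%:MP * dd_minor e1 e2 f g.
Proof.
move=> fr; set a := cross e1 e2; set b := cross e2 e0; set c := cross e0 e1.
exists (a 0 i * b 0 j - a 0 j * b 0 i), (a 0 i * c 0 j - a 0 j * c 0 i),
  (b 0 i * c 0 j - b 0 j * c 0 i).
rewrite !(frame_mderiv fr i) !(frame_mderiv fr j) -/a -/b -/c /dd_minor; ring.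
Qed.

(** By the product rule the minor of r f is r times that of f plus a multiple of f, which is in J
    and hence in T. *)
Lemma minor_ideal (J T : R -> Prop) v w g : is_ideal T -> is_ideal J -> (forall f, J f -> T f) ->
  is_ideal (fun f => J f /\ T (dd_minor v w f g)).
Proof.
move=> idT idJ JT; split=> [|x y [Jx Tx] [Jy Ty]|r x [Jx Tx]].
- by split; [exact: idl0 | rewrite /dd_minor !dd0 !mul0r subrr; apply: idl0].
- split; first exact: idlD.
  rewrite /dd_minor in Tx Ty *; rewrite !ddD; have := idlD idT Tx Ty; congr T; ring.
split; first exact: idlMl.
rewrite /dd_minor in Tx *; rewrite !ddM; have := idlD idT (idlMl idT r Tx) (idlMr idT (dd v r * dd w g - dd w r * dd v g) (JT _ Jx)).
by congr T; ring.
Qed.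

Lemma dd_minor_swap v w (f g : R) : dd_minor v w f g = - dd_minor v w g f.
Proof. by rewrite /dd_minor; ring. Qed.

Lemma minor_gen (J S T : R -> Prop) v w : is_ideal T -> is_ideal J -> (forall f, J f -> T f) ->
  (forall f, S f -> J f) -> (forall f g, S f -> S g -> T (dd_minor v w f g)) ->
  forall f g, ideal_gen S f -> ideal_gen S g -> T (dd_minor v w f g).
Proof.
move=> idT idJ JT SJ ST f g Sf.
have half h : S h -> T (dd_minor v w f h).
  move=> Sh; have [] : J f /\ T (dd_minor v w f h); last by [].
  move: f Sf; apply: ideal_gen_sub => [|f Sf]; first exact: minor_ideal.
  by split; [apply: SJ | apply: ST].
move=> Sg; have [_] : J g /\ T (dd_minor v w g f).
  move: g Sg; apply: ideal_gen_sub => [|g Sg]; first exact: minor_ideal.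
  by split; [apply: SJ | rewrite dd_minor_swap; apply: idlN => //; apply: half].
by rewrite (dd_minor_swap v w f g); apply: idlN.
Qed.

(** Modulo J the minors are bilinear, so generators suffice; and partial derivatives and derivatives
    along a frame are combinations of each other with constant coefficients. *)
Lemma jacobian_ideal_of (J : R -> Prop) m (F : m.-tuple R) : is_ideal J ->
  homog_generators J F -> jacobian_of J (jacobian_ideal J F).
Proof.
move=> idJ [_ genF]; set I := jacobian_ideal J F.
have idI : is_ideal I by exact: ideal_gen_ideal.
have JI f : J f -> I f by move=> Jf; apply: mem_ideal_gen; left.
have FJ f : f \in F -> J f by move=> Ff; apply/genF/mem_ideal_gen.
have minF (i j : 'I_3) : (i < j)%N -> forall a b : 'I_m,
    I ((tnth F a)^`M(i) * (tnth F b)^`M(j) - (tnth F a)^`M(j) * (tnth F b)^`M(i)).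
  move=> ij; have lt (a b : 'I_m) : (a < b)%N ->
    I ((tnth F a)^`M(i) * (tnth F b)^`M(j) - (tnth F a)^`M(j) * (tnth F b)^`M(i)).
    move=> ab; apply: mem_ideal_gen; right.
    exists (fun x => if x == 0 then a else b), (fun x => if x == 0 then i else j); split.
    - by move=> [[|[|//]] ?] [[|[|//]] ?].
    - by move=> [[|[|//]] ?] [[|[|//]] ?].
    by rewrite det_mx22 !mxE.
  move=> a b; case: (ltngtP a b) => [/lt //|/lt H|/val_inj ->]; last first.
    by rewrite mulrC subrr; apply: (idl0 idI).
  by have := idlN idI H; congr I; ring.
have l01 : (i0 < i1)%N by []. have l02 : (i0 < i2)%N by []. have l12 : (i1 < i2)%N by [].
have FF f g v w : f \in F -> g \in F -> I (dd_minor v w f g).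
  move=> /tnthP[a ->] /tnthP[b ->]; rewrite dd_minorE.
  by apply: (idlD idI); first apply: (idlB idI); apply: (idlMl idI); apply: minF.
split=> // [f g v w /genF Jf /genF Jg|G T e0 e1 e2 fr idT GJ JG JT GT].
  by apply: (minor_gen idI idJ JI FJ) => // *; apply: FF.
apply: ideal_gen_sub => // f [/JT //|[r [c [_ _ ->]]]].
rewrite det_mx22 !mxE.
set f0 := tnth F (r 0); set f1 := tnth F (r 1).
have [J0 J1] : J f0 /\ J f1 by split; apply: FJ; apply: mem_tnth.
have [c01 [c02 [c12 ->]]] := mderiv_minorE (c 0) (c 1) f0 f1 fr.
apply: (idlD idT); first apply: (idlD idT); apply: (idlMl idT);
  by apply: (minor_gen idT idJ JT GJ) => [f' g' Gf Gg||]; [have [] := GT f' g' Gf Gg | apply: JG | apply: JG].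
Qed.

Lemma lineP L : exists b0 b1, [/\ cross b0 b1 != 0, b0 \in subsp_val L, b1 \in subsp_val L
  & forall v, (v \in subsp_val L) = (dot (cross b0 b1) v == 0)].
Proof.
case: L => U /= /eqP dU.
have U0 : vpick U != 0 by rewrite vpick0; apply/eqP => U0; move: dU; rewrite U0 dimv0.
have [b1 Ub1 b1n] : exists2 b1, b1 \in U & b1 \notin <[vpick U]>%VS.
  by apply/subvPn/negP => /dimvS; rewrite dU dim_vline U0.
have Ub0 := memv_pick U; set b0 := vpick U in U0 Ub0 b1n *.
have c0 : cross b0 b1 != 0.
  by apply: contraNneq b1n => /(crossP U0)[x ->]; apply: memvZ; apply: memv_line.
exists b0, b1; split=> // v; apply/idP/eqP => [Uv|/(det3_span c0)[x [y ->]]]; last first.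
  by apply: memvD; apply: memvZ.
have : U == (<[b0]> + <[b1]>)%VS.
  rewrite eq_sym eqEdim subv_add -!memvE Ub0 Ub1 dU /=.
  rewrite dimv_disjoint_sum ?dim_vline ?U0; last first.
    apply/eqP; rewrite -subv0; apply/subvP => w; rewrite memv_cap => /andP[/vlineP[x ->] /vlineP[y E]].
    rewrite memv0; case: (eqVneq y 0) => [y0|y0]; first by rewrite E y0 scale0r.
    case/negP: b1n; have -> : b1 = y^-1 *: (x *: b0) by rewrite E scalerA mulVf // scale1r.
    by rewrite scalerA memvZ // memv_line.
  have -> : b1 != 0 by apply: contraNneq b1n => ->; apply: mem0v.
  by [].
move/eqP=> EU; move: Uv; rewrite EU => /memv_addP[w /vlineP[x ->] [w' /vlineP[y ->] ->]].
vring.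
Qed.

Lemma line_of a : a != 0 -> exists L, forall v, (v \in subsp_val L) = (dot a v == 0).
Proof.
move=> /frame_with[b [c fr]].
have E : cross (cross c a) (cross a b) = a.
  by rewrite -[RHS]scale1r -[X in X *: _]fr; rvring.
set b0 := cross c a in E; set b1 := cross a b in E; pose U := (<[b0]> + <[b1]>)%VS.
have a0 : a != 0.
  by apply/eqP => a0; move/eqP: (oner_neq0 k); apply; rewrite -fr a0; vring.
have b00 : b0 != 0 by apply: contraNneq a0 => z; rewrite -E z; apply/eqP; rvring.
have b10 : b1 != 0 by apply: contraNneq a0 => z; rewrite -E z; apply/eqP; rvring.
have dU : \dim U == 2.
  rewrite dimv_disjoint_sum ?dim_vline ?b00 ?b10 //.
  apply/eqP; rewrite -subv0; apply/subvP => w.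
  rewrite memv_cap memv0 => /andP[/vlineP[x ->] /vlineP[y E']].
  have x0 : x *: a = 0.
    transitivity (cross (x *: b0) b1); first by rewrite -E; rvring.
    by rewrite E'; rvring.
  by move/eqP: x0; rewrite scaler_eq0 (negPf a0) orbF => /eqP->; rewrite scale0r.
exists (Subsp dU) => v; apply/idP/eqP => [/memv_addP[w /vlineP[x ->] [w' /vlineP[y ->] ->]]|av].
  by rewrite -E; vring.
rewrite -E in av; have [|x [y ->]] := det3_span _ av; first by rewrite E.
by apply: memv_add; apply: memvZ; apply: memv_line.
Qed.

Lemma on_lineE L a P : (forall v, (v \in subsp_val L) = (dot a v == 0)) ->
  on_line P L = (dot a (rep P) == 0).
Proof. by move=> La; rewrite /on_line (point_line (rep_in P) (rep_neq0 P)) -memvE La. Qed.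

Lemma size_points_on (X : {fset point k}) L :
  size (points_on X L) = count (fun P => on_line P L) X.
Proof.
rewrite -size_filter; apply/perm_size/uniq_perm; [exact: fset_uniq | exact/filter_uniq/fset_uniq |].
by move=> P; rewrite mem_filter !inE /= andbC.
Qed.

(** Scaled so that [a] takes the value 1 at points off its line, as the frames require; a = 0 gives
    the plain representative. *)
Definition nrep a P : 'rV[k]_3 :=
  if dot a (rep P) == 0 then rep P else (dot a (rep P))^-1 *: rep P.

Lemma nrep_in a P : nrep a P \in subsp_val P.
Proof. by rewrite /nrep; case: ifP => _; [|apply: memvZ]; apply: rep_in. Qed.

Lemma nrep_neq0 a P : nrep a P != 0.
Proof.
rewrite /nrep; case: ifPn => [_|n]; first exact: rep_neq0.
by rewrite scaler_eq0 invr_eq0 negb_or n rep_neq0.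
Qed.

Lemma nrep_dot a b P : (dot b (nrep a P) == 0) = (dot b (rep P) == 0).
Proof.
rewrite /nrep; case: ifPn => // aP; rewrite dotZr mulf_eq0 invr_eq0 (negPf aP).
by [].
Qed.

Lemma nrep_off a P : dot a (rep P) != 0 -> dot a (nrep a P) = 1.
Proof. by move=> aP; rewrite /nrep (negPf aP) dotZr mulVf. Qed.

Lemma nrep_ind a P Q : P != Q -> cross (nrep a P) (nrep a Q) != 0.
Proof.
apply: contraNneq => /(crossP (nrep_neq0 a P))[x Ex]; apply/eqP/subsp_val_inj.
have QP : nrep a Q \in subsp_val P by rewrite Ex memvZ // nrep_in.
by rewrite (point_line QP (nrep_neq0 a Q)) (point_line (nrep_in a Q) (nrep_neq0 a Q)).
Qed.

Lemma nrep_inj a : injective (nrep a).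
Proof.
move=> P Q E; apply/eqP; apply: contraT => /(nrep_ind a); rewrite E.
have -> : cross (nrep a Q) (nrep a Q) = 0 by rvring.
by rewrite eqxx.
Qed.

Lemma map_nrep_uniq a s : uniq s -> uniq (map (nrep a) s).
Proof. by rewrite map_inj_uniq //; apply: nrep_inj. Qed.

Lemma map_nrep_ind a s : {in map (nrep a) s &, forall p p', p != p' -> cross p p' != 0}.
Proof.
by move=> _ _ /mapP[P _ ->] /mapP[Q _ ->]; rewrite (inj_eq (@nrep_inj a)); apply: nrep_ind.
Qed.

Lemma map_nrep_pts a s (X : {fset point k}) : s =i X ->
  ideal_of_points (map (nrep a) s) (points_ideal X).
Proof.
move=> sX; apply: points_ideal_of; split=> [_ /mapP[P sP ->]|P XP].
  by split; [exact: nrep_neq0 | exists P; [rewrite -sX | exact: nrep_in]].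
by exists (nrep a P); [apply: map_f; rewrite sX | exact: nrep_in].
Qed.

(** Conics form a space of dimension six, so at most five linear conditions leave a nonzero one. *)
Lemma conic_through (s : seq 'rV[k]_3) : (size s <= 5)%N ->
  exists q : R, [/\ q != 0, q \is 2.-homog & forall v, v \in s -> ev v q = 0].
Proof.
move=> s5; pose f (q : dhomog 3 k 2) : 'rV[k]_(size s) := \row_j ev (nth 0 s j) (q : R).
have f_lin : linear f.
  by move=> c x y; apply/rowP => j; rewrite !mxE /= mevalD mevalZ.
pose fL : {linear dhomog 3 k 2 -> 'rV[k]_(size s)} :=
  HB.pack f (GRing.isLinear.Build _ _ _ _ f f_lin).
have ker0 : lker (linfun fL) != 0%VS.
  apply/eqP => k0; have := limg_ker_dim (linfun fL) fullv.
  rewrite k0 capv0 dimv0 add0n dimvf => E.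
  have : (\dim (linfun fL @: fullv) <= size s)%N.
    by apply: leq_trans (dimvS (subvf _)) _; rewrite dimvf /dim /= mul1n.
  by rewrite E => /leq_trans/(_ s5).
have := vpick0 (lker (linfun fL)); rewrite (negPf ker0) => /negbT q0.
have := memv_pick (lker (linfun fL)); set q := vpick _ in q0 *.
rewrite memv_ker lfunE /= => /eqP/rowP fq; exists (q : R); split.
- by apply: contraNneq q0 => E; apply/eqP/val_inj.
- exact: dhomog_is_dhomog.
move=> v sv; have js : (index v s < size s)%N by rewrite index_mem.
by have := fq (Ordinal js); rewrite !mxE /= nth_index.
Qed.

Lemma lf_neq0 (a : 'rV[k]_3) : a != 0 -> lf a != 0.
Proof.
move=> /dot_surj[v av]; apply/eqP => l0; move/eqP: (oner_neq0 k); apply.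
by rewrite -av -lf_eval l0 meval0.
Qed.

Lemma unit_ev0 (f : R) : f \is a GRing.unit -> ev (0 : 'rV[k]_3) f != 0.
Proof.
move=> /mulrV E; apply/eqP => f0; move/eqP: (oner_neq0 k); apply.
have : ev 0 (f / f) = 1 by rewrite E meval1.
by rewrite mevalM f0 mul0r => <-.
Qed.

Lemma homog_ev0 d (f : R) : f \is d.+1.-homog -> ev (0 : 'rV[k]_3) f = 0.
Proof. by move=> fh; rewrite -(scale0r (0 : 'rV[k]_3)) (homog_eval _ _ fh) expr0n mul0r. Qed.

(** Otherwise q would vanish at a + b as well, hence on the whole line through a and b, whose linear
    form would split off. *)
Lemma irreducible_conic_polar (q : R) (a b : 'rV[k]_3) : q \is 2.-homog -> irreducible_elt q ->
  ev a q = 0 -> ev b q = 0 -> cross a b != 0 -> ev a (dd b q) != 0.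
Proof.
move=> qh [_ irr] qa qb ab; apply/eqP => qab.
have [c abc] := frame_complete ab; have fr : framed c a b by rewrite /framed det3_rot.
have [A [B E]] := two_points_ideal k_char0 fr qh qa qb.
have := homog_quot (dhomogM (lf_homog (cross b c)) (lf_homog (cross c a))) qh (lf_homog (cross a b)) E.
rewrite /= subnn; have [y ->] := homog0P (pihomogP mdeg 0 B).
set A' := pihomog _ _ _ => E'.
have y0 : y = 0.
  have : ev (1 *: a + 1 *: b) q = 0 by rewrite quad_polar // qa qb qab !mulr0 !addr0.
  rewrite E' mevalD !mevalM mevalC !lf_eval.
  have -> : dot (cross a b) (1 *: a + 1 *: b) = 0 by vring.
  have -> : dot (cross b c) (1 *: a + 1 *: b) = 1 by rewrite -[RHS]abc; vring.
  have -> : dot (cross c a) (1 *: a + 1 *: b) = 1 by rewrite -[RHS]abc; vring.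
  by rewrite mul0r add0r !mul1r.
rewrite y0 mpolyC0 mulr0 addr0 in E'.
by case: (irr _ _ E') => /unit_ev0; rewrite (homog_ev0 (d := 0)) ?eqxx ?lf_homog ?pihomogP.
Qed.

Lemma nonunit_msize (f : R) : f != 0 -> f \isn't a GRing.unit -> (1 < msize f)%N.
Proof.
move=> f0; apply: contraR; rewrite -leqNgt => /msize1_polyC E.
have c0 : f@_0 != 0 by apply: contraNneq f0 => z; rewrite E z mpolyC0.
by rewrite E; apply/unitrPr; exists (f@_0)^-1%:MP; rewrite -mpolyCM mulfV // mpolyC1.
Qed.

(** Two nonunit factors of a conic have degree one but need not be given as homogeneous; in degree
    two their product is that of their linear parts. *)
Lemma reducible_conic (q : R) : q != 0 -> q \is 2.-homog -> ~ irreducible_elt q ->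
  exists a b : 'rV[k]_3, [/\ a != 0, b != 0 & q = lf a * lf b].
Proof.
move=> q0 qh irr.
have [f [g [E fu gu]]] : exists f g : R, [/\ q = f * g, f \isn't a GRing.unit & g \isn't a GRing.unit].
  apply: NNPP => H; apply: irr; split.
    by apply/negP => /unit_ev0; rewrite (homog_ev0 qh) eqxx.
  move=> f g E; case fu: (f \is a GRing.unit); first by left.
  case gu: (g \is a GRing.unit); first by right.
  by case: H; exists f, g; rewrite fu gu.
have f0 : f != 0 by apply: contraNneq q0 => z; rewrite E z mul0r.
have g0 : g != 0 by apply: contraNneq q0 => z; rewrite E z mulr0.
have sq : (msize q).-1 = 2 by have /(dhomog_uniq q0 qh) := dhomog_msize qh.
have := msizeM f0 g0; rewrite -E => sfg.
have [sf sg] : (msize f <= 2)%N /\ (msize g <= 2)%N.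
  have := nonunit_msize f0 fu; have := nonunit_msize g0 gu; move: sfg sq.
  move: (msize q) (msize f) (msize g) => nq nf ng; rewrite !(leqNgt _ 2); lia.
have [a Ea] := homog1P (pihomogP mdeg 1 f); have [b Eb] := homog1P (pihomogP mdeg 1 g).
have Eq : q = lf a * lf b.
  have [x Ex] := homog0P (pihomogP mdeg 0 f); have [y Ey] := homog0P (pihomogP mdeg 0 g).
  have Ef : f = x%:MP + lf a.
    by rewrite (pihomog_partitionE sf) !big_ord_recl big_ord0 addr0 /= Ex Ea.
  have Eg : g = y%:MP + lf b.
    by rewrite (pihomog_partitionE sg) !big_ord_recl big_ord0 addr0 /= Ey Eb.
  rewrite -[LHS](pihomog_dE qh) E Ef Eg mulrDr raddfD /= (pihomogM _ _ (homogC y)).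
  rewrite (pihomogM _ _ (lf_homog b)) /= subn0 !raddfD /=.
  rewrite (pihomog_ne0 (d := 0) _ (homogC x)) // (pihomog_ne0 (d := 1) _ (lf_homog a)) //.
  rewrite (pihomog_ne0 (d := 0) _ (homogC x)) // (pihomog_dE (lf_homog a)).
  by rewrite !addr0 mul0r !add0r.
exists a, b; split=> //; apply: contraNneq q0 => z; rewrite Eq z.
  by rewrite -(scale0r (0 : 'rV[k]_3)) lfZ mpolyC0 !mul0r.
by rewrite -(scale0r (0 : 'rV[k]_3)) lfZ mpolyC0 mul0r mulr0.
Qed.

(** * The classification of the configurations *)

Section Configurations.
Variables (X : {fset point k}) (I : R -> Prop).
Local Notation J := (points_ideal X).
Hypotheses (X_card : size X = 6%N) (jacI : jacobian_of J I).

Lemma fold6_not_VV : fold_collinear 6 X -> ~ VV_torsion_free J I.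
Proof.
case=> L; rewrite size_points_on => cL; have [b0 [b1 [b01 _ _ La]]] := lineP L.
have [q fr] := frame_complete b01; set a := cross b0 b1 in La.
have XL P : P \in X -> dot a (rep P) = 0.
  move=> XP; apply/eqP; rewrite -(on_lineE P La).
  by have /allP : all (fun P => on_line P L) X; [rewrite all_count cL X_card | apply].
apply: (collinear_not_VV6 k_char0 fr (Y := map (nrep a) X) _ _ _ _ (map_nrep_pts a (fun=> erefl)) jacI).
- exact/map_nrep_uniq/fset_uniq.
- by move=> _ /mapP[P _ ->]; apply: nrep_neq0.
- by move=> _ /mapP[P XP ->]; apply/eqP; rewrite nrep_dot XL.
- exact: map_nrep_ind.
by rewrite size_map.
Qed.

Local Notation on_zeros a := (fun P : point k => dot a (rep P) == 0).

Lemma split_line a : exists s t : seq (point k), [/\ s ++ t =i X, uniq (s ++ t),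
  size (s ++ t) = 6%N, forall P, P \in s -> dot a (rep P) = 0 &
  forall P, P \in t -> dot a (rep P) != 0] /\ size s = count (on_zeros a) X.
Proof.
pose f P := dot a (rep P) == 0.
exists [seq P <- X | f P], [seq P <- X | ~~ f P]; split; last by rewrite size_filter.
have P : perm_eq ([seq P <- X | f P] ++ [seq P <- X | ~~ f P]) X by exact/permPl/perm_filterC.
split; [by move=> Q; rewrite (perm_mem P) | by rewrite (perm_uniq P) fset_uniq | by rewrite (perm_size P) | |].
  by move=> Q; rewrite mem_filter => /andP[/eqP].
by move=> Q; rewrite mem_filter => /andP[].
Qed.

Lemma fold5_not_VV : fold_collinear 5 X -> ~ VV_torsion_free J I.
Proof.
case=> L; rewrite size_points_on => cL; have [b0 [b1 [b01 _ _ La]]] := lineP L.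
set a := cross b0 b1 in La.
have [s [t [[stX stu st6 s0 t0] ss]]] := split_line a.
have s5 : size s = 5%N by rewrite ss -cL; apply: eq_count => P; rewrite (on_lineE P La).
case: t stX stu st6 t0 => [|P [|? ?]] stX stu st6 t0; last 2 first.
- have {}t0 : dot a (rep P) != 0 by apply: t0; rewrite inE.
  have fr : framed b0 b1 (nrep a P) := nrep_off t0.
  have pts : ideal_of_points (nrep a P :: map (nrep a) s) J.
    apply: (@map_nrep_pts a (P :: s)) => Q; by rewrite -stX mem_cat !inE orbC.
  apply: (collinear_not_VV5 k_char0 fr (Y := map (nrep a) s) _ _ _ _ pts jacI).
  + by apply: map_nrep_uniq; move: stu; rewrite cat_uniq => /andP[].
  + by move=> _ /mapP[Q _ ->]; apply: nrep_neq0.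
  + by move=> _ /mapP[Q sQ ->]; apply/eqP; rewrite nrep_dot s0.
  + exact: map_nrep_ind.
  by rewrite size_map.
- by move: st6; rewrite size_cat s5.
by move: st6; rewrite cats0 s5.
Qed.

Lemma enum6 : exists P1 P2 P3 P4 P5 P6, X =i [:: P1; P2; P3; P4; P5; P6]
  /\ uniq [:: P1; P2; P3; P4; P5; P6].
Proof.
have := X_card; have := fset_uniq X; have : X =i (X : seq _) by [].
case: (enum_fset X) => [|P1 [|P2 [|P3 [|P4 [|P5 [|P6 [|? ?]]]]]]] // XE U _.
by exists P1, P2, P3, P4, P5, P6.
Qed.

Lemma conic_not_VV : on_irreducible_conic X -> ~ VV_torsion_free J I.
Proof.
case=> q [qh irr q0]; have [P1 [P2 [P3 [P4 [P5 [P6 [XE U]]]]]]] := enum6.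
have pts := map_nrep_pts 0 (fun P => esym (XE P)).
have qr P : P \in X -> ev (nrep 0 P) q = 0.
  by move=> XP; apply: q0 XP _ (nrep_in 0 P) (nrep_neq0 0 P).
have pol P Q : P \in X -> Q \in X -> P != Q -> ev (nrep 0 P) (dd (nrep 0 Q) q) != 0.
  by move=> XP XQ PQ; apply: irreducible_conic_polar; rewrite ?qr ?nrep_ind.
have PX n : (n < 6)%N -> nth P1 [:: P1; P2; P3; P4; P5; P6] n \in X.
  by move=> n6; rewrite XE mem_nth.
have [n12 n34 n56] := uniq_pairs6 U.
have pol12 := pol P1 P2 (PX 0 isT) (PX 1 isT) n12.
have pol34 := pol P3 P4 (PX 2 isT) (PX 3 isT) n34.
have pol56 := pol P5 P6 (PX 4 isT) (PX 5 isT) n56.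
apply: (three_pairs_not_VV k_char0 qh (map_nrep_uniq 0 U) _ _ pol12 pol34 pol56 pts jacI).
- exact: (@map_nrep_ind 0 [:: P1; P2; P3; P4; P5; P6]).
- by move=> _ /(@mapP _ _ (nrep 0) [:: P1; P2; P3; P4; P5; P6])[P sP ->]; apply: qr; rewrite XE.
Qed.

(** Each pair takes one point from each line. The polar form of [lf a * lf b] at such a pair is a
    product of two nonzero values, because no point of X is on both lines. *)
Lemma triples_not_VV : two_collinear_triples X -> ~ VV_torsion_free J I.
Proof.
case=> L [M [cL XM [Q LMQ XQ]]]; have {}cL : size (points_on X L) = 3%N := cL.
have [b0 [b1 [_ _ _ La]]] := lineP L; have [c0 [c1 [_ _ _ Mb]]] := lineP M.
set a := cross b0 b1 in La; set b := cross c0 c1 in Mb.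
have [s [t [[stX stu st6 s0 t0] ss]]] := split_line a.
have s3 : size s = 3%N.
  by rewrite ss -cL size_points_on; apply: eq_count => P; rewrite (on_lineE P La).
have tb P : P \in t -> dot b (rep P) = 0.
  move=> tP; apply/eqP; rewrite -(on_lineE P Mb); apply: XM; first by rewrite -stX mem_cat tP orbT.
  by rewrite (on_lineE P La) t0.
have sb P : P \in s -> dot b (rep P) != 0.
  move=> sP; apply: contraNneq XQ => bP.
  have -> : Q = P; last by rewrite -stX mem_cat sP.
  have QP : rep P \in subsp_val Q by rewrite -LMQ memv_cap La Mb s0 // bP eqxx.
  apply: subsp_val_inj.
  by rewrite (point_line QP (rep_neq0 P)) (point_line (rep_in P) (rep_neq0 P)).
have t3 : size t = 3%N by move: st6; rewrite size_cat s3 => -[].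
have pol P P' : P \in s -> P' \in t -> ev (nrep a P) (dd (nrep a P') (lf a * lf b)) != 0.
  move=> sP tP'; have aP : dot a (nrep a P) = 0 by apply/eqP; rewrite nrep_dot s0.
  rewrite ddM mevalD !mevalM !lf_eval !dd_lf !mevalC aP mul0r addr0.
  by rewrite mulf_eq0 !nrep_dot negb_or t0 // sb.
have qP P : P \in X -> ev (nrep a P) (lf a * lf b) = 0.
  rewrite mevalM !lf_eval -stX mem_cat => /orP[/s0|/tb] E; apply/eqP.
    by rewrite mulf_eq0 nrep_dot E eqxx.
  by rewrite mulf_eq0 !nrep_dot E eqxx orbT.
case: s s3 stX stu {ss st6 s0 sb} pol => [|P1 [|P2 [|P3 [|? ?]]]] // _.
case: t t3 {t0 tb} => [|P4 [|P5 [|P6 [|? ?]]]] // _ stX stu pol.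
have pm : perm_eq ([:: P1; P2; P3] ++ [:: P4; P5; P6]) [:: P1; P4; P2; P5; P3; P6].
  by apply/permP => f /=; lia.
have sP n : (n < 3)%N -> nth P1 [:: P1; P2; P3] n \in [:: P1; P2; P3].
  by move=> n3; exact: (@mem_nth _ P1 [:: P1; P2; P3]).
have tP n : (n < 3)%N -> nth P1 [:: P4; P5; P6] n \in [:: P4; P5; P6].
  by move=> n3; exact: (@mem_nth _ P1 [:: P4; P5; P6]).
have U : uniq [:: P1; P4; P2; P5; P3; P6] by rewrite -(perm_uniq pm).
have XE : [:: P1; P4; P2; P5; P3; P6] =i X by move=> P; rewrite -(perm_mem pm).
apply: (three_pairs_not_VV k_char0 (dhomogM (lf_homog a) (lf_homog b)) (map_nrep_uniq a U)
  _ _ (pol _ _ (sP 0 isT) (tP 0 isT)) (pol _ _ (sP 1 isT) (tP 1 isT)) (pol _ _ (sP 2 isT) (tP 2 isT))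
  (map_nrep_pts a XE) jacI).
- exact: (@map_nrep_ind a [:: P1; P4; P2; P5; P3; P6]).
- by move=> _ /(@mapP _ _ (nrep a) [:: P1; P4; P2; P5; P3; P6])[P sP' ->]; apply: qP; rewrite -XE.
Qed.

Lemma four_on_line_VV a : a != 0 -> count (on_zeros a) X = 4%N ->
  VV_torsion_free J I.
Proof.
move=> a0 c4; have [s [t [[stX stu st6 s0 t0] ss]]] := split_line a.
have s4 : size s = 4%N by rewrite ss.
have t2 : size t = 2%N by move: st6; rewrite size_cat s4 => -[].
case: t t2 stX stu t0 {st6} => [|P5 [|P6 [|? ?]]] // _ stX stu t0.
have a5 : dot a (nrep a P5) = 1 by apply/nrep_off/t0; rewrite !inE eqxx.
have a6 : dot a (nrep a P6) = 1 by apply/nrep_off/t0; rewrite !inE eqxx orbT.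
have P56 : P5 != P6.
  by apply: contraTneq stu => ->; rewrite cat_uniq /= !inE eqxx !andbF.
set e1 := nrep a P5 in a5; set e2 := nrep a P6 in a6.
(* With this [y] the vector [cross a y] is on the line and completes [e1], [e2] to a frame of
   determinant 1, in which [a] has the dual coordinates (0, 1, 1). *)
have [y ye] : exists y, dot (e2 - e1) y = 1.
  apply: dot_surj; apply: contraNneq (nrep_ind a P56) => /eqP; rewrite subr_eq0 => /eqP E.
  by apply/eqP; rewrite -/e1 -/e2 E; rvring.
have fr : framed (cross a y) e1 e2.
  transitivity (dot a e1 * dot e2 y - dot a e2 * dot e1 y); first by vring.
  by rewrite a5 a6 !mul1r -[RHS]ye; vring.
set e0 := cross a y in fr.
have Ea : cross e2 e0 + cross e0 e1 = a.
  rewrite -[RHS]scale1r -[X in X *: _]fr.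
  transitivity (dot a e0 *: cross e1 e2 + dot a e1 *: cross e2 e0 + dot a e2 *: cross e0 e1).
    rewrite a5 a6 !scale1r; have -> : dot a e0 = 0 by vring.
    by rewrite scale0r add0r.
  by rvring.
case: s s4 stX stu s0 {ss} => [|P1 [|P2 [|P3 [|P4 [|? ?]]]]] // _ stX stu s0.
have XE : [:: P5; P6; P1; P2; P3; P4] =i X.
  by move=> P; rewrite -stX; apply: perm_mem; apply/permP => f /=; lia.
have U : uniq [:: P1; P2; P3; P4] by move: stu; rewrite cat_uniq => /andP[].
apply: (four_collinear_VV k_char0 fr (map_nrep_uniq a U) _ _ (map_nrep_pts a XE) jacI).
- exact: (@map_nrep_ind a [:: P1; P2; P3; P4]).
rewrite Ea => _ /(@mapP _ _ (nrep a) [:: P1; P2; P3; P4])[P sP ->].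
by rewrite nrep_neq0; split=> //; apply/eqP; rewrite nrep_dot s0.
Qed.

(** A nonzero conic through five of the points misses the sixth, which provides separators of degree
    two. *)
Lemma no_conic_through_VV :
  (forall q, q \is 2.-homog -> (forall P, P \in X -> ev (nrep 0 P) q = 0) -> q = 0) ->
  VV_torsion_free J I.
Proof.
move=> noq; have pts := map_nrep_pts 0 (fun=> erefl) : ideal_of_points (map (nrep 0) X) J.
have [_ _ evJ _] := pts.
apply: (no_conic_VV k_char0 pts jacI) => [_ /mapP[P _ ->]|p sp|d f d2 fh Jf].
- exact: nrep_neq0.
- have [|E [E0 Eh Ev]] := @conic_through (rem p (map (nrep 0) X)).
    by rewrite size_rem // size_map X_card.
  exists E; split=> // [|p' sp' pp']; last first.
    by apply: Ev; rewrite mem_rem_uniq ?inE ?pp' //; apply/map_nrep_uniq/fset_uniq.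
  apply: contraNneq E0 => Ep; apply/eqP/noq => // P XP.
  case: (eqVneq (nrep 0 P) p) => [->//|Pp].
  by apply: Ev; rewrite mem_rem_uniq ?inE ?Pp ?map_f //; apply/map_nrep_uniq/fset_uniq.
have [P1 _] := enum6; have l0 := lf_neq0 (rep_neq0 P1).
(* A form of degree below two is raised to a conic by a power of a nonzero linear form. *)
have /eqP : f * lf (rep P1) ^+ (2 - d) = 0.
  apply: noq => [|P XP]; last by rewrite mevalM (evJ _ _ Jf) ?mul0r ?map_f.
  have := dhomogM fh (dhomogMn (2 - d) (lf_homog (rep P1))).
  by rewrite mul1n subnKC.
by rewrite mulf_eq0 expf_eq0 (negPf l0) andbF orbF => /eqP.
Qed.

Lemma fold_of_count n a : a != 0 -> count (on_zeros a) X = n ->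
  fold_collinear n X.
Proof.
move=> a0 <-; have [L La] := line_of a0; exists L.
by rewrite size_points_on; apply: eq_count => P; rewrite (on_lineE P La).
Qed.

(** Six points are covered by two sets of at most three, so each line has exactly three and their
    intersection is not in X. *)
Lemma triples_of_count a b : a != 0 -> b != 0 ->
  (forall P, P \in X -> dot a (rep P) = 0 \/ dot b (rep P) = 0) ->
  (count (on_zeros a) X <= 3)%N -> (count (on_zeros b) X <= 3)%N ->
  two_collinear_triples X.
Proof.
move=> a0 b0 abX; set f := on_zeros a; set g := on_zeros b.
move=> cf cg; have := count_predUI f g X.
have -> : count (predU f g) X = 6%N.
  rewrite -X_card; apply/eqP; rewrite -all_count; apply/allP => P /abX /= [] E.
    by rewrite /f E eqxx.
  by rewrite /g E eqxx orbT.
move=> E; have [f3 fg0] : count f X = 3%N /\ count (predI f g) X = 0%N by split; lia.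
have disj P : P \in X -> dot a (rep P) = 0 -> dot b (rep P) != 0.
  move=> XP aP; apply/eqP => bP; move/eqP: fg0; rewrite -leqn0 leqNgt -has_count => /hasPn/(_ P XP).
  by rewrite /= /f /g aP bP eqxx.
have [P0 XP0 /eqP aP0] : exists2 P, P \in X & f P by apply/hasP; rewrite has_count f3.
have ab : cross a b != 0.
  apply: contraNneq (disj _ XP0 aP0) => /(crossP a0)[x ->]; rewrite dotC dotZr dotC.
  by rewrite aP0 mulr0.
have [L La] := line_of a0; have [M Mb] := line_of b0.
have dQ : \dim <[cross a b]> == 1%N by rewrite dim_vline ab.
exists L, M; split.
- by rewrite size_points_on -[RHS]f3; apply: eq_count => P; rewrite (on_lineE P La).
- by move=> P /abX[] E'; rewrite (on_lineE P La) (on_lineE P Mb) E' eqxx.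
exists (Subsp dQ).
  apply/vspaceP => v; rewrite memv_cap La Mb /=; apply/andP/vlineP => [[/eqP av /eqP bv]|[x ->]].
    exact: orth2P.
  by split; apply/eqP; vring.
apply/negP => XQ; have /vlineP[x Ex] := rep_in (Subsp dQ).
have /(disj _ XQ)/negP : dot a (rep (Subsp dQ)) = 0 by rewrite Ex; vring.
by apply; apply/eqP; rewrite Ex; vring.
Qed.

Lemma configurations_of_not_VV : ~ VV_torsion_free J I ->
  [\/ fold_collinear 6 X, fold_collinear 5 X, two_collinear_triples X | on_irreducible_conic X].
Proof.
move=> nVV; have [q [qh q0 qX]] : exists q : R, [/\ q \is 2.-homog, q != 0 &
    forall P, P \in X -> ev (nrep 0 P) q = 0].
  apply: NNPP => H; apply: nVV; apply: no_conic_through_VV => q qh qX.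
  by apply/eqP; apply: contraT => q0; case: H; exists q.
case: (classic (irreducible_elt q)) => [irr|/(reducible_conic q0 qh)[a [b [a0 b0 Eq]]]].
  constructor 4; exists q; split=> // P XP v.
  rewrite (point_line (nrep_in 0 P) (nrep_neq0 0 P)) => /vlineP[x ->] _.
  by rewrite (homog_eval _ _ qh) qX // mulr0.
have abX P : P \in X -> dot a (rep P) = 0 \/ dot b (rep P) = 0.
  move=> /qX/eqP; rewrite Eq mevalM !lf_eval mulf_eq0 !nrep_dot.
  by case/orP => /eqP; [left | right].
have few c : c != 0 -> [\/ fold_collinear 6 X, fold_collinear 5 X |
    (count (on_zeros c) X <= 3)%N].
  move=> c0; have : (count (on_zeros c) X <= 6)%N by rewrite -X_card count_size.
  case E : (count _ X) => [|[|[|[|[|[|[|n]]]]]]] // _; try by constructor 3.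
  - by case: nVV; apply: four_on_line_VV E.
  - by constructor 2; apply: fold_of_count E.
  by constructor 1; apply: fold_of_count E.
case: (few a a0) => [H|H|ca]; [by constructor 1 | by constructor 2 |].
case: (few b b0) => [H|H|cb]; [by constructor 1 | by constructor 2 |].
by constructor 3; apply: (triples_of_count a0 b0).
Qed.

End Configurations.

End PointsAndLines.

Local Close Scope ring_scope.

Theorem proposition3p5 (k : closedFieldType) (k_char0 : [pchar k]%R =i pred0)
    (X : {fset point k}) (X_card : #|` X|%fset = 6)
    (m : nat) (F : m.-tuple {mpoly k[3]})
    (F_gen : homog_generators (points_ideal X) F) :
  ~ VV_torsion_free (points_ideal X) (jacobian_ideal (points_ideal X) F) <->
  [\/ fold_collinear 6 X, fold_collinear 5 X,
      two_collinear_triples X | on_irreducible_conic X].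
Proof.
have jacI := jacobian_ideal_of (ideal_gen_ideal _) F_gen.
split; first exact: (configurations_of_not_VV k_char0 X_card jacI).
case; [exact: (fold6_not_VV k_char0 X_card jacI) | exact: (fold5_not_VV k_char0 X_card jacI) |
  exact: (triples_not_VV k_char0 X_card jacI) | exact: (conic_not_VV k_char0 X_card jacI)].
Qed.
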